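(* Let $\Lambda\subset\mathbb{C}$ be a lattice of covolume $\frac{\pi}{2}$. Then there is a constant $K>1$, depending only on $\Lambda$, such that for every integer $N\ge1$ and every real $\beta>0$, $$1\le\varTheta_{N,\beta}(\mathbb{C}/\Lambda)\le K^{\beta}.$$
   Context: A lattice $\Lambda=\omega_1\mathbb{Z}+\omega_2\mathbb{Z}\subset\mathbb{C}$ is a discrete additive subgroup with two $\mathbb{R}$-linearly independent generators; its covolume is the area of a fundamental parallelogram. $\mathrm{dA}$ is area measure on $\mathbb{C}$, also used on $\mathbb{C}/\Lambda$. Let $\sigma$ be the Weierstrass sigma function of $\Lambda$, $$\sigma(z)=z\prod_{0\ne\omega\in\Lambda}\Big(1-\frac z\omega\Big)\exp\Big\{\frac z\omega+\frac{z^2}{2\omega^2}\Big\}.$$ The modified sigma function is $\sigma_\ast(z)=\mathrm{e}^{bz^2}\sigma(z)$, where $b\in\mathbb{C}$ is the unique constant such that $\mathrm{e}^{-|z|^2}|\sigma_\ast(z)|$ is $\Lambda$-periodic (it exists because the covolume is $\frac\pi2$; if the generators are chosen with $\omega_1>0$ and $\operatorname{Im}\omega_2>0$, then $b=1-\frac{\lambda_1}{2\omega_1}$ with $\lambda_1=2\zeta(\omega_1/2)$, $\zeta=\sigma'/\sigma$). Put $$A_\Lambda=\frac2\pi\int_{\mathbb{C}/\Lambda}(\log|\sigma_\ast(z)|-|z|^2)\,\mathrm{dA}(z),$$ and define the unipolar Green function $$U_{\mathbb{C}/\Lambda}(z,w)=\log|\sigma_\ast(z-w)|-|z-w|^2-A_\Lambda,\qquad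 z,w\in\mathbb{C}.$$ For an integer $N\ge1$ and real $\beta>-2$, the packing number is $$\varTheta_{N,\beta}(\mathbb{C}/\Lambda)=\inf_{w_1,\ldots,w_N\in\mathbb{C}}\frac2\pi\int_{\mathbb{C}/\Lambda}\exp\big(\beta U_{\mathbb{C}/\Lambda}(z,w_1)+\cdots+\beta U_{\mathbb{C}/\Lambda}(z,w_N)\big)\,\mathrm{dA}(z).$$ *)

(* Defs.v *)
From mathcomp Require Import all_boot all_order all_algebra.
From mathcomp Require Import finmap complex.
From mathcomp Require Import all_classical all_reals all_analysis.
From mathcomp Require summability.

Set Implicit Arguments.
Unset Strict Implicit.
Unset Printing Implicit Defensive.

Import Order.TTheory GRing.Theory Num.Theory.
Import numFieldNormedType.Exports.

Local Open Scope classical_set_scope.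
Local Open Scope complex_scope.
Local Open Scope ring_scope.

Section Lattice.
Variable R : realType.
Implicit Types (L : set R[i]) (z w om : R[i]).

(* The norm [`|z|] of [R[i]] takes its values in [R[i]]; this is the same
   modulus as an element of [R]. *)
Definition cabs z : R := complex.Re `|z|.

Definition cexp z : R[i] :=
  (expR (complex.Re z))%:C * (cos (complex.Im z) +i* sin (complex.Im z)).

Definition lattice_basis L (b : R[i] * R[i]) : Prop :=
  (forall s t : R, s%:C * b.1 + t%:C * b.2 = 0 -> s = 0 /\ t = 0) /\
  L = [set om | exists m n : int, om = m%:~R * b.1 + n%:~R * b.2].

Definition is_lattice L : Prop := exists b, lattice_basis L b.

(* A chosen basis: neither the covolume nor the integral of a periodic function
   over the fundamental parallelogram depends on the choice. *)
Definition basis_of_lattice L : R[i] * R[i] := xget (0, 0) (lattice_basis L).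

(* [C] is identified with [R * R], whose area is the product measure. *)
Definition complex_of_pair (p : R * R) : R[i] := p.1 +i* p.2.

Definition area : {measure set (measurableTypeR R * measurableTypeR R) -> \bar R} :=
  (@lebesgue_measure R \x @lebesgue_measure R)%E.

Definition fundamental_parallelogram L : set (R * R) :=
  [set p | exists s t : R, [/\ 0 <= s < 1, 0 <= t < 1 &
    complex_of_pair p =
      s%:C * (basis_of_lattice L).1 + t%:C * (basis_of_lattice L).2]].

Definition covolume L : \bar R := area (fundamental_parallelogram L).

(* The integral of an [L]-periodic function over the torus [C / L]. *)
Definition torus_integral L (f : R[i] -> \bar R) : \bar R :=
  (\int[area]_(p in fundamental_parallelogram L) f (complex_of_pair p))%E.

Definition lattice_periodic L (f : R[i] -> R) : Prop :=
  forall z om, L om -> f (z + om) = f z.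

Definition weierstrass_factor z om : R[i] :=
  (1 - z / om) * cexp (z / om + z ^+ 2 / (2 * om ^+ 2)).

(* The infinite product is unconditional: the limit is taken along the finite
   sets of complex numbers directed by inclusion. *)
Definition sigma L z : R[i] :=
  z * (lim ((fun F : {fset R[i]} =>
     \prod_(om <- F | (om != 0) && (om \in L)) weierstrass_factor z om : R[i]^o)
       @ summability.totally)).

Definition sigma_star_with L (b : R[i]) z : R[i] := cexp (b * z ^+ 2) * sigma L z.

(* Such a constant exists, and is unique, when [L] has covolume [pi / 2]. *)
Definition sigma_star_const L : R[i] :=
  xget 0 [set b | lattice_periodic L
    (fun z => expR (- cabs z ^+ 2) * cabs (sigma_star_with L b z))].

Definition sigma_star L : R[i] -> R[i] := sigma_star_with L (sigma_star_const L).

Local Open Scope ereal_scope.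

(* [log |sigma_star z| - |z|^2], with value [-oo] at the points of [L] *)
Definition log_sigma_star L z : \bar R :=
  lne (cabs (sigma_star L z))%:E - (cabs z ^+ 2)%:E.

Definition green_const L : \bar R :=
  (2 / pi)%:E * torus_integral L (log_sigma_star L).

Definition green L z w : \bar R := log_sigma_star L (z - w)%R - green_const L.

Definition packing_number L (N : nat) (beta : R) : \bar R :=
  ereal_inf [set (2 / pi)%:E *
      torus_integral L (fun z => expeR (\sum_(i < N) beta%:E * green L z (w i)))
    | w in [set: 'I_N -> R[i]]].

End Lattice.

(* Main.v *)
Require Import Defs.
From HB Require Import structures.
From mathcomp Require Import all_boot all_order all_algebra.
From mathcomp Require Import finmap complex.
From mathcomp Require Import all_classical all_reals all_analysis.
From mathcomp Require Import measurable_realfun.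
From mathcomp Require summability.
From mathcomp Require Import ring lra zify.

(** Write z = s b1 + t b2 in the real coordinates of a basis (b1, b2), let
tau = b2 / b1, h = |Im tau|, and let e(x) = exp(2 pi i x). The function

  psi(s,t) = exp(- pi h B(t)) prod_(n in Z) |1 - e(x_n + i |y_n|)|,

with x_n + i y_n = s + (t + n) tau and B the periodic extension of the second
Bernoulli polynomial t^2 - t + 1/6, has period 1 in s and in t. The first half
of the proof identifies exp(-|z|^2) |sigma_star(z)| with a constant multiple of
psi (sigma_star_formula). The Weierstrass product is summed over boxes of
lattice points, row after row; each row is a product for the sine
(sine_product), and the exponential factors contribute only exp(Re(c z^2)) for
some constant c (sigma_formula). When the covolume is pi/2, the remaining
quadratic exponent is exactly the one that periodicity allows, and periodicity
determines c.

In these coordinates the integral over the torus is pi/2 times the mean over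
the unit square, so everything is about psi. The decisive fact is that log psi
has mean zero. The Bernoulli term has mean zero. For the theta product
theta_tau, the multiplication formula

  prod_(0 <= j < n) theta_tau(s + j/n, t) = theta_(n tau)(n s, t)

(prod_theta) makes n times the mean of log theta_tau over a row equal to the
mean of log theta_(n tau), which stays bounded as n grows when 0 < t < 1; so
the mean over each row vanishes (theta_gap_row). It follows that the constant
A_Lambda is the logarithm of the constant in front of psi, and that the Green
function is log psi(s - u, t - v) (greenE).

The lower bound is e^x >= 1 + x, applied to x = beta sum_i U(z, w_i) and
integrated: the mean of x is zero by translation invariance
(mean_psi_power_ge1).

The upper bound follows from one configuration for which the product of the
translates of psi is bounded independently of N (good_configuration). About
sqrt N horizontal rows are used, each carrying about sqrt N equally spaced
points, at heights that cut [0, 1] into cells of lengths proportional to the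
numbers of points. By the multiplication formula a row of n points at height y
contributes exp(- pi n h B(t - y)) times a theta product that exceeds 1 at most
by factors exp(O(exp(- 2 pi n h |t - y + m|))), m in Z. The sum of n B(t - y)
over the rows is a midpoint sum for the integral of N B over a period, which is
zero, with bounded error (sum_bern); the sum of the exponentials is compared
with the integral of exp(- a |x|) over the line, with a of order sqrt N
(sum_decay). Both comparisons telescope through explicit primitives. The
constant K is the resulting bound of the product. *)

Set Implicit Arguments.
Unset Strict Implicit.
Unset Printing Implicit Defensive.
Import Order.TTheory GRing.Theory Num.Theory.
Import numFieldNormedType.Exports.
Local Open Scope classical_set_scope.
Local Open Scope complex_scope.
Local Open Scope ring_scope.

(** * Modulus and exponential of a complex number *)

Section Cabs.
Variable R : realType.
Implicit Types z w : R[i].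
Lemma cabsE z : `|z| = (cabs z)%:C.
Proof. by rewrite /cabs normc_def. Qed.

Lemma cabs_sqr z : cabs z ^+ 2 = complex.Re z ^+ 2 + complex.Im z ^+ 2.
Proof. by rewrite /cabs normc_def /= sqr_sqrtr // addr_ge0 // sqr_ge0. Qed.

Lemma cabs_ge0 z : 0 <= cabs z.
Proof. by rewrite /cabs normc_def /= sqrtr_ge0. Qed.

Lemma cabsM z w : cabs (z * w) = cabs z * cabs w.
Proof. by apply: complexI; rewrite -cabsE rmorphM /= -!cabsE normrM. Qed.

Lemma cabsD z w : cabs (z + w) <= cabs z + cabs w.
Proof. by rewrite -lecR rmorphD /= -!cabsE ler_normD. Qed.

Lemma cabsN z : cabs (- z) = cabs z.
Proof. by rewrite /cabs normrN. Qed.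

Lemma cabsB z w : cabs (z - w) = cabs (w - z).
Proof. by rewrite /cabs distrC. Qed.

Lemma cabsV z : cabs z^-1 = (cabs z)^-1.
Proof. by apply: complexI; rewrite -cabsE fmorphV /= -!cabsE normfV. Qed.

Lemma cabs0 : cabs (0 : R[i]) = 0.
Proof. by rewrite /cabs normr0. Qed.

Lemma cabs1 : cabs (1 : R[i]) = 1.
Proof. by rewrite /cabs normr1. Qed.

Lemma cabs_eq0 z : (cabs z == 0) = (z == 0).
Proof. by rewrite -(inj_eq (@complexI R)) -cabsE normr_eq0. Qed.

Lemma cabs_real (x : R) : cabs x%:C = `|x|.
Proof. by rewrite /cabs normc_def /= expr0n addr0 sqrtr_sqr. Qed.

Lemma cabsX z n : cabs (z ^+ n) = cabs z ^+ n.
Proof. by elim: n => [|n IH]; rewrite ?expr0 ?cabs1 // !exprS cabsM IH. Qed.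

Lemma cabs_prod (I : Type) (s : seq I) (P : pred I) (F : I -> R[i]) :
  cabs (\prod_(i <- s | P i) F i) = \prod_(i <- s | P i) cabs (F i).
Proof. by elim/big_ind2 : _ => [|x a y b <- <-|]; rewrite ?cabs1 ?cabsM. Qed.

Lemma cabs_cexp z : cabs (cexp z) = expR (complex.Re z).
Proof.
rewrite /cexp cabsM cabs_real ger0_norm ?expR_ge0 // -[RHS]mulr1; congr (_ * _).
by rewrite /cabs normc_def /= cos2Dsin2 sqrtr1.
Qed.

Lemma cexpD z w : cexp (z + w) = cexp z * cexp w.
Proof.
case: z w => [a b] [c d]; rewrite /cexp /= expRD sinD cosD.
by apply/eqP; rewrite eq_complex /=; apply/andP; split; apply/eqP; ring.
Qed.

Lemma cexp0 : cexp (0 : R[i]) = 1.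
Proof. by rewrite /cexp /= expR0 cos0 sin0 mul1r. Qed.

Lemma normRe_le z : `|complex.Re z| <= cabs z.
Proof. by rewrite -lecR -cabsE normc_ge_Re. Qed.

Lemma normIm_le z : `|complex.Im z| <= cabs z.
Proof.
rewrite -ler_sqr ?nnegrE ?cabs_ge0 // cabs_sqr -normrX ger0_norm ?sqr_ge0 //.
by rewrite lerDr sqr_ge0.
Qed.

Lemma cabs_le_ReIm z : cabs z <= `|complex.Re z| + `|complex.Im z|.
Proof.
rewrite -ler_sqr ?nnegrE ?cabs_ge0 ?addr_ge0 // cabs_sqr.
rewrite sqrrD !real_normK ?num_real // addrAC lerDl.
by rewrite mulrn_wge0 // mulr_ge0.
Qed.

Lemma realCB (a b : R) : (a - b)%:C = a%:C - b%:C :> R[i].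
Proof. exact: (rmorphB (real_complex R)). Qed.

Lemma realCM (a b : R) : (a * b)%:C = a%:C * b%:C :> R[i].
Proof. exact: (rmorphM (real_complex R)). Qed.

Lemma realCV (a : R) : (a^-1)%:C = (a%:C)^-1 :> R[i].
Proof. exact: (fmorphV (real_complex R)). Qed.
End Cabs.

(** * Taylor remainders of the complex exponential *)

Section Taylor.
Variable R : realType.
Implicit Types z w : R[i].

(** The mean value theorem over [0, 1]. *)
Lemma norm_increment_le (f df : R -> R) (B : R) :
  (forall x : R, is_derive x (1:R) f (df x)) ->
  (forall x, 0 <= x <= 1 -> `|df x| <= B) -> `|f 1 - f 0| <= B.
Proof.
move=> fdf dfB.
have fc : {within `[0, 1], continuous f}.
  apply: continuous_subspaceT => x.
  by apply: differentiable_continuous; apply/derivable1_diffP; case: (fdf x).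
have [c] := MVT_segment ler01 (fun x _ => fdf x) fc.
rewrite in_itv /= subr0 mulr1 => c01 ->; exact: dfB.
Qed.

(** Complex-valued functions of a real variable are differentiated through their
real and imaginary parts, so that no norm on the complex field is involved. *)
Definition path_derive (f df : R -> R[i]) := forall x : R,
  is_derive x (1:R) (fun t => complex.Re (f t)) (complex.Re (df x)) /\
  is_derive x (1:R) (fun t => complex.Im (f t)) (complex.Im (df x)).

(** The mean value theorem fails for complex values; applying it to the real and
the imaginary parts separately costs the factor 2. *)
Lemma cabs_increment_le (f df : R -> R[i]) (B : R) : path_derive f df ->
  (forall x, 0 <= x <= 1 -> cabs (df x) <= B) -> cabs (f 1 - f 0) <= 2 * B.
Proof.
move=> fdf dfB; apply: le_trans (cabs_le_ReIm _) _.
rewrite mulr_natl mulr2n !raddfB lerD //.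
- apply: norm_increment_le (fun x => (fdf x).1) _ => x x01.
  exact: le_trans (normRe_le _) (dfB x x01).
- apply: norm_increment_le (fun x => (fdf x).2) _ => x x01.
  exact: le_trans (normIm_le _) (dfB x x01).
Qed.

Lemma path_deriveB (f df g dg : R -> R[i]) : path_derive f df -> path_derive g dg ->
  path_derive (fun t => f t - g t) (fun t => df t - dg t).
Proof.
move=> F G x; have [F1 F2] := F x; have [G1 G2] := G x; rewrite !raddfB; split.
- rewrite (_ : (fun t => _) = (fun t => complex.Re (f t)) - (fun t => complex.Re (g t))).
    exact: is_deriveB.
  by apply/funext => t; rewrite raddfB.
- rewrite (_ : (fun t => _) = (fun t => complex.Im (f t)) - (fun t => complex.Im (g t))).
    exact: is_deriveB.
  by apply/funext => t; rewrite raddfB.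
Qed.

Lemma is_derive_mulr_cst (u : R -> R) (du a x : R) : is_derive x (1:R) u du ->
  is_derive x (1:R) (fun t => u t * a) (du * a).
Proof.
move=> H; apply: is_derive_eq (is_deriveM H (is_derive_cst a x (1:R))) _.
by rewrite /cst /GRing.scale /= mulr0 add0r mulrC.
Qed.

Lemma path_derive_real (u du : R -> R) (w : R[i]) : (forall x : R, is_derive x (1:R) u (du x)) ->
  path_derive (fun t => (u t)%:C * w) (fun t => (du t)%:C * w).
Proof.
case: w => a b H x /=; rewrite !mul0r subr0 addr0; split.
- under eq_fun do rewrite subr0; exact: is_derive_mulr_cst.
- under eq_fun do rewrite addr0; exact: is_derive_mulr_cst.
Qed.

Lemma is_derive_comp_mulr (f : R -> R) (df a x : R) : is_derive (x * a) (1:R) f df ->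
  is_derive x (1:R) (fun t => f (t * a)) (a * df).
Proof.
move=> H; rewrite mulrC; apply: is_derive1_comp.
by have := is_derive_mulr_cst a (is_derive_id x (1:R)); rewrite mul1r.
Qed.

Definition ray (w : R[i]) (t : R) := cexp (t%:C * w).
Lemma path_derive_ray w : path_derive (ray w) (fun t => w * ray w t).
Proof.
case: w => a b x.
have E := is_derive_comp_mulr (is_derive_expR (x * a)).
have rayE t : ray (a +i* b) t = (expR (t * a) * cos (t * b)) +i* (expR (t * a) * sin (t * b)).
  rewrite /ray /cexp /= !mul0r !(addr0, subr0).
  by apply/eqP; rewrite eq_complex /= !mul0r !(addr0, subr0) !eqxx.
under eq_fun do rewrite rayE; under [X in _ /\ is_derive _ _ X _]eq_fun do rewrite rayE.
rewrite rayE /=; split.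
- apply: is_derive_eq (is_deriveM E (is_derive_comp_mulr (is_derive_cos (x * b)))) _.
  by rewrite /GRing.scale /=; ring.
- apply: is_derive_eq (is_deriveM E (is_derive_comp_mulr (is_derive_sin (x * b)))) _.
  by rewrite /GRing.scale /=; ring.
Qed.

Lemma cabs_rayM_le w (x : R) : 0 <= x <= 1 -> cabs (x%:C * w) <= cabs w.
Proof. by move=> /andP[x0 x1]; rewrite cabsM cabs_real ger0_norm // ler_piMl ?cabs_ge0. Qed.

Lemma ray1 w : ray w 1 = cexp w.
Proof. by rewrite /ray mul1r. Qed.

Lemma ray0 w : ray w 0 = 1.
Proof. by rewrite /ray mul0r cexp0. Qed.

(** Each Taylor remainder is the integral along the ray of the preceding one, which
is why the three bounds are obtained successively and the constant doubles. *)
Lemma cexp_taylor0 w : cabs (cexp w - 1) <= 2 * (cabs w * expR (cabs w)).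
Proof.
rewrite -ray1 -(ray0 w); apply: cabs_increment_le (path_derive_ray w) _ => x x01.
rewrite cabsM ler_wpM2l ?cabs_ge0 // /ray cabs_cexp ler_expR.
exact: le_trans (ler_norm _) (le_trans (normRe_le _) (cabs_rayM_le w x01)).
Qed.

Lemma cexp_taylor1 w : cabs (cexp w - 1 - w) <= 4 * (cabs w ^+ 2 * expR (cabs w)).
Proof.
have P := path_deriveB (path_derive_ray w) (path_derive_real w (fun x => is_derive_id x (1:R))).
rewrite (_ : 4 * _ = 2 * (2 * (cabs w ^+ 2 * expR (cabs w)))); last by ring.
have := cabs_increment_le P (B := 2 * (cabs w ^+ 2 * expR (cabs w))).
rewrite ray1 ray0 mul0r mul1r subr0 addrAC; apply => x x01.
rewrite (_ : _ - w = w * (ray w x - 1)); last by ring.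
rewrite cabsM expr2 -mulrA [leRHS]mulrCA ler_wpM2l ?cabs_ge0 //.
apply: le_trans (cexp_taylor0 _) _; have xw := cabs_rayM_le w x01.
by rewrite ler_wpM2l // ler_pM ?cabs_ge0 ?expR_ge0 // ler_expR.
Qed.

Lemma cexp_taylor2 w :
  cabs (cexp w - 1 - w - w ^+ 2 / 2) <= 8 * (cabs w ^+ 3 * expR (cabs w)).
Proof.
have sq (x : R) : is_derive x (1:R) (fun t => t * t) (2 * x).
  apply: is_derive_eq (is_deriveM (is_derive_id x (1:R)) (is_derive_id x (1:R))) _.
  by rewrite /GRing.scale /=; ring.
have P := path_deriveB (path_deriveB (path_derive_ray w)
  (path_derive_real w (fun x => is_derive_id x (1:R)))) (path_derive_real (w ^+ 2 / 2) sq).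
rewrite (_ : 8 * _ = 2 * (4 * (cabs w ^+ 3 * expR (cabs w)))); last by ring.
have := cabs_increment_le P (B := 4 * (cabs w ^+ 3 * expR (cabs w))).
rewrite ray1 ray0 !mul0r !mul1r !subr0.
rewrite (_ : _ - _ - 1 = cexp w - 1 - w - w ^+ 2 / 2); last by ring.
apply => x x01.
rewrite realCM rmorph_nat (_ : _ - _ = w * (ray w x - 1 - x%:C * w)); last by field.
rewrite cabsM exprS -mulrA [leRHS]mulrCA ler_wpM2l ?cabs_ge0 //.
apply: le_trans (cexp_taylor1 _) _; have xw := cabs_rayM_le w x01.
rewrite ler_wpM2l // ler_pM ?exprn_ge0 ?cabs_ge0 ?expR_ge0 ?ler_expR //.
by rewrite lerXn2r ?nnegrE ?cabs_ge0.
Qed.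

Lemma is_derive_lin (a b x : R) : is_derive x (1:R) (fun t : R => a + t * b) b.
Proof.
have -> : (fun t => a + t * b) = cst a + (@id R) * cst b by [].
apply: is_derive_eq (is_deriveD (is_derive_cst a x 1) (is_deriveM (is_derive_id x 1) (is_derive_cst b x 1))) _.
by rewrite /cst /GRing.scale /= mulr0 !add0r mulr1.
Qed.
End Taylor.

(** * The modulus of the sine and its multiplication formula *)

Section SineFactor.
Variable R : realType.
Implicit Types (z w : R[i]) (x y : R).
Lemma cabs_sqr_inj (a b : R) : 0 <= a -> 0 <= b -> a ^+ 2 = b ^+ 2 -> a = b.
Proof. by move=> a0 b0 /eqP; rewrite eqrXn2 // => /eqP. Qed.

(** For z = x + i y this is exp(2 pi i z). *)
Definition nome x y : R[i] := cexp ((- (2 * pi * y)) +i* (2 * pi * x)).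

(** With the absolute value the exponential is at most 1 in modulus, so that this
factor tends to 1 in both directions |y| -> oo. *)
Definition kfac x y : R := cabs (1 - nome x `|y|).

(** This is 2 |sin(pi (x + i y))|; see [sfac_sqr]. *)
Definition sfac x y : R := expR (pi * `|y|) * kfac x y.
Lemma nomeD x y x' y' : nome (x + x') (y + y') = nome x y * nome x' y'.
Proof.
by rewrite /nome -cexpD; congr cexp; apply/eqP; rewrite eq_complex /=; apply/andP; split;
  apply/eqP; ring.
Qed.

Lemma nome0 : nome 0 0 = 1.
Proof. by rewrite /nome !mulr0 oppr0 cexp0. Qed.

Lemma nomeN x y : nome (- x) (- y) * nome x y = 1.
Proof. by rewrite -nomeD !addNr nome0. Qed.

Lemma nome1 : nome 1 0 = 1.
Proof.
rewrite /nome mulr0 oppr0 mulr1 /cexp /= expR0 mul1r mulr_natl cos2pi sin2pi.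
by [].
Qed.

Lemma nomeM x y n : nome x y ^+ n = nome (n%:R * x) (n%:R * y).
Proof.
elim: n => [|n IH]; first by rewrite expr0 !mul0r nome0.
by rewrite exprSr IH -nomeD; congr nome; rewrite -[in RHS]natr1; ring.
Qed.

Lemma nome_int x y (m : nat) : nome (x + m%:R) y = nome x y.
Proof.
rewrite -{1}[y]addr0 nomeD; have := nomeM 1 0 m.
by rewrite nome1 expr1n mulr1 mulr0 => <-; rewrite mulr1.
Qed.

Lemma cabs_nome x y : cabs (nome x y) = expR (- (2 * pi * y)).
Proof. by rewrite cabs_cexp. Qed.

Lemma cabs_1Bcexp_sqr (a b : R) :
  cabs (1 - cexp (a +i* b)) ^+ 2 = 1 - 2 * expR a * cos b + expR a ^+ 2.
Proof.
rewrite cabs_sqr /cexp /= !mul0r.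
rewrite subr0 addr0.
transitivity (1 - 2 * expR a * cos b + expR a ^+ 2 * (cos b ^+ 2 + sin b ^+ 2)).
  by ring.
by rewrite cos2Dsin2 mulr1.
Qed.

Lemma sfac_ge0 x y : 0 <= sfac x y.
Proof. by rewrite mulr_ge0 ?expR_ge0 ?cabs_ge0. Qed.

Lemma sfac_sqr x y : sfac x y ^+ 2 =
   expR (2 * pi * y) + expR (- (2 * pi * y)) - 2 * cos (2 * pi * x).
Proof.
rewrite exprMn cabs_1Bcexp_sqr -!expRM_natl.
have -> : 2%:R * - (2 * pi * `|y|) = - (2 * pi * `|y|) + - (2 * pi * `|y|) by ring.
rewrite expRD mulrDr mulrBr mulr1 mulrA.
have E : expR (2 * pi * `|y|) * expR (- (2 * pi * `|y|)) = 1.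
  by rewrite -expRD subrr expR0.
rewrite [X in _ + X]mulrA E mul1r.
have -> : expR (2 * pi * `|y|) * (2 * expR (- (2 * pi * `|y|)) * cos (2 * pi * x)) =
  expR (2 * pi * `|y|) * expR (- (2 * pi * `|y|)) * (2 * cos (2 * pi * x)) by ring.
rewrite E mul1r addrAC; congr (_ - _).
have [y0|y0] := leP 0 y; first by rewrite ger0_norm.
by rewrite ltr0_norm // !(mulrN, opprK) addrC.
Qed.

(** For y < 0 one has |1 - nome| = |nome| |1 - 1 / nome|, and the exponential factor
accounts for |nome|. *)
Lemma sfacE x y : sfac x y = cabs (1 - nome x y) * expR (pi * y).
Proof.
apply: cabs_sqr_inj; rewrite ?sfac_ge0 ?mulr_ge0 ?cabs_ge0 ?expR_ge0 //.
rewrite sfac_sqr exprMn cabs_1Bcexp_sqr -!expRM_natl.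
have -> : 2%:R * (pi * y) = 2 * pi * y by ring.
have -> : 2%:R * - (2 * pi * y) = - (2 * pi * y) + - (2 * pi * y) by ring.
rewrite expRD; set a := expR _; set b := expR _.
have ab : b * a = 1 by rewrite -expRD addNr expR0.
transitivity (a - 2 * (b * a) * cos (2 * pi * x) + b * (b * a)); last by ring.
by rewrite ab; ring.
Qed.

Lemma sfacN x y : sfac (- x) (- y) = sfac x y.
Proof.
apply: cabs_sqr_inj; rewrite ?sfac_ge0 // !sfac_sqr !mulrN cosN opprK.
by rewrite [X in X - _]addrC.
Qed.

Lemma kfacN x y : kfac (- x) (- y) = kfac x y.
Proof.
have := sfacN x y; rewrite /sfac normrN => /mulfI; apply.
by rewrite expR_eq0.
Qed.

Lemma kfac_int x y (m : nat) : kfac (x + m%:R) y = kfac x y.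
Proof. by rewrite /kfac nome_int. Qed.

Lemma kfac_intB x y (m : nat) : kfac (x - m%:R) y = kfac x y.
Proof. by rewrite -[in RHS](subrK m%:R x) kfac_int. Qed.

Lemma sfac_int x y (m : nat) : sfac (x + m%:R) y = sfac x y.
Proof. by rewrite /sfac kfac_int. Qed.

(** At w = 2 pi i z this is (2 i sin(pi z))^2. *)
Definition cexp_diff2 w := cexp w + cexp (- w) - 2.
Lemma sin_sqr_half (x : R) : 4 * sin x ^+ 2 - 2 = - (2 * cos (2 * x)).
Proof. rewrite (mulr_natl x 2) cos_mulr2n sin2cos2; ring. Qed.

(** The identity 4 sin(u + v) sin(u - v) = 4 sin^2 u - 4 sin^2 v, in modulus. *)
Lemma sfac_mul (p a b : R) : sfac (p + a) b * sfac (a - p) b =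
  cabs ((4 * sin (pi * p) ^+ 2)%:C + cexp_diff2 ((- (2 * pi * b)) +i* (2 * pi * a))).
Proof.
rewrite !sfacE /cexp_diff2.
have -> : cexp ((- (2 * pi * b)) +i* (2 * pi * a)) = nome a b by [].
have -> : cexp (- ((- (2 * pi * b)) +i* (2 * pi * a))) = nome (- a) (- b).
  by rewrite /nome !mulrN; congr cexp.
set v := nome a b; set v' := nome (- a) (- b).
have vv' : v' * v = 1 := nomeN a b.
set u := nome p 0; set u' := nome (- p) 0.
have uu' : u' * u = 1.
  by have := nomeN p 0; rewrite oppr0.
have -> : nome (p + a) b = u * v by rewrite -nomeD add0r.
have -> : nome (a - p) b = u' * v by rewrite -nomeD add0r addrC.
have upu' : u + u' = (2 * cos (2 * pi * p))%:C.
  rewrite /u /u' /nome /cexp /= mulr0 oppr0 expR0 mulrN cosN sinN !mul1r.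
  by apply/eqP; rewrite eq_complex /= subrr eqxx andbT; apply/eqP; ring.
have E : expR (pi * b) * expR (pi * b) = (cabs v)^-1.
  by rewrite /v cabs_nome -expRN opprK -expRD; congr expR; ring.
rewrite mulrACA E -cabsM.
have -> : (1 - u * v) * (1 - u' * v) =
   v * ((4 * sin (pi * p) ^+ 2)%:C + (v + v' - 2)).
  transitivity (1 - (u + u') * v + (u' * u) * (v * v)); first by ring.
  rewrite upu' uu' mul1r.
  have -> : 2 * cos (2 * pi * p) = 2 - 4 * sin (pi * p) ^+ 2.
    by rewrite -opprB sin_sqr_half opprK mulrA.
  rewrite rmorphB /= rmorph_nat; set t := (_)%:C.
  transitivity (v' * v - (2 - t) * v + v * v); [by rewrite vv' | by ring].
rewrite cabsM mulrAC mulfV ?mul1r //.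
by rewrite gt_eqF // /v cabs_nome expR_gt0.
Qed.

Lemma sfac_sqr_diff2 (a b : R) : sfac a b ^+ 2 =
  cabs (cexp_diff2 ((- (2 * pi * b)) +i* (2 * pi * a))).
Proof.
have := sfac_mul 0 a b; rewrite add0r subr0 -expr2 => ->.
by rewrite mulr0 sin0 expr0n mulr0 rmorph0 add0r.
Qed.

Lemma sfac_real_sqr (p : R) : sfac p 0 ^+ 2 = 4 * sin (pi * p) ^+ 2.
Proof.
have := sfac_mul p 0 0; rewrite addr0 add0r -{2}oppr0 sfacN -expr2 => ->.
rewrite /cexp_diff2 !mulr0 oppr0 cexp0 oppr0 cexp0.
by rewrite (_ : 1 + 1 - 2 = 0 :> R[i]) ?addr0 ?cabs_real ?ger0_norm //;
  [rewrite mulr_ge0 // sqr_ge0 | ring].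
Qed.

Lemma nome_primitive n : (0 < n)%N -> n.-primitive_root (nome (- n%:R^-1) 0).
Proof.
move=> n0; rewrite /primitive_root_of_unity n0 /=; apply/forallP => i; apply/eqP.
rewrite unity_rootE nomeM mulr0.
have nR : n%:R != 0 :> R by rewrite pnatr_eq0 -lt0n.
have [En|ne] := eqVneq i.+1 n.
  rewrite En mulrN mulfV //.
  have := nomeN 1 0; rewrite oppr0 nome1 mulr1 => ->; exact: eqxx.
apply/negbTE/eqP => /(congr1 (fun z => cabs (1 - z))).
rewrite subrr cabs0 => /(congr1 (fun z : R => z ^+ 2)).
rewrite expr0n /= mulrN cabs_1Bcexp_sqr mulr0 oppr0 expR0 expr1n mulr1 => /eqP.
rewrite mulrN cosN -mulrA addrAC -sin_sqr_half.
have -> : 1 + 1 + (4 * sin (pi * (i.+1%:R * n%:R^-1)) ^+ 2 - 2) =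
  4 * sin (pi * (i.+1%:R * n%:R^-1)) ^+ 2 :> R by ring.
rewrite mulf_eq0 pnatr_eq0 /= expf_eq0 /= gt_eqF // sin_gt0_pi //.
have lt : (i.+1 < n)%N by rewrite ltn_neqAle ne ltn_ord.
rewrite mulr_gt0 ?pi_gt0 ?divr_gt0 ?ltr0n //= gtr_pMr ?pi_gt0 //.
by rewrite ltr_pdivrMr ?ltr0n // mul1r ltr_nat.
Qed.

(** Evaluation at v of the factorisation of X^n - 1 over the n-th roots of unity. *)
Lemma prod_1B_nome n (v : R[i]) : (0 < n)%N ->
  \prod_(0 <= j < n) cabs (1 - nome (j%:R / n%:R) 0 * v) = cabs (1 - v ^+ n).
Proof.
move=> n0; have := factor_Xn_sub_1 (nome_primitive n0).
move=> /(congr1 (fun p : {poly R[i]} => cabs p.[v])).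
have -> : ('X^n - 1).[v] = v ^+ n - 1 by rewrite !hornerE.
rewrite cabsB => <-; rewrite horner_prod cabs_prod; apply: eq_bigr => j _.
rewrite !hornerE nomeM mulr0 mulrN -/(_ / _).
have := nomeN (j%:R / n%:R) 0; rewrite oppr0 => E.
rewrite -[1 in LHS]mul1r.
have -> : v - nome (- (j%:R / n%:R)) 0 =
  - (nome (- (j%:R / n%:R)) 0 * (1 - nome (j%:R / n%:R) 0 * v)).
  by rewrite mulrBr mulrA E mulr1 mul1r opprB.
by rewrite cabsN cabsM cabs_nome mulr0 oppr0 expR0 !mul1r.
Qed.

(** The distribution relation of the sine, which becomes the multiplication
formula of theta. *)
Lemma prod_kfac n x y : (0 < n)%N ->
  \prod_(0 <= j < n) kfac (x + j%:R / n%:R) y = kfac (n%:R * x) (n%:R * y).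
Proof.
move=> n0; rewrite /kfac normrM ger0_norm // -nomeM -prod_1B_nome //.
by apply: eq_bigr => j _; rewrite -nomeD add0r [_ / _ + _]addrC.
Qed.

Lemma prod_sfac n x y : (0 < n)%N ->
  \prod_(0 <= j < n) sfac (x + j%:R / n%:R) y = sfac (n%:R * x) (n%:R * y).
Proof.
move=> n0; rewrite big_split /= prod_kfac //; congr (_ * _).
rewrite prodr_const_nat subn0 -expRM_natl normrM (ger0_norm (ler0n _ _)).
by congr expR; ring.
Qed.

(** The distribution relation with its vanishing factor divided out: X^n - 1 divided
by X - 1 takes the value n at 1. *)
Lemma prod_1B_nome1 n : (0 < n)%N ->
  \prod_(1 <= j < n) sfac (j%:R / n%:R) 0 = n%:R.
Proof.
move=> n0; have := factor_Xn_sub_1 (nome_primitive n0).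
rewrite big_ltn // expr0 subrX1 => /mulfI => /(_ _) H.
have /H {H} : 'X - 1%:P != 0 :> {poly R[i]} by rewrite polyXsubC_eq0.
move=> /(congr1 (fun p : {poly R[i]} => cabs p.[1])).
rewrite horner_prod cabs_prod horner_sum.
under [X in _ = cabs X -> _]eq_bigr do rewrite hornerXn expr1n.
rewrite sumr_const card_ord -(rmorph_nat (real_complex R)) cabs_real ger0_norm // => H; rewrite -[RHS]H.
rewrite !big_nat; apply: eq_bigr => j _.
rewrite !hornerE nomeM mulr0 mulrN -/(_ / _) sfacE mulr0 expR0 mulr1.
have := nomeN (j%:R / n%:R) 0; rewrite oppr0 => E.
have c1 : cabs (nome (- (j%:R / n%:R)) 0) = 1 by rewrite cabs_nome mulr0 oppr0 expR0.
have -> : 1 - nome (- (j%:R / n%:R)) 0 =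
    - (nome (- (j%:R / n%:R)) 0 * (1 - nome (j%:R / n%:R) 0)).
  by rewrite mulrBr E mulr1 opprB.
by rewrite cabsN cabsM c1 mul1r.
Qed.
End SineFactor.

(** * Elementary bounds for the sine product *)

Section SineProduct.
Variable R : realType.
Implicit Types (z w : R[i]) (x y p : R).
Lemma le_increment (f df : R -> R) p : 0 <= p ->
  (forall t : R, is_derive t (1:R) f (df t)) ->
  (forall t : R, 0 <= t <= p -> 0 <= df t) -> f 0 <= f p.
Proof.
move=> p0 fdf df0.
have fc : {within `[0, p], continuous f}.
  apply: continuous_subspaceT => x.
  by apply: differentiable_continuous; apply/derivable1_diffP; case: (fdf x).
have [c] := MVT_segment p0 (fun x _ => fdf x) fc.
rewrite in_itv /= subr0 => c0p /eqP; rewrite subr_eq => /eqP ->.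
by rewrite lerDr mulr_ge0 // df0.
Qed.

Lemma sin_le p : 0 <= p -> sin p <= p.
Proof.
move=> p0; rewrite -subr_ge0.
have := @le_increment (fun t => t * 1 - sin t) (fun t => 1 - cos t) p p0.
rewrite mul0r sin0 subr0 mulr1; apply => [t|t _]; last by rewrite subr_ge0 cos_le1.
have := is_deriveB (is_derive_lin 0 1 t) (is_derive_sin t).
by have -> : (fun t : R => 0 + t * 1) = (fun t : R => t * 1) by apply/funext => u; rewrite add0r.
Qed.

Lemma cos_ge p : 1 - p ^+ 2 / 2 <= cos p.
Proof.
wlog p0 : p / 0 <= p.
  by move=> H; have [/H//|p0] := leP 0 p; rewrite -cosN -sqrrN H // oppr_ge0 ltW.
have E : p = (p / 2) *+ 2 by rewrite -mulr_natr divfK.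
rewrite E cos_mulr2n cos2sin2 -E.
have s0 : `|sin (p / 2)| <= p / 2.
  rewrite ler_norml; apply/andP; split; last by rewrite sin_le // divr_ge0.
  have := @le_increment (fun t => t * 1 + sin t) (fun t => 1 + cos t) (p / 2).
  rewrite mul0r sin0 addr0 mulr1 => H; rewrite lerNl -subr_ge0 opprK; apply: H.
  - by rewrite divr_ge0.
  - move=> t; have := is_deriveD (is_derive_lin 0 1 t) (is_derive_sin t).
    by have -> : (fun t : R => 0 + t * 1) = (fun t : R => t * 1) by apply/funext => u; rewrite add0r.
  - by move=> t _; rewrite -lerBlDl sub0r cos_geN1.
have : sin (p / 2) ^+ 2 <= (p / 2) ^+ 2.
  by rewrite -(real_normK (num_real (sin _))) lerXn2r ?nnegrE // divr_ge0.
move: (sin _) => s; rewrite !expr2 => H; rewrite -mulr_natr; nra.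
Qed.

(** Integration of cos >= 1 - p^2 / 2. *)
Lemma sin_ge_cubic p : 0 <= p -> p - p ^+ 3 / 6 <= sin p.
Proof.
move=> p0; rewrite -subr_ge0.
have := @le_increment (sin - (fun t => 0 + t * 1) + (fun t => t * t * t * (1 / 6)))
  (fun t => cos t - 1 + t ^+ 2 / 2) p p0.
rewrite !fctE sin0 !mul0r !mulr1 !add0r oppr0 !add0r => H.
have -> : sin p - (p - p ^+ 3 / 6) = sin p - p + p * p * p * (1 / 6) by ring.
apply: H => t; last by move=> _; have := cos_ge t; lra.
have q : is_derive t 1 (fun t => t * t * t * (1 / 6)) (t ^+ 2 / 2).
  have -> : (fun t => t * t * t * (1 / 6)) = (@id R) * (@id R) * (@id R) * cst (1/6) by [].
  have D := is_deriveM (is_deriveM (is_deriveM (is_derive_id t (1:R)) (is_derive_id t (1:R))) (is_derive_id t (1:R))) (is_derive_cst (1/6 : R) t (1:R)).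
  apply: is_derive_eq D _.
  by rewrite !fctE /cst /GRing.scale /=; field.
exact: is_deriveD (is_deriveB (is_derive_sin t) (is_derive_lin 0 1 t)) q.
Qed.

Lemma pi_half_lt2 : pi / 2 < 2 :> R.
Proof. exact: pihalf_lt2. Qed.

Lemma sin_ge_third p : 0 <= p <= pi / 2 -> p / 3 <= sin p.
Proof.
move=> /andP[p0 pp]; apply: le_trans (sin_ge_cubic p0).
have p2 : p <= 2 by apply: le_trans pp _; exact: ltW pi_half_lt2.
have : p ^+ 2 <= 4 by rewrite expr2; nra.
rewrite exprS; set q := p ^+ 2 => H; nra.
Qed.

(** The double poles at 0 cancel. *)
Lemma inv_sin_sqr p : 0 < p <= pi / 2 -> `|(p ^+ 2)^-1 - (sin p ^+ 2)^-1| <= 3.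
Proof.
move=> /andP[p0 pp]; set s := sin p.
have s3 : p / 3 <= s by rewrite sin_ge_third // ltW.
have sp : s <= p by rewrite sin_le // ltW.
have sc : p - p ^+ 3 / 6 <= s by rewrite sin_ge_cubic // ltW.
have s0 : 0 < s by apply: lt_le_trans s3; rewrite divr_gt0.
rewrite ler0_norm ?opprB; last first.
  by rewrite subr_le0 lef_pV2 ?posrE ?exprn_gt0 // lerXn2r ?nnegrE ?(ltW p0) ?(ltW s0).
have -> : (s ^+ 2)^-1 - (p ^+ 2)^-1 = (p ^+ 2 - s ^+ 2) / (p ^+ 2 * s ^+ 2).
  by field; rewrite !gt_eqF.
rewrite ler_pdivrMr ?mulr_gt0 ?exprn_gt0 //.
have A : p ^+ 2 / 9 <= s ^+ 2.
  have p3 : 0 <= p / 3 by rewrite divr_ge0 // ltW.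
  rewrite !expr2 (_ : p * p / 9 = p / 3 * (p / 3)); last by field.
  exact: ler_pM.
have B : p ^+ 2 - s ^+ 2 <= (p ^+ 3 / 6) * (p + p).
  rewrite subr_sqr ler_pM ?subr_ge0 ?addr_ge0 ?(ltW p0) ?(ltW s0) //; first lra.
  by rewrite lerD2l.
apply: le_trans B _.
have p2 : 0 <= p ^+ 2 by rewrite sqr_ge0.
have -> : p ^+ 3 / 6 * (p + p) = p ^+ 2 * (p ^+ 2 / 3) by field.
by rewrite [leRHS]mulrCA ler_wpM2l //; lra.
Qed.

Lemma cexp_diff2_taylor w : cabs w <= 1 ->
  cabs (cexp_diff2 w - w ^+ 2) <= 16 * expR 1 * cabs w ^+ 3.
Proof.
move=> w1.
have -> : cexp_diff2 w - w ^+ 2 = (cexp w - 1 - w - w ^+ 2 / 2) +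
   (cexp (- w) - 1 - (- w) - (- w) ^+ 2 / 2).
  by rewrite /cexp_diff2 sqrrN; field.
apply: le_trans (cabsD _ _) _.
have e1 : expR (cabs w) <= expR 1 by rewrite ler_expR.
have w3 : 0 <= cabs w ^+ 3 by rewrite exprn_ge0 ?cabs_ge0.
have := cexp_taylor2 w; have := cexp_taylor2 (- w); rewrite cabsN => A B.
apply: le_trans (lerD B A) _.
have -> : 16 * expR 1 * cabs w ^+ 3 = 8 * (cabs w ^+ 3 * expR 1) + 8 * (cabs w ^+ 3 * expR 1) by ring.
by rewrite lerD // ler_wpM2l // ler_wpM2l.
Qed.

Lemma cexp_diff2_le w : cabs w <= 1 ->
  cabs (cexp_diff2 w) <= (1 + 16 * expR 1) * cabs w ^+ 2.
Proof.
move=> w1; rewrite -[cexp_diff2 w](subrK (w ^+ 2)).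
apply: le_trans (cabsD _ _) _; rewrite cabsX addrC mulrDl mul1r lerD2l.
apply: le_trans (cexp_diff2_taylor w1) _.
rewrite ler_wpM2l ?mulr_ge0 ?expR_ge0 // exprSr.
by rewrite ler_piMr // exprn_ge0 // cabs_ge0.
Qed.

(** Telescoping: the factors of a are replaced by those of b one at a time. *)
Lemma prod_diff_le (a b : nat -> R[i]) (c : nat -> R) m n :
  (forall j, (m <= j < n)%N -> cabs (a j) <= expR (c j)) ->
  (forall j, (m <= j < n)%N -> cabs (b j) <= expR (c j)) ->
  (forall j, (m <= j < n)%N -> 0 <= c j) ->
  cabs (\prod_(m <= j < n) a j - \prod_(m <= j < n) b j) <=
  expR (\sum_(m <= j < n) c j) * \sum_(m <= j < n) cabs (a j - b j).
Proof.
have [nm|mn] := leqP n m.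
  by rewrite !big_geq // subrr cabs0 mulr0.
rewrite -(subnKC (ltnW mn)); elim: (n - m)%N => [|k IH] ac bc c0.
  by rewrite addn0 !big_geq // subrr cabs0 mulr0.
rewrite addnS !big_nat_recr ?leq_addr //=.
have kk : (m <= m + k < m + k.+1)%N by rewrite leq_addr addnS ltnSn.
have sub j : (m <= j < m + k)%N -> (m <= j < m + k.+1)%N.
  by case/andP=> -> /= H; rewrite addnS ltnS ltnW.
have {}IH := IH (fun j H => ac j (sub j H)) (fun j H => bc j (sub j H)) (fun j H => c0 j (sub j H)).
set A := \prod_(_ <= _ < _) a _ in IH *; set B := \prod_(_ <= _ < _) b _ in IH *.
have -> : A * a (m + k)%N - B * b (m + k)%N =
   (A - B) * b (m + k)%N + A * (a (m + k)%N - b (m + k)%N) by ring.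
apply: le_trans (cabsD _ _) _; rewrite !cabsM expRD mulrDr.
have Ale : cabs A <= expR (\sum_(m <= j < m + k) c j).
  rewrite expR_sum /A cabs_prod !big_nat; apply: ler_prod => j jk.
  by rewrite cabs_ge0 ac ?sub.
apply: lerD.
  by rewrite mulrAC ler_pM ?cabs_ge0 ?bc.
rewrite ler_wpM2r ?cabs_ge0 // (le_trans Ale) // ler_peMr ?expR_ge0 //.
by rewrite -expR0 ler_expR c0.
Qed.

Lemma sum_inv_sqr_le (n : nat) : \sum_(1 <= j < n) (j%:R ^+ 2)^-1 <= 2 :> R.
Proof.
suff H : forall m, \sum_(1 <= j < m.+2) (j%:R ^+ 2)^-1 <= 2 - m.+1%:R^-1 :> R.
  case: n => [|[|n]]; [by rewrite big_geq|by rewrite big_geq|].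
  by apply: le_trans (H n) _; rewrite gerBl invr_ge0.
elim=> [|m IH]; first by rewrite big_nat1 expr1n invr1; lra.
rewrite big_nat_recr //=; apply: le_trans (lerD IH (lexx _)) _.
have m0 : 0 < m.+1%:R :> R by rewrite ltr0n.
have -> : m.+2%:R = m.+1%:R + 1 :> R by rewrite natr1.
set t := m.+1%:R in m0 *.
rewrite -subr_ge0.
have -> : 2 - (t + 1)^-1 - (2 - t^-1 + ((t + 1) ^+ 2)^-1) = (t * (t + 1) ^+ 2)^-1.
  by field; rewrite !gt_eqF //; lra.
by rewrite invr_ge0 mulr_ge0 ?sqr_ge0 // ltW.
Qed.

(** Pairs the j-th factor with the j-th from the end; in the distribution relation
of odd order these are the translates by j/n and - j/n. *)
Lemma big_nat_halves (F : nat -> R) M :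
  \prod_(1 <= j < (2 * M).+1) F j =
  \prod_(1 <= j < M.+1) (F j * F ((2 * M).+1 - j)%N).
Proof.
rewrite (@big_cat_nat _ _ _ M.+1) //=; last by rewrite ltnS mul2n -addnn leq_addr.
rewrite big_split /=; congr (_ * _).
rewrite -[M.+1 in LHS]add1n -(addn1 (2 * M)) mul2n -addnn -addnA [(M + (M + 1))%N]addnC big_addn addnK addn1.
rewrite big_nat_rev /=; apply: eq_big_nat => j /andP[j1 jM]; congr F; lia.
Qed.
End SineProduct.

(** * The product formula for the sine *)

Section SineLimit.
Variable R : realType.
Implicit Types (x y : R).

(** All error terms below decay at least like 1/n. *)
Lemma cvg_le_harmonic (u : nat -> R) (l K : R) :
  (\forall n \near \oo, `|u n - l| <= K * n.+1%:R^-1) -> u @ \oo --> l.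
Proof.
move=> H.
have h0 : (fun n : nat => K * n.+1%:R^-1) @ \oo --> (0 : R).
  rewrite -(mulr0 K); apply: cvgMr; exact: cvg_harmonic.
rewrite -(subr0 l); apply/cvgrPdist_le => e e0; rewrite subr0.
move/cvgrPdist_le : h0 => /(_ e e0) h0.
near=> n; rewrite distrC.
have A : `|u n - l| <= K * n.+1%:R^-1 by near: n.
apply: le_trans A _; apply: le_trans (ler_norm _) _.
by rewrite -[X in `|X|]opprK normrN -[- _]sub0r; near: n.
Unshelve. all: by end_near. Qed.

Lemma cabs_dist (z w : R[i]) : `|cabs z - cabs w| <= cabs (z - w).
Proof.
rewrite ler_norml; apply/andP; split.
  by rewrite lerNl opprB lerBlDr cabsB -{1}(subrK z w) cabsD.
by rewrite lerBlDr -{1}(subrK w z) cabsD.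
Qed.

Lemma mul4_sqr_ge0 (a : R) : 0 <= 4 * a ^+ 2.
Proof. by apply: mulr_ge0 => //; exact: sqr_ge0. Qed.

Definition wray x y (n : nat) : R[i] :=
  (- (2 * pi * (y / n%:R))) +i* (2 * pi * (x / n%:R)).
Lemma wrayE x y n : wray x y n = (2 * pi / n%:R)%:C * ('i * (x +i* y)).
Proof.
rewrite /wray; apply/eqP; rewrite eq_complex /=; apply/andP; split; apply/eqP; ring.
Qed.

Lemma cabs_wray x y n : cabs (wray x y n) = 2 * pi * cabs (x +i* y) / n%:R.
Proof.
rewrite wrayE !cabsM cabs_real ger0_norm ?divr_ge0 ?mulr_ge0 ?pi_ge0 //.
rewrite (_ : cabs 'i = 1) ?mul1r; first by rewrite mulrAC.
by rewrite /cabs normc_def /= expr0n expr1n add0r sqrtr1.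
Qed.

Lemma wray_sqr x y n : wray x y n ^+ 2 = - ((2 * pi / n%:R) ^+ 2)%:C * (x +i* y) ^+ 2.
Proof.
by rewrite wrayE exprMn (exprMn _ 'i) sqr_i -rmorphXn /= mulN1r mulrN mulNr.
Qed.

(** The quotient of the paired factors of the distribution relation of order n at
z/n and at 0; as n grows it tends to 1 - z^2 / j^2. *)
Definition sine_factor x y n (j : nat) : R[i] :=
  1 + cexp_diff2 (wray x y n) / (4 * sin (pi * (j%:R / n%:R)) ^+ 2)%:C.
Lemma half_range M j : (1 <= j < M.+1)%N ->
  0 < (pi : R) * (j%:R / (2 * M).+1%:R) <= pi / 2.
Proof.
case/andP=> j1 jM; apply/andP; split.
  by rewrite mulr_gt0 ?pi_gt0 // divr_gt0 ?ltr0n.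
rewrite ler_wpM2l ?pi_ge0 // ler_pdivrMr ?ltr0n // mulrC ler_pdivlMr // -natrM ler_nat.
by rewrite mulnC ltnW // ltnS leq_mul2l.
Qed.

(** Euler's derivation of the product: the distribution relation of order n = 2M + 1
at z/n, divided by its value at 0. *)
Lemma sfac_prod x y M : let n := (2 * M).+1 in
  sfac x y = (n%:R * sfac (x / n%:R) (y / n%:R)) *
     \prod_(1 <= j < M.+1) cabs (sine_factor x y n j).
Proof.
move=> n; have n0 : n%:R != 0 :> R by rewrite pnatr_eq0.
have := @prod_sfac R n (x / n%:R) (y / n%:R) (ltn0Sn _).
rewrite ![n%:R * (_ / _)]mulrC !divfK // => <-.
rewrite big_ltn // mul0r addr0 [n%:R * _]mulrC -[RHS]mulrA; congr (_ * _).
have := @prod_1B_nome1 R n (ltn0Sn _).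
(* dividing by the value at 0: n is itself the product of the remaining factors *)
rewrite big_nat_halves -/n => H; rewrite -[X in _ = X * _]H big_nat_halves -big_split /=.
apply: eq_big_nat => j jM.
have /andP[q0 qh] := half_range jM; rewrite -/n in q0 qh.
have s0 : 0 < sin (pi * (j%:R / n%:R)) :> R.
  by rewrite sin_gt0_pi // q0 /= (le_lt_trans qh) // gtr_pMr ?pi_gt0 //; lra.
have jn : (j <= n)%N by case/andP: jM => _; rewrite ltnS /n; lia.
rewrite natrB // mulrBl mulfV // addrA addrAC (_ : 1 = 1%:R) // sfac_int addrC.
rewrite [_ + x / _]addrC [x / _ + _]addrC sfac_mul.
rewrite (_ : 1%:R - _ = - (j%:R / n%:R) + 1%:R) 1?addrC // sfac_int.
rewrite -[X in _ * sfac _ X]oppr0 sfacN -expr2 sfac_real_sqr.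
rewrite -[X in _ = X * _]ger0_norm ?mul4_sqr_ge0 // -cabs_real -cabsM; congr cabs.
rewrite addrC /sine_factor -/(wray x y n) mulrDr mulr1; congr (_ + _).
rewrite mulrCA mulfV ?mulr1 //.
rewrite (inj_eq (@complexI R) _ 0).
by rewrite mulf_neq0 // expf_neq0 // gt_eqF.
Qed.
Let C0 : R := 16 * expR 1.
Let C0_ge0 : 0 <= C0.
Proof. by rewrite mulr_ge0 // expR_ge0. Qed.

Lemma cvg_sfac_small x y :
  (fun M => (2 * M).+1%:R * sfac (x / (2 * M).+1%:R) (y / (2 * M).+1%:R)) @ \oo -->
    2 * pi * cabs (x +i* y).
Proof.
set V := 2 * pi * cabs (x +i* y).
have V0 : 0 <= V by rewrite !mulr_ge0 ?pi_ge0 ?cabs_ge0.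
set u := (X in X @ _ --> _).
have uE : u = Num.sqrt \o (fun M => u M ^+ 2).
  by apply/funext => M /=; rewrite sqrtr_sqr ger0_norm // mulr_ge0 // sfac_ge0.
have -> : V = Num.sqrt (V ^+ 2) by rewrite sqrtr_sqr ger0_norm.
rewrite uE; apply: continuous_cvg; first exact: sqrt_continuous.
apply: (@cvg_le_harmonic _ _ (C0 * V ^+ 3)).
near=> M; set n := (2 * M).+1.
have n0 : 0 < n%:R :> R by rewrite ltr0n.
have Vn : V <= n%:R.
  have : V <= M%:R by near: M; exact: nbhs_infty_ger.
  by move/le_trans; apply; rewrite ler_nat /n; clear; lia.
have w1 : cabs (wray x y n) = V / n%:R by rewrite cabs_wray.
have wle : cabs (wray x y n) <= 1 by rewrite w1 ler_pdivrMr // mul1r.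
rewrite /u -/n exprMn sfac_sqr_diff2 -/(wray x y n).
have := cexp_diff2_taylor wle; rewrite w1 -/C0.
set D := cexp_diff2 _ => H.
have -> : V ^+ 2 = n%:R ^+ 2 * cabs (wray x y n ^+ 2).
  by rewrite cabsX w1 expr_div_n mulrC divfK // expf_neq0 // gt_eqF.
rewrite -mulrBr normrM ger0_norm ?sqr_ge0 //.
have H2 : `|cabs D - cabs (wray x y n ^+ 2)| <= cabs (D - wray x y n ^+ 2).
  exact: cabs_dist.
apply: le_trans (ler_wpM2l (sqr_ge0 _) (le_trans H2 H)) _.
have -> : n%:R ^+ 2 * (C0 * (V / n%:R) ^+ 3) = C0 * V ^+ 3 * n%:R^-1.
  by field; rewrite gt_eqF.
apply: ler_wpM2l; first by rewrite mulr_ge0 // exprn_ge0.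
rewrite lef_pV2 ?posrE ?ltr0n //.
by rewrite ler_nat /n; clear; lia.
Unshelve. all: by end_near. Qed.
Let Kb x y : R := 9 * (1 + C0) * cabs (x +i* y) ^+ 2.
Let Kb_ge0 x y : 0 <= Kb x y.
Proof. by rewrite !mulr_ge0 ?exprn_ge0 ?cabs_ge0 ?addr_ge0. Qed.
Section Close.
Variables (x y : R) (M : nat).
Let n := (2 * M).+1.
Let Z := cabs (x +i* y).
Let V := 2 * pi * Z.
Hypothesis Vn : V <= n%:R.
Let n0 : 0 < n%:R :> R. Proof. by rewrite ltr0n. Qed.
Let Z0 : 0 <= Z. Proof. exact: cabs_ge0. Qed.
Let V0 : 0 <= V. Proof. by rewrite !mulr_ge0 // pi_ge0. Qed.
Let w1 : cabs (wray x y n) = V / n%:R. Proof. by rewrite cabs_wray. Qed.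
Let wle : cabs (wray x y n) <= 1.
Proof. by rewrite w1 ler_pdivrMr // mul1r. Qed.
Let p0 : 0 < pi :> R. Proof. exact: pi_gt0. Qed.
Let sin_lb j : (1 <= j < M.+1)%N ->
  ((pi : R) * j%:R / n%:R) ^+ 2 / 9 <= sin (pi * (j%:R / n%:R)) ^+ 2 /\ 0 < sin (pi * (j%:R / n%:R)) :> R.
Proof.
move=> jM; have /andP[q0 qh] := half_range jM; rewrite -/n in q0 qh.
have q0' : 0 <= pi * (j%:R / n%:R) :> R by exact: ltW.
have := @sin_ge_third R (pi * (j%:R / n%:R)); rewrite q0' qh => /(_ isT) H.
rewrite -mulrA; move: (pi * _) q0 q0' H => p q0 q0' H; split; last first.
  by apply: lt_le_trans H; rewrite divr_gt0.
have p3 : 0 <= p / 3 by rewrite divr_ge0.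
rewrite !expr2 (_ : p * p / 9 = p / 3 * (p / 3)); last by field.
exact: ler_pM.
Qed.
Let inv_sin_lb j : (1 <= j < M.+1)%N ->
  (4 * sin ((pi : R) * (j%:R / n%:R)) ^+ 2)^-1 <= 9 * n%:R ^+ 2 / (4 * pi ^+ 2) / j%:R ^+ 2.
Proof.
move=> jM; have [H s0] := sin_lb jM; have j0 : 0 < j%:R :> R by rewrite ltr0n; case/andP: jM.
have -> : 9 * n%:R ^+ 2 / (4 * pi ^+ 2) / j%:R ^+ 2 =
   (4 * ((pi * j%:R / n%:R) ^+ 2 / 9))^-1 :> R.
  by move: (pi : R) (p0) => P P0; field; rewrite !gt_eqF.
rewrite lef_pV2 ?posrE ?ler_wpM2l //.
  by rewrite mulr_gt0 // exprn_gt0.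
by rewrite mulr_gt0 // divr_gt0 // exprn_gt0 // divr_gt0 // mulr_gt0.
Qed.

Lemma sine_factor_le j : (1 <= j < M.+1)%N ->
  cabs (sine_factor x y n j) <= expR (Kb x y * (j%:R ^+ 2)^-1).
Proof.
move=> jM; apply: le_trans (expR_ge1Dx _); apply: le_trans (cabsD _ _) _.
rewrite cabs1 lerD2l cabsM cabsV cabs_real ger0_norm ?mul4_sqr_ge0 //.
have C := cexp_diff2_le wle; rewrite w1 -/C0 in C.
have j0 : 0 < j%:R :> R by rewrite ltr0n; case/andP: (jM).
have s0 : 0 <= (4 * sin (pi * (j%:R / n%:R)) ^+ 2)^-1 :> R.
  by rewrite invr_ge0 mul4_sqr_ge0.
apply: le_trans (ler_pM (cabs_ge0 _) s0 C (inv_sin_lb jM)) _.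
rewrite /Kb -/Z /V le_eqVlt; apply/orP; left; apply/eqP.
by move: (pi : R) (p0) => P P0; field; rewrite !gt_eqF.
Qed.

Lemma plain_factor_le j : (1 <= j < M.+1)%N ->
  cabs (1 - (x +i* y) ^+ 2 / (j%:R ^+ 2)%:C) <= expR (Kb x y * (j%:R ^+ 2)^-1).
Proof.
move=> jM; apply: le_trans (expR_ge1Dx _); apply: le_trans (cabsD _ _) _.
rewrite cabs1 lerD2l cabsN cabsM cabsV cabs_real ger0_norm ?sqr_ge0 //.
rewrite ler_wpM2r ?invr_ge0 ?sqr_ge0 // cabsX -/Z /Kb -/Z ler_peMl ?sqr_ge0 //.
rewrite mulrDr mulr1; have := C0_ge0; lra.
Qed.
Let Kd : R := 3 * pi ^+ 2 * Z ^+ 2.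
Let Ke : R := 9 * C0 * V ^+ 3 / (4 * pi ^+ 2).

(** The first term is the error of replacing sin^2 by its argument squared, the
second the error of replacing the second difference of exp by w^2. *)
Lemma factor_diff_le j : (1 <= j < M.+1)%N ->
  cabs (1 - (x +i* y) ^+ 2 / (j%:R ^+ 2)%:C - sine_factor x y n j) <=
  Kd / n%:R ^+ 2 + Ke / n%:R * (j%:R ^+ 2)^-1.
Proof.
move=> jM; have [_ s0] := sin_lb jM.
have j0 : 0 < j%:R :> R by rewrite ltr0n; case/andP: (jM).
set z := x +i* y; pose p : R := pi * (j%:R / n%:R).
set E := cexp_diff2 (wray x y n) - wray x y n ^+ 2.
have EE : cexp_diff2 (wray x y n) = E - ((2 * pi / n%:R) ^+ 2)%:C * z ^+ 2.
  by rewrite /E wray_sqr mulNr opprK addrK.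
have -> : 1 - z ^+ 2 / (j%:R ^+ 2)%:C - sine_factor x y n j =
   - (z ^+ 2 * ((pi / n%:R) ^+ 2 * ((p ^+ 2)^-1 - (sin p ^+ 2)^-1))%:C)
   - E / (4 * sin p ^+ 2)%:C.
  rewrite /sine_factor EE -/p.
  have -> : (pi / n%:R) ^+ 2 * ((p ^+ 2)^-1 - (sin p ^+ 2)^-1) =
    (j%:R ^+ 2)^-1 - (2 * pi / n%:R) ^+ 2 / (4 * sin p ^+ 2).
    have {}s0 : 0 < sin p by [].
    move: (sin p) s0 => sp s0; rewrite /p; move: (pi : R) (p0) => P P0.
    by field; rewrite !gt_eqF.
  have -> : ((j%:R ^+ 2)^-1 - (2 * pi / n%:R) ^+ 2 / (4 * sin p ^+ 2))%:C =
      ((j%:R ^+ 2)%:C)^-1 - ((2 * pi / n%:R) ^+ 2)%:C / (4 * sin p ^+ 2)%:C :> R[i].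
    by rewrite realCB realCV realCM realCV.
  set a := (j%:R ^+ 2)%:C; set b := (_ ^+ 2)%:C; set c := (4 * _)%:C.
  by ring.
apply: le_trans (cabsD _ _) _; rewrite !cabsN !cabsM cabsV !cabs_real.
apply: lerD.
  have := inv_sin_sqr (half_range jM); rewrite -/n -/p => H.
  rewrite -expr2 -/Z normrM ger0_norm ?sqr_ge0 //.
  apply: le_trans (_ : Z ^+ 2 * ((pi / n%:R) ^+ 2 * 3) <= _).
    by rewrite ler_wpM2l ?sqr_ge0 // ler_wpM2l ?sqr_ge0.
  by rewrite le_eqVlt; apply/orP; left; apply/eqP; rewrite /Kd; move: (pi : R) => P; field; rewrite gt_eqF.
have C := cexp_diff2_taylor wle; rewrite w1 -/C0 -/E in C.
rewrite ger0_norm ?mul4_sqr_ge0 //.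
have si : 0 <= (4 * sin p ^+ 2)^-1 :> R by rewrite invr_ge0 mul4_sqr_ge0.
apply: le_trans (ler_pM (cabs_ge0 _) si C (inv_sin_lb jM)) _.
by rewrite le_eqVlt; apply/orP; left; apply/eqP; rewrite /Ke /V; move: (pi : R) (p0) => P P0; field; rewrite !gt_eqF.
Qed.
Let sumKb : expR (\sum_(1 <= j < M.+1) Kb x y * (j%:R ^+ 2)^-1) <= expR (Kb x y * 2).
Proof. by rewrite ler_expR -mulr_sumr ler_wpM2l // sum_inv_sqr_le. Qed.

Lemma prod_sine_factor_le :
  \prod_(1 <= j < M.+1) cabs (sine_factor x y n j) <= expR (Kb x y * 2).
Proof.
apply: le_trans sumKb; rewrite expR_sum !big_nat.
by apply: ler_prod => j jM; rewrite cabs_ge0 sine_factor_le.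
Qed.

Lemma prod_sine_factor_close :
  `|\prod_(1 <= j < M.+1) cabs (1 - (x +i* y) ^+ 2 / (j%:R ^+ 2)%:C) -
    \prod_(1 <= j < M.+1) cabs (sine_factor x y n j)| <=
  expR (Kb x y * 2) * (Kd + Ke * 2) * M.+1%:R^-1.
Proof.
rewrite -!cabs_prod; apply: le_trans (cabs_dist _ _) _.
have := @prod_diff_le R _ _ _ 1 M.+1 plain_factor_le sine_factor_le
   (fun j _ => mulr_ge0 (Kb_ge0 x y) (_ : 0 <= (j%:R ^+ 2)^-1)).
move=> /(_ (fun j => _)) H.
apply: le_trans (H _) _ => {H}; first by move=> j; rewrite invr_ge0 sqr_ge0.
rewrite -mulrA; apply: ler_pM; rewrite ?expR_ge0 ?sumr_ge0 //.
  by move=> j _; exact: cabs_ge0.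
have Kd0 : 0 <= Kd.
  by apply: mulr_ge0; [apply: mulr_ge0 => //; exact: sqr_ge0| exact: sqr_ge0].
have Ke0 : 0 <= Ke.
  by apply: divr_ge0; [apply: mulr_ge0; [exact: mulr_ge0|exact: exprn_ge0]|exact: mul4_sqr_ge0].
have : \sum_(1 <= j < M.+1) cabs (1 - (x +i* y) ^+ 2 / (j%:R ^+ 2)%:C - sine_factor x y n j)
   <= \sum_(1 <= j < M.+1) (Kd / n%:R ^+ 2 + Ke / n%:R * (j%:R ^+ 2)^-1).
  by rewrite !big_nat; apply: ler_sum => j; exact: factor_diff_le.
move/le_trans; apply.
rewrite big_split /= sumr_const_nat subSS subn0 mulrDl.
have Mn : M.+1%:R <= n%:R :> R by rewrite ler_nat /n; clear; lia.
have nM : n%:R^-1 <= M.+1%:R^-1 :> R by rewrite lef_pV2 ?posrE ?ltr0n.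
move: Kd Ke Kd0 Ke0 => K1 K2 K10 K20; apply: lerD.
  rewrite -[_ *+ M]mulr_natr -mulrA; apply: ler_wpM2l => //; rewrite expr2 invfM -mulrA.
  apply: le_trans nM; rewrite ler_piMr ?invr_ge0 ?(ltW n0) //.
  by rewrite mulrC ler_pdivrMr // mul1r ler_nat /n; clear; lia.
rewrite -mulr_sumr -!mulrA; apply: ler_wpM2l => //; rewrite [leRHS]mulrC.
by apply: ler_pM => //; rewrite ?sumr_ge0 ?invr_ge0 ?(ltW n0) ?sum_inv_sqr_le // => j _; rewrite invr_ge0 sqr_ge0.
Qed.
End Close.

(** Tannery's theorem: the factors of [sfac_prod] converge to those of the limit
with summable bounds, so the products converge together. *)
Lemma sine_product x y :
  (fun M => 2 * pi * cabs (x +i* y) *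
    \prod_(1 <= j < M.+1) cabs (1 - (x +i* y) ^+ 2 / (j%:R ^+ 2)%:C)) @ \oo -->
  sfac x y.
Proof.
set V := 2 * pi * cabs (x +i* y).
set A := fun M => \prod_(1 <= j < M.+1) cabs (1 - (x +i* y) ^+ 2 / (j%:R ^+ 2)%:C).
set B := fun M => \prod_(1 <= j < M.+1) cabs (sine_factor x y (2 * M).+1 j).
set u := fun M => (2 * M).+1%:R * sfac (x / (2 * M).+1%:R) (y / (2 * M).+1%:R).
have uV : u @ \oo --> V by exact: cvg_sfac_small.
have V0 : 0 <= V by rewrite !mulr_ge0 ?pi_ge0 ?cabs_ge0.
have AB : (fun M => A M - B M) @ \oo --> 0.
  apply: (@cvg_le_harmonic _ _ (expR (Kb x y * 2) * (3 * pi ^+ 2 * cabs (x +i* y) ^+ 2 +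
    9 * C0 * V ^+ 3 / (4 * pi ^+ 2) * 2))).
  near=> M; rewrite subr0; apply: prod_sine_factor_close.
  have : V <= M%:R by near: M; exact: nbhs_infty_ger.
  by move/le_trans; apply; rewrite ler_nat; clear; lia.
have VB : (fun M => (V - u M) * B M) @ \oo --> 0.
  apply: (@squeeze_cvgr _ _ _ _ (fun M => - (`|V - u M| * expR (Kb x y * 2)))
      (fun M => `|V - u M| * expR (Kb x y * 2))).
  - near=> M.
    have HB : `|B M| <= expR (Kb x y * 2).
      rewrite ger0_norm; last by apply: prodr_ge0 => j _; exact: cabs_ge0.
      apply: prod_sine_factor_le.
      have : V <= M%:R by near: M; exact: nbhs_infty_ger.
      by move/le_trans; apply; rewrite ler_nat; clear; lia.
    by rewrite -ler_norml normrM ler_wpM2l.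
  - rewrite -oppr0; apply: cvgN; rewrite -(mul0r (expR (Kb x y * 2))); apply: cvgMl.
    by rewrite -(@normr0 _ R); apply: cvg_norm; rewrite -(subrr V); apply: cvgB => //; exact: cvg_cst.
  - rewrite -(mul0r (expR (Kb x y * 2))); apply: cvgMl.
    by rewrite -(@normr0 _ R); apply: cvg_norm; rewrite -(subrr V); apply: cvgB => //; exact: cvg_cst.
have -> : (fun M => V * A M) = (fun M => sfac x y + (V * (A M - B M) + (V - u M) * B M)).
  apply/funext => M; rewrite (sfac_prod x y M) -/(u M) -/(B M); ring.
rewrite -[X in _ --> X]addr0; apply: cvgD; first exact: cvg_cst.
by rewrite -(addr0 0); apply: cvgD => //; rewrite -(mulr0 V); apply: cvgMr.
Unshelve. all: by end_near. Qed.
End SineLimit.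

(** * Unconditional infinite products *)

Section UnconditionalProduct.
Variables (R : realType) (I : choiceType).
Lemma ler_sum_uniq_sub (f : I -> R) (s1 s2 : seq I) :
  uniq s1 -> uniq s2 -> {subset s1 <= s2} -> (forall i, 0 <= f i) ->
  \sum_(i <- s1) f i <= \sum_(i <- s2) f i.
Proof.
move=> u1 u2 s12 f0; rewrite [leRHS](bigID (mem s1)) /= -[leRHS]/(_ + _).
have -> : \sum_(i <- s2 | i \in s1) f i = \sum_(i <- s1) f i.
  rewrite -big_filter; apply: perm_big; apply: uniq_perm => //; first exact: filter_uniq.
  by move=> i; rewrite mem_filter; case: (boolP (i \in s1)) => //= /s12 ->.
by rewrite lerDl sumr_ge0.
Qed.

Lemma cabs_prod_1D_le (a : I -> R[i]) (s : seq I) :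
  cabs (\prod_(i <- s) (1 + a i)) <= expR (\sum_(i <- s) cabs (a i)).
Proof.
rewrite cabs_prod expR_sum; apply: ler_prod => i _; rewrite cabs_ge0 /=.
apply: le_trans (cabsD _ _) _; rewrite cabs1; exact: expR_ge1Dx.
Qed.

(** Expanding both sides, every monomial on the left is dominated by one of the
exponential series. *)
Lemma cabs_prod_1D_sub1_le (a : I -> R[i]) (s : seq I) :
  cabs (\prod_(i <- s) (1 + a i) - 1) <= expR (\sum_(i <- s) cabs (a i)) - 1.
Proof.
elim: s => [|i s IH]; first by rewrite !big_nil !subrr cabs0 expR0 subrr.
rewrite !big_cons; set P := \prod_(_ <- _) _ in IH *; set S := \sum_(_ <- _) _ in IH *.
have -> : (1 + a i) * P - 1 = (P - 1) * (1 + a i) + a i by ring.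
apply: le_trans (cabsD _ _) _; rewrite cabsM expRD.
have A : cabs (1 + a i) <= 1 + cabs (a i) by apply: le_trans (cabsD _ _) _; rewrite cabs1.
have B := expR_ge1Dx (cabs (a i)).
have S0 : 1 <= expR S by rewrite -expR0 ler_expR sumr_ge0 // => j _; exact: cabs_ge0.
have a0 := cabs_ge0 (a i); have p0 := cabs_ge0 (P - 1).
move: (cabs (1 + a i)) A (cabs (P - 1)) p0 IH => u A v p0 IH.
move: (expR S) S0 IH => e S0 IH; move: (expR _) B => f B.
apply: (@le_trans _ _ ((e - 1) * (1 + cabs (a i)) + cabs (a i))).
  rewrite lerD2r; apply: le_trans (ler_wpM2l p0 A) _.
  by rewrite ler_wpM2r // addr_ge0.
nra.
Qed.

(** Cauchy completeness along finite sets, transferred from the reals through the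
real and imaginary parts. *)
Lemma cabs_cvg_totally (g : {fset I} -> R[i]) :
  (forall e : R, 0 < e -> exists A : {fset I},
     forall F : {fset I}, (A `<=` F)%fset -> cabs (g F - g A) <= e) ->
  exists l : R[i], forall e : R, 0 < e -> exists A : {fset I},
     forall F : {fset I}, (A `<=` F)%fset -> cabs (g F - l) <= e.
Proof.
move=> H.
have tF := @summability.totally_filter I.
have key (h : R[i] -> R) : (forall z w, `|h z - h w| <= cabs (z - w)) ->
    exists l : R, forall e : R, 0 < e -> exists A : {fset I},
     forall F : {fset I}, (A `<=` F)%fset -> `|h (g F) - l| <= e.
  move=> hl.
  have : cvg ((h \o g) @ @summability.totally I).
    apply/cauchy_cvgP; apply: cauchy_exP => e e0.
    have [A HA] := H (e / 2) (divr_gt0 e0 (ltr0n _ 2)).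
    exists (h (g A)), A => //= F AF; rewrite /ball /= distrC.
    apply: le_lt_trans (le_trans (hl _ _) (HA F AF)) _.
    by rewrite ltr_pdivrMr // ltr_pMr // ltr1n.
  move/cvgrPdist_le => c; exists (lim ((h \o g) @ @summability.totally I)) => e e0.
  have [A _ HA] := c e e0; exists A => F AF; rewrite distrC; exact: HA.
have [z w|lr Hr] := key (@complex.Re R).
  by apply: le_trans (normRe_le _); rewrite raddfB.
have [z w|li Hi] := key (@complex.Im R).
  by apply: le_trans (normIm_le _); rewrite raddfB.
exists (lr +i* li) => e e0; have e2 : 0 < e / 2 by rewrite divr_gt0.
have [A HA] := Hr _ e2; have [B HB] := Hi _ e2.
exists (A `|` B)%fset => F; rewrite fsubUset => /andP[AF BF].
apply: le_trans (cabs_le_ReIm _) _.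
have := HA F AF; have := HB F BF; case: (g F) => x y /= h1 h2.
by rewrite (splitr e) lerD.
Qed.

(** Beyond a finite set that nearly attains the supremum of the sums, the remaining
factors multiply to nearly 1. *)
Lemma unconditional_product_cvg (a : I -> R[i]) (S : R) :
  (forall F : {fset I}, \sum_(i <- F) cabs (a i) <= S) ->
  exists l : R[i], forall e : R, 0 < e -> exists A : {fset I},
     forall F : {fset I}, (A `<=` F)%fset -> cabs (\prod_(i <- F) (1 + a i) - l) <= e.
Proof.
move=> HS; apply: (cabs_cvg_totally (g := fun F : {fset I} => \prod_(i <- F) (1 + a i))) => e e0.
pose E := [set x | exists F : {fset I}, x = \sum_(i <- F) cabs (a i)].
have supE : has_sup E.
  split; first by exists (\sum_(i <- fset0) cabs (a i)), fset0.
  by exists S => x [F ->].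
have M0 : 0 < expR S by exact: expR_gt0.
pose d := ln (1 + e / expR S).
have q0 : 0 < 1 + e / expR S by rewrite addr_gt0 // divr_gt0.
have d0 : 0 < d by rewrite ln_gt0 // ltrDl divr_gt0.
(* e^S (e^d - 1) = e for this d *)
have [x [A ->] HA] := sup_adherent d0 supE.
exists A => F AF.
pose B := [fset i in F | i \notin A]%fset.
have FE : {subset A <= F} by apply/fsubsetP.
have FA : [fset i in F | i \in A]%fset = A.
  by apply/fsetP => i; rewrite !inE /=; case: (boolP (i \in A)) => [/FE ->|]; rewrite ?andbF.
have sF : \sum_(i <- F) cabs (a i) = \sum_(i <- A) cabs (a i) + \sum_(i <- B) cabs (a i).
  by rewrite (big_fsetID _ (mem A)) /= FA.
have -> : \prod_(i <- F) (1 + a i) = \prod_(i <- A) (1 + a i) * \prod_(i <- B) (1 + a i).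
  by rewrite (big_fsetID _ (mem A)) /= FA.
rewrite -{2}[\prod_(i <- A) _]mulr1 -mulrBr cabsM.
have sB : \sum_(i <- B) cabs (a i) <= d.
  have : \sum_(i <- F) cabs (a i) <= sup E by apply: ub_le_sup; [case: supE|exists F].
  by rewrite sF; move: HA; move: (sup E) => T; lra.
apply: le_trans (ler_pM (cabs_ge0 _) (cabs_ge0 _) (cabs_prod_1D_le a A) (cabs_prod_1D_sub1_le a B)) _.
apply: (@le_trans _ _ (expR S * (expR d - 1))).
  apply: ler_pM; rewrite ?expR_ge0 ?ler_expR //.
    by rewrite subr_ge0 -expR0 ler_expR sumr_ge0 // => j _; exact: cabs_ge0.
  by rewrite lerD2r ler_expR.
by rewrite lnK ?posrE // addrC addKr mulrC divfK // gt_eqF.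
Qed.
End UnconditionalProduct.

(** * Symmetric ranges of integers *)

Section SymmetricRange.

(** All limits over the integers are taken symmetrically, so the range is enlarged by
a number and its opposite at once. *)
Fixpoint zrange (M : nat) : seq int :=
  if M is M'.+1 then zrange M' ++ [:: M'.+1%:Z; - M'.+1%:Z] else [:: 0].
Lemma mem_zrange M (m : int) : (m \in zrange M) = (`|m| <= M)%N.
Proof.
elim: M => [|M IH] /=; first by rewrite inE leqn0 absz_eq0.
rewrite mem_cat IH !inE; lia.
Qed.

Lemma uniq_zrange M : uniq (zrange M).
Proof.
elim: M => [|M IH] //; rewrite [zrange _]/= cat_uniq IH /= orbF !mem_zrange ?abszN ?absz_nat ltnn.
by [].
Qed.

Lemma big_zrangeS (T : Type) (idx : T) (op : Monoid.com_law idx) (F : int -> T) M :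
  \big[op/idx]_(m <- zrange M.+1) F m =
  op (\big[op/idx]_(m <- zrange M) F m) (op (F M.+1%:Z) (F (- M.+1%:Z))).
Proof. by rewrite [zrange _]/= big_cat big_cons big_seq1. Qed.

Lemma big_zrange (T : Type) (idx : T) (op : Monoid.com_law idx) (F : int -> T) M :
  \big[op/idx]_(m <- zrange M) F m =
  op (F 0) (\big[op/idx]_(1 <= j < M.+1) op (F j%:Z) (F (- j%:Z))).
Proof.
elim: M => [|M IH]; first by rewrite /= big_seq1 big_geq // Monoid.mulm1.
by rewrite big_zrangeS IH [in RHS]big_nat_recr // -[LHS]Monoid.mulmA.
Qed.

Lemma perm_zrangeN M : perm_eq (map -%R (zrange M)) (zrange M).
Proof.
apply: uniq_perm; rewrite ?uniq_zrange ?(map_inj_uniq (@oppr_inj int)) ?uniq_zrange //.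
move=> m; rewrite mem_zrange; apply/mapP/idP => [[n]|].
  by rewrite mem_zrange => H ->; rewrite abszN.
by move=> H; exists (- m); rewrite ?opprK // mem_zrange abszN.
Qed.

Lemma big_zrangeN (T : Type) (idx : T) (op : Monoid.com_law idx) (F : int -> T) M :
  \big[op/idx]_(m <- zrange M) F (- m) = \big[op/idx]_(m <- zrange M) F m.
Proof. by rewrite -[RHS](perm_big _ (perm_zrangeN M)) big_map. Qed.
End SymmetricRange.

(** * Lattice points in coordinates *)

Section LatticeBounds.
Variables (R : realType) (b : R[i] * R[i]).
Hypothesis indep : forall s t : R, s%:C * b.1 + t%:C * b.2 = 0 -> s = 0 /\ t = 0.
Definition basis_det : R :=
  complex.Re b.1 * complex.Im b.2 - complex.Im b.1 * complex.Re b.2.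
Definition pt (s t : R) : R[i] := s%:C * b.1 + t%:C * b.2.
Lemma basis_det_neq0 : basis_det != 0.
Proof.
apply/eqP; rewrite /basis_det; case: b indep => [[a1 c1] [a2 c2]] /= H D.
have [|c20 c10] := H c2 (- c1).
  by apply/eqP; rewrite eq_complex /=; apply/andP; split; apply/eqP; lra.
have [|a20 a10] := H a2 (- a1).
  by apply/eqP; rewrite eq_complex /=; apply/andP; split; apply/eqP; lra.
have [|/eqP] := H 1 0; last by rewrite oner_eq0.
apply/eqP; rewrite eq_complex /=; apply/andP; split; apply/eqP; nra.
Qed.

Lemma ptE s t : pt s t = (s * complex.Re b.1 + t * complex.Re b.2) +i*
   (s * complex.Im b.1 + t * complex.Im b.2).
Proof.
rewrite /pt; case: b => [[a1 c1] [a2 c2]] /=.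
apply/eqP; rewrite eq_complex /=; apply/andP; split; apply/eqP; ring.
Qed.

Lemma pt_inj s t s' t' : pt s t = pt s' t' -> s = s' /\ t = t'.
Proof.
move=> E; have [] := indep (s := s - s') (t := t - t').
  move/eqP: E; rewrite -subr_eq0 => /eqP <-.
  by rewrite /pt !rmorphB /=; ring.
by move=> /eqP + /eqP; rewrite !subr_eq0 => /eqP -> /eqP ->.
Qed.

Lemma pt_surj z : exists s t, z = pt s t.
Proof.
have D0 := basis_det_neq0; rewrite /basis_det in D0.
case: z => x y.
exists ((x * complex.Im b.2 - y * complex.Re b.2) / basis_det),
  ((y * complex.Re b.1 - x * complex.Im b.1) / basis_det).
rewrite ptE /basis_det; case: b D0 => [[a1 c1] [a2 c2]] /= D0.
by apply/eqP; rewrite eq_complex /=; apply/andP; split; apply/eqP; field.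
Qed.

(** Cramer's rule bounds the coordinates of a point by its modulus divided by this
length; in particular no lattice point but 0 is closer to the origin. *)
Definition basis_gap : R := `|basis_det| / (cabs b.1 + cabs b.2).
Lemma cross_le (z w : R[i]) :
  `|complex.Re z * complex.Im w - complex.Im z * complex.Re w| <= cabs z * cabs w.
Proof.
have -> : complex.Re z * complex.Im w - complex.Im z * complex.Re w = complex.Im (z^* * w).
  by case: z w => [a c] [a' c'] /=; ring.
apply: le_trans (normIm_le _) _; rewrite cabsM.
by rewrite [X in X * _ <= _](_ : _ = cabs z) // /cabs normcJ.
Qed.

Lemma basis_gap_gt0 : 0 < basis_gap.
Proof.
rewrite /basis_gap divr_gt0 ?normr_gt0 ?basis_det_neq0 //.
rewrite lt_def addr_ge0 ?cabs_ge0 // andbT; apply/eqP => H.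
have b10 : cabs b.1 = 0 by have := cabs_ge0 b.1; have := cabs_ge0 b.2; lra.
have [|/eqP] := indep (s := 1) (t := 0); last by rewrite oner_eq0.
by move/eqP: b10; rewrite cabs_eq0 => /eqP ->; rewrite mulr0 mul0r addr0.
Qed.

Lemma pt_gap s t : basis_gap * `|s| <= cabs (pt s t) /\ basis_gap * `|t| <= cabs (pt s t).
Proof.
have S0 : 0 < cabs b.1 + cabs b.2.
  have := basis_gap_gt0; rewrite /basis_gap.
  have : 0 <= cabs b.1 + cabs b.2 by rewrite addr_ge0 ?cabs_ge0.
  by rewrite le_eqVlt => /orP[/eqP <-|//]; rewrite invr0 mulr0 ltxx.
have A := cross_le (pt s t) b.2; have B := cross_le b.1 (pt s t).
rewrite /basis_gap ![_ / _ * _]mulrAC !ler_pdivrMr // -!normrM.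
have p0 := cabs_ge0 (pt s t); have b10 := cabs_ge0 b.1; have b20 := cabs_ge0 b.2.
have E1 : basis_det * s = complex.Re (pt s t) * complex.Im b.2 - complex.Im (pt s t) * complex.Re b.2.
  by rewrite ptE /basis_det /=; ring.
have E2 : basis_det * t = complex.Re b.1 * complex.Im (pt s t) - complex.Im b.1 * complex.Re (pt s t).
  by rewrite ptE /basis_det /=; ring.
rewrite E1 E2; split; first by apply: le_trans A _; rewrite ler_wpM2l // lerDr.
by apply: le_trans B _; rewrite mulrC ler_wpM2l // lerDl.
Qed.

Definition lpt (m n : int) : R[i] := pt m%:~R n%:~R.
Lemma lpt_inj m n m' n' : lpt m n = lpt m' n' -> m = m' /\ n = n'.
Proof. by move/pt_inj => [/intr_inj -> /intr_inj ->]. Qed.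

Lemma lpt_eq0 m n : (lpt m n == 0) = (m == 0) && (n == 0).
Proof.
apply/eqP/andP => [|[/eqP -> /eqP ->]]; last by rewrite /lpt /pt !mul0r addr0.
have -> : 0 = lpt 0 0 by rewrite /lpt /pt !mul0r addr0.
by move/lpt_inj => [-> ->].
Qed.

(** The exponent 3/2 is half of the exponent 3 in the sum over the lattice, so the
double sum is dominated by a product of two convergent sums. *)
Definition cube_weight (m : int) : R := ((`|m|.+1)%:R * Num.sqrt (`|m|.+1)%:R)^-1.
Lemma cube_weight_ge0 m : 0 <= cube_weight m.
Proof. by rewrite invr_ge0 mulr_ge0 // sqrtr_ge0. Qed.

(** The sum over 1 <= j <= n is dominated by the telescoping sum of value
2 (1 - (n + 1)^(-1/2)). *)
Lemma sum_cube_weight_le M : \sum_(m <- zrange M) cube_weight m <= 5.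
Proof.
have H : forall n, \sum_(1 <= j < n.+1) cube_weight j%:Z <= 2 * (1 - (Num.sqrt n.+1%:R)^-1) :> R.
  elim=> [|n IH]; first by rewrite big_geq // sqrtr1 invr1 subrr mulr0.
  rewrite big_nat_recr //=; apply: le_trans (lerD IH (lexx _)) _.
  rewrite /cube_weight absz_nat.
  set x := Num.sqrt n.+1%:R; set y := Num.sqrt n.+2%:R.
  have x0 : 0 < x by rewrite sqrtr_gt0.
  have y0 : 0 < y by rewrite sqrtr_gt0.
  have x2 : x ^+ 2 = n.+1%:R by rewrite sqr_sqrtr.
  have y2 : y ^+ 2 = n.+2%:R by rewrite sqr_sqrtr.
  have xy : y ^+ 2 - x ^+ 2 = 1 by rewrite x2 y2 -natrB // subSnn.
  have lxy : x <= y by rewrite ler_sqrt // ler_nat.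
  rewrite -y2 -subr_ge0.
  have -> : 2 * (1 - y^-1) - (2 * (1 - x^-1) + (y ^+ 2 * y)^-1) =
     (2 * (y - x) * y ^+ 2 - x) / (x * y ^+ 3).
    by field; rewrite !gt_eqF.
  rewrite divr_ge0 ?mulr_ge0 ?exprn_ge0 ?(ltW x0) ?(ltW y0) // subr_ge0.
  have e : (y - x) * (y + x) = 1 by rewrite -subr_sqr.
  have d0 : 0 <= y - x by rewrite subr_ge0.
  apply: (@le_trans _ _ y) => //.
  have : (y - x) * (y + x) * y <= (y - x) * (y + y) * y.
    by rewrite ler_wpM2r ?(ltW y0) // ler_wpM2l // lerD2l.
  by rewrite e mul1r; move/le_trans; apply; rewrite le_eqVlt; apply/orP; left; apply/eqP; ring.
rewrite big_zrange /=.
have wN j : cube_weight (- j%:Z) = cube_weight j%:Z by rewrite /cube_weight abszN.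
under eq_bigr do rewrite wN -mulr2n.
rewrite sumrMnl {1}/cube_weight absz0 sqrtr1 mul1r invr1.
have := H M; have : 0 <= (Num.sqrt M.+1%:R)^-1 :> R by rewrite invr_ge0 sqrtr_ge0.
by rewrite mulr2n; lra.
Qed.

(** The modulus is at least a multiple of max(|m|, |n|), whose cube dominates
((|m| + 1) (|n| + 1))^(3/2) up to a constant. *)
Lemma cabs_lpt_cube m n : lpt m n != 0 ->
  (cabs (lpt m n) ^+ 3)^-1 <= 8 / basis_gap ^+ 3 * (cube_weight m * cube_weight n).
Proof.
rewrite lpt_eq0 negb_and => mn.
have c0 := basis_gap_gt0.
have [A B] := pt_gap m%:~R n%:~R; rewrite -/(lpt m n) in A B.
rewrite -!intr_norm -!abszE in A B.
have k1 : (1 <= maxn `|m| `|n|)%N by rewrite leq_max !absz_gt0.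
set k := maxn `|m| `|n| in k1.
have K : basis_gap * k%:R <= cabs (lpt m n) by rewrite /k /maxn; case: ifP.
have k0 : 0 < k%:R :> R by rewrite ltr0n.
have gk0 : 0 < basis_gap * k%:R by rewrite mulr_gt0.
have p0 : 0 < cabs (lpt m n) by apply: lt_le_trans K.
apply: (@le_trans _ _ ((basis_gap * k%:R) ^+ 3)^-1).
  by rewrite lef_pV2 ?posrE ?exprn_gt0 // lerXn2r ?nnegrE ?(ltW gk0) ?(ltW p0).
rewrite exprMn invfM [8 / _]mulrC -mulrA ler_wpM2l ?invr_ge0 ?exprn_ge0 ?(ltW c0) //.
pose u : R := Num.sqrt `|m|.+1%:R; pose v : R := Num.sqrt `|n|.+1%:R.
have u0 : 0 < u by rewrite sqrtr_gt0.
have v0 : 0 < v by rewrite sqrtr_gt0.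
have u2 : u ^+ 2 = `|m|.+1%:R by rewrite sqr_sqrtr.
have v2 : v ^+ 2 = `|n|.+1%:R by rewrite sqr_sqrtr.
have uk : u ^+ 2 <= 2 * k%:R.
  by rewrite u2 -natrM ler_nat /k; move: (leq_maxl `|m| `|n|) k1; rewrite -/k; clear; lia.
have vk : v ^+ 2 <= 2 * k%:R.
  by rewrite v2 -natrM ler_nat /k; move: (leq_maxr `|m| `|n|) k1; rewrite -/k; clear; lia.
rewrite /cube_weight -/u -/v -u2 -v2 -invfM -ler_pdivrMl // -invfM lef_pV2 ?posrE; last 2 first.
- by rewrite !mulr_gt0 ?exprn_gt0.
- by rewrite !mulr_gt0 ?exprn_gt0.
rewrite -ler_sqr ?nnegrE ?mulr_ge0 ?exprn_ge0 ?(ltW u0) ?(ltW v0) ?(ltW k0) //.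
have -> : (u ^+ 2 * u * (v ^+ 2 * v)) ^+ 2 = (u ^+ 2) ^+ 3 * (v ^+ 2) ^+ 3 by ring.
have -> : (8 * k%:R ^+ 3) ^+ 2 = (2 * k%:R) ^+ 3 * (2 * k%:R) ^+ 3 :> R by ring.
have k2 : 0 <= 2 * k%:R :> R by rewrite mulr_ge0.
apply: ler_pM; [by apply: exprn_ge0; exact: sqr_ge0|by apply: exprn_ge0; exact: sqr_ge0|
  by apply: lerXn2r => //; exact: sqr_ge0|by apply: lerXn2r => //; exact: sqr_ge0].
Qed.

Definition box (M N : nat) : seq R[i] := [seq lpt m n | n <- zrange N, m <- zrange M].
Lemma mem_box M N m n : (lpt m n \in box M N) = (`|m| <= M)%N && (`|n| <= N)%N.
Proof.
apply/allpairsP/andP => [[[n' m']] /= []|[mM nN]].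
  by rewrite !mem_zrange => H1 H2 /lpt_inj[-> ->].
by exists (n, m); rewrite !mem_zrange.
Qed.

Lemma uniq_box M N : uniq (box M N).
Proof.
apply: allpairs_uniq; rewrite ?uniq_zrange //.
by move=> [n m] [n' m'] _ _ /= /lpt_inj[-> ->].
Qed.

Lemma big_box (T : Type) (idx : T) (op : Monoid.com_law idx) (F : R[i] -> T) M N :
  \big[op/idx]_(w <- box M N) F w =
  \big[op/idx]_(n <- zrange N) \big[op/idx]_(m <- zrange M) F (lpt m n).
Proof. exact: big_allpairs_dep. Qed.

Lemma sum_box_le M N : \sum_(w <- box M N | w != 0) (cabs w ^+ 3)^-1 <= 200 / basis_gap ^+ 3.
Proof.
rewrite big_mkcond big_box /=.
have c0 := basis_gap_gt0.
apply: (@le_trans _ _ (\sum_(n <- zrange N) \sum_(m <- zrange M) 8 / basis_gap ^+ 3 * (cube_weight m * cube_weight n))).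
  apply: ler_sum => n _; apply: ler_sum => m _; case: ifP => [|_]; first exact: cabs_lpt_cube.
  by rewrite !mulr_ge0 ?cube_weight_ge0 ?invr_ge0 ?exprn_ge0 // ltW.
under eq_bigr do rewrite -mulr_sumr -mulr_suml.
rewrite -mulr_sumr -mulr_sumr.
have s0 K : 0 <= \sum_(m <- zrange K) cube_weight m by apply: sumr_ge0 => m _; exact: cube_weight_ge0.
have -> : 200 / basis_gap ^+ 3 = 8 / basis_gap ^+ 3 * (5 * 5) by ring.
rewrite ler_wpM2l ?divr_ge0 ?exprn_ge0 ?(ltW c0) //.
by rewrite ler_pM ?s0 ?sum_cube_weight_le.
Qed.
End LatticeBounds.

(** * Convergence of the product defining sigma *)

Section SigmaProduct.
Variables (R : realType) (L : set R[i]) (b : R[i] * R[i]).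
Hypothesis Lb : lattice_basis L b.
Let indep := Lb.1.
Lemma lattice_mem w : L w <-> exists m n : int, w = lpt b m n.
Proof.
rewrite Lb.2 /=; split=> -[m [n ->]]; exists m, n; rewrite /lpt /pt ?rmorph_int //.
Qed.

Definition factor_bound (U : R) : R :=
  2^-1 + 3 / 8 * U + U ^+ 2 / 8 + (1 + U) * (8 * ((1 + U / 2) ^+ 3 * expR (U * (1 + U / 2)))).
Lemma factor_bound_ge0 U : 0 <= U -> 0 <= factor_bound U.
Proof. by move=> U0; rewrite !(addr_ge0, mulr_ge0, exprn_ge0, expR_ge0, invr_ge0). Qed.

(** The exponent cancels log(1 - u) up to order u^3. *)
Lemma primary_factor_le (u : R[i]) (U : R) : cabs u <= U ->
  cabs ((1 - u) * cexp (u + u ^+ 2 / 2) - 1) <= factor_bound U * cabs u ^+ 3.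
Proof.
move=> uU; set v := u + u ^+ 2 / 2.
have u0 := cabs_ge0 u; have U0 : 0 <= U by apply: le_trans uU.
have vle : cabs v <= cabs u * (1 + U / 2).
  apply: le_trans (cabsD _ _) _; rewrite mulrDr mulr1 lerD2l cabsM cabsX cabsV.
  rewrite -(rmorph_nat (real_complex R)) cabs_real ger0_norm // expr2 -!mulrA.
  by rewrite ler_wpM2l // ler_wpM2r ?invr_ge0.
have vle2 : cabs v <= U * (1 + U / 2).
  by apply: le_trans vle _; rewrite ler_wpM2r // addr_ge0 // divr_ge0.
pose E := cexp v - 1 - v - v ^+ 2 / 2.
(* the polynomial part of (1 - u) exp(v) - 1 begins at u^3 *)
have -> : (1 - u) * cexp v - 1 =
   - (u ^+ 3 * (2^-1%:C + (3 / 8)%:C * u + u ^+ 2 * 8^-1%:C)) + (1 - u) * E.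
  rewrite !(realCM, realCV) !(rmorph_nat (real_complex R)).
  by rewrite /E /v; field.
have EB : cabs E <= 8 * (cabs v ^+ 3 * expR (cabs v)) := cexp_taylor2 v.
apply: le_trans (cabsD _ _) _; rewrite cabsN /factor_bound [leRHS]mulrDl; apply: lerD.
  rewrite cabsM cabsX mulrC ler_wpM2r ?exprn_ge0 //.
  apply: le_trans (cabsD _ _) _; apply: lerD.
    apply: le_trans (cabsD _ _) _; rewrite cabs_real cabsM cabs_real !ger0_norm ?divr_ge0 ?invr_ge0 //.
    by rewrite lerD2l ler_wpM2l // divr_ge0.
  rewrite cabsM cabsX cabs_real ger0_norm ?invr_ge0 // ler_wpM2r ?invr_ge0 //.
  by rewrite lerXn2r ?nnegrE.
rewrite cabsM -[leRHS]mulrA; apply: ler_pM; rewrite ?cabs_ge0 //.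
  by apply: le_trans (cabsD _ _) _; rewrite cabs1 cabsN lerD2l.
apply: le_trans EB _; set X := expR (U * _).
have -> : 8 * ((1 + U / 2) ^+ 3 * X) * cabs u ^+ 3 = 8 * ((cabs u * (1 + U / 2)) ^+ 3 * X) by ring.
apply: ler_wpM2l => //; apply: ler_pM; rewrite ?expR_ge0 ?ler_expR //.
  by apply: exprn_ge0; exact: cabs_ge0.
apply: lerXn2r => //; rewrite nnegrE ?cabs_ge0 //.
by rewrite mulr_ge0 // addr_ge0 // divr_ge0.
Qed.

Lemma lattice_norm_ge w : L w -> w != 0 -> basis_gap b <= cabs w.
Proof.
move/lattice_mem => [m [n ->]]; rewrite lpt_eq0 // negb_and => mn.
have [A B] := pt_gap indep m%:~R n%:~R; have c0 := basis_gap_gt0 indep.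
have g k : k != 0 -> basis_gap b <= basis_gap b * `|k%:~R|.
  by move=> k0; rewrite ler_peMr ?(ltW c0) // -intr_norm -[1]/(1%:~R) ler_int; lia.
by case/orP: mn => /g h; apply: le_trans h _.
Qed.

(** Putting 1 for the factors that the product omits lets the finite sets range over
all complex numbers. *)
Definition term z w : R[i] :=
  if (w != 0) && (w \in L) then weierstrass_factor z w - 1 else 0.
Definition term_bound z : R := factor_bound (cabs z / basis_gap b) * cabs z ^+ 3.
Lemma term_le z w : cabs (term z w) <=
  if (w != 0) && (w \in L) then term_bound z * (cabs w ^+ 3)^-1 else 0.
Proof.
rewrite /term; case: ifP => [/andP[w0 /set_mem wL]|]; last by rewrite cabs0.
have c0 := basis_gap_gt0 indep; have gw := lattice_norm_ge wL w0.
have cw : 0 < cabs w by apply: lt_le_trans gw.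
have H : cabs (z / w) <= cabs z / basis_gap b.
  by rewrite cabsM cabsV ler_wpM2l ?cabs_ge0 // lef_pV2.
have := primary_factor_le H; rewrite /weierstrass_factor.
have -> : (z / w) ^+ 2 / 2 = z ^+ 2 / (2 * w ^+ 2) by field; rewrite w0.
have -> // : term_bound z / cabs w ^+ 3 =
  factor_bound (cabs z / basis_gap b) * cabs (z / w) ^+ 3.
by rewrite [cabs (z / w)]cabsM cabsV exprMn exprVn mulrA.
Qed.

Lemma fset_sub_box (F : {fset R[i]}) : exists K : nat,
  forall w, w \in F -> L w -> w \in box b K K.
Proof.
suff H : forall s : seq R[i], exists K : nat, forall w, w \in s -> L w -> w \in box b K K.
  by have [K HK] := H F; exists K => w wF; exact: HK.
elim=> [|x s [K HK]]; first by exists 0%N.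
have [xL|xL] := pselect (L x); last first.
  by exists K => w; rewrite inE => /orP[/eqP ->|] //; exact: HK.
have [m [n xE]] := (lattice_mem x).1 xL.
exists (maxn K (maxn `|m| `|n|)) => w; rewrite inE => /orP[/eqP -> _|ws wL].
  by rewrite xE mem_box // !leq_max !leqnn !orbT.
have := HK w ws wL; have [p [q ->]] := (lattice_mem w).1 wL.
by rewrite !mem_box // !leq_max => /andP[-> ->].
Qed.

Lemma sum_term_le z (F : {fset R[i]}) :
  \sum_(w <- F) cabs (term z w) <= term_bound z * (200 / basis_gap b ^+ 3).
Proof.
have [K HK] := fset_sub_box F.
have c0 := basis_gap_gt0 indep.
have tb0 : 0 <= term_bound z.
  by rewrite mulr_ge0 ?exprn_ge0 ?cabs_ge0 // factor_bound_ge0 // divr_ge0 ?cabs_ge0 // ltW.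
apply: (@le_trans _ _ (\sum_(w <- F | (w != 0) && (w \in L)) term_bound z * (cabs w ^+ 3)^-1)).
  by rewrite [leRHS]big_mkcond; apply: ler_sum => w _; exact: term_le.
rewrite -mulr_sumr; apply: ler_wpM2l => //.
apply: le_trans (sum_box_le indep K K).
rewrite -big_filter -[leRHS]big_filter; apply: ler_sum_uniq_sub.
- by rewrite filter_uniq // fset_uniq.
- by rewrite filter_uniq // uniq_box.
- by move=> w; rewrite !mem_filter => /andP[/andP[-> /set_mem wL] wF] /=; exact: HK.
- by move=> w; rewrite invr_ge0 exprn_ge0 // cabs_ge0.
Qed.

Lemma prod_termE z (F : {fset R[i]}) :
  \prod_(w <- F | (w != 0) && (w \in L)) weierstrass_factor z w = \prod_(w <- F) (1 + term z w).
Proof.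
rewrite big_mkcond; apply: eq_bigr => w _; rewrite /term; case: ifP => _; last by rewrite addr0.
by rewrite addrC subrK.
Qed.

(** Terms are of order |w|^(-3), which is summable over the lattice. *)
Lemma sigma_limit z : exists l : R[i], sigma L z = z * l /\
  forall e : R, 0 < e -> exists A : {fset R[i]},
     forall F : {fset R[i]}, (A `<=` F)%fset -> cabs (\prod_(w <- F) (1 + term z w) - l) <= e.
Proof.
have [l Hl] := unconditional_product_cvg (sum_term_le z).
exists l; split=> //; rewrite /sigma; congr (_ * _).
have tF := @summability.totally_filter R[i].
apply: (@cvg_lim R[i]^o (@norm_hausdorff _ _)); apply/cvgrPdist_le => e e0.
have e0' : 0 < complex.Re e by move: e0; rewrite ltcE => /andP[].
have [A HA] := Hl _ e0'.
exists A => //= F AF; rewrite distrC prod_termE cabsE.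
have -> : e = (complex.Re e)%:C.
  by move: e0; rewrite ltcE /= => /andP[/eqP]; case: (e) => x y /= ->.
by rewrite lecR; exact: HA.
Qed.

(** Large boxes contain any given finite set of lattice points, so the
unconditional product may be computed along boxes. *)
Lemma sigma_box z (e : R) : 0 < e -> exists K : nat, forall M N, (K <= M)%N -> (K <= N)%N ->
  cabs (z * \prod_(w <- box b M N | w != 0) weierstrass_factor z w - sigma L z) <= e.
Proof.
move=> e0; have [l [-> Hl]] := sigma_limit z.
have z1 : 0 < cabs z + 1 by rewrite ltr_wpDl ?cabs_ge0.
have [A HA] := Hl _ (divr_gt0 e0 z1).
have [K HK] := fset_sub_box A; exists K => M N KM KN.
(* elements of A off the lattice contribute factors 1 *)
pose F := ([fset w in box b M N] `|` A)%fset.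
have -> : \prod_(w <- box b M N | w != 0) weierstrass_factor z w =
   \prod_(w <- F) (1 + term z w).
  rewrite -prod_termE -[RHS]big_filter -[LHS]big_filter; apply: perm_big.
  apply: uniq_perm; rewrite ?filter_uniq ?uniq_box ?fset_uniq // => w.
  rewrite !mem_filter /F !inE /=.
  case: (w != 0) => //=; apply/idP/idP => [wB|].
    rewrite wB andbT; apply/mem_set/lattice_mem.
    by move: wB => /allpairsP[[n m] /= [_ _ ->]]; exists m, n.
  move=> /andP[/set_mem wL /orP[//|wA]].
  have := HK w wA wL; have [p [q ->]] := (lattice_mem w).1 wL.
  by rewrite !mem_box // => /andP[/leq_trans -> // /leq_trans ->].
rewrite -mulrBr cabsM.
apply: le_trans (_ : (cabs z + 1) * (e / (cabs z + 1)) <= _); last first.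
  by rewrite mulrC divfK // gt_eqF.
apply: ler_pM; rewrite ?cabs_ge0 // ?lerDl //.
by apply: HA; rewrite fsubsetUr.
Qed.
End SigmaProduct.

(** * Products over the rows of the lattice *)

Section Rows.
Variables (R : realType) (b : R[i] * R[i]).
Hypothesis indep : forall s t : R, s%:C * b.1 + t%:C * b.2 = 0 -> s = 0 /\ t = 0.
Let tau := b.2 / b.1.
Definition tau_re : R := complex.Re (b.2 / b.1).
Definition tau_im : R := complex.Im (b.2 / b.1).
Lemma b1_neq0 : b.1 != 0.
Proof.
apply/eqP => b10; have [|/eqP] := indep (s := 1) (t := 0); last by rewrite oner_eq0.
by rewrite b10 mulr0 mul0r addr0.
Qed.

Lemma tau_pt s t : pt b s t = b.1 * ((s + t * tau_re) +i* (t * tau_im)).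
Proof.
have E : b.2 = b.1 * (tau_re +i* tau_im).
  by rewrite /tau_re /tau_im -[RHS]mulr1 -{1}(divfK b1_neq0 b.2) mulrC mulr1; congr (_ * _); case: (_ / _).
rewrite /pt {1}E; case: (b.1) => x y /=.
by apply/eqP; rewrite eq_complex /=; apply/andP; split; apply/eqP; ring.
Qed.

Lemma tau_im_neq0 : tau_im != 0.
Proof.
apply/eqP => t0; have [|_ /eqP] := indep (s := - tau_re) (t := 1); last by rewrite oner_eq0.
by rewrite -/(pt b _ _) tau_pt t0 mul1r addNr mulr0 (_ : 0 +i* 0 = 0) // mulr0.
Qed.

Lemma sfac_gt0 (x y : R) : y != 0 -> 0 < sfac x y.
Proof.
move=> y0; rewrite mulr_gt0 ?expR_gt0 // lt_def cabs_ge0 andbT cabs_eq0 subr_eq0.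
apply/eqP => /(congr1 (@cabs R)); rewrite cabs1 cabs_nome => /eqP; rewrite eq_sym -[X in _ == X]expR0.
rewrite (inj_eq (@expR_inj R)) oppr_eq0 !mulf_eq0 normr_eq0 (negbTE y0) orbF pnatr_eq0 /=.
by rewrite gt_eqF // pi_gt0.
Qed.

(** A product over one row of the lattice, in the coordinate where the row is the
set of integers. *)
Definition rho (M : nat) (x y : R) : R := \prod_(m <- zrange M) cabs ((x + m%:~R) +i* y).
Definition rho_scale (M : nat) : R := 2 * pi / (\prod_(1 <= j < M.+1) (j%:R ^+ 2)).
Lemma rhoE M x y : rho_scale M * rho M x y =
   2 * pi * cabs (x +i* y) * \prod_(1 <= j < M.+1) cabs (1 - (x +i* y) ^+ 2 / (j%:R ^+ 2)%:C).
Proof.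
rewrite /rho_scale /rho big_zrange /= addr0; set P := \prod_(1 <= j < _) _; set Q := \prod_(1 <= j < _) _.
have -> : 2 * pi / P * (cabs (x +i* y) * Q) = 2 * pi * cabs (x +i* y) * (P^-1 * Q) by ring.
rewrite /P /Q; congr (_ * _).
rewrite -prodfV -big_split /= !big_nat; apply: eq_bigr => j /andP[j0 _].
have jR : j%:R != 0 :> R by rewrite pnatr_eq0 -lt0n.
rewrite -cabsM -[(_ ^+ 2)^-1]ger0_norm ?invr_ge0 ?sqr_ge0 // -cabs_real -cabsM realCV.
have jC : (j%:R ^+ 2)%:C != 0 :> R[i].
  by rewrite -(rmorph0 (real_complex R)) (inj_eq (@complexI R)) expf_neq0.
rewrite -[in RHS](cabsN); congr cabs.
have -> : ((x + j%:~R) +i* y) * ((x + (- j%:Z)%:~R) +i* y) = (x +i* y) ^+ 2 - (j%:R ^+ 2)%:C.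
  rewrite mulrNz pmulrn expr2; apply/eqP; rewrite eq_complex /=.
  by apply/andP; split; apply/eqP; rewrite -?pmulrn; ring.
by rewrite mulrBr mulVf // opprB mulrC.
Qed.

(** The factors at m and - m of a row multiply to those of the sine product. *)
Lemma rho_cvg x y : (fun M => rho_scale M * rho M x y) @ \oo --> sfac x y.
Proof. by under eq_fun do rewrite rhoE; exact: sine_product. Qed.

Lemma rho_scale_gt0 M : 0 < rho_scale M.
Proof.
rewrite divr_gt0 ?mulr_gt0 ?pi_gt0 // big_nat; apply: prodr_gt0 => j /andP[j0 _].
by rewrite exprn_gt0 // ltr0n.
Qed.

(** With [ry], the real and imaginary parts of s + (t + n) tau. Divided by b1, the
differences between the point (s, t) and the lattice points of a row are such a
number plus the integers. *)
Definition rx (s t : R) (n : int) : R := s + (t + n%:~R) * tau_re.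
Definition ry (t : R) (n : int) : R := (t + n%:~R) * tau_im.

(** The Weierstrass product over a box without its exponential factors. *)
Definition plain_box (z : R[i]) (M N : nat) : R :=
  cabs z * \prod_(w <- box b M N | w != 0) cabs (1 - z / w).

(** The limit of [plain_box] when the rows become infinite. *)
Definition plain_rows (s t : R) (N : nat) : R :=
  cabs b.1 / (2 * pi) * (\prod_(n <- zrange N) sfac (rx s t n) (ry t n)) /
    \prod_(1 <= j < N.+1) (sfac (rx 0 0 j%:Z) (ry 0 j%:Z) ^+ 2).
Lemma sub_pt s t m n : lpt b m n - pt b s t =
  b.1 * ((- rx s t (- n) + m%:~R) +i* (- ry t (- n))).
Proof.
have -> : lpt b m n - pt b s t = pt b (m%:~R - s) (n%:~R - t).
  by rewrite /lpt /pt !rmorphB /=; ring.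
rewrite tau_pt /rx /ry mulrNz; congr (_ * _); apply/eqP; rewrite eq_complex /=.
by apply/andP; split; apply/eqP; ring.
Qed.

Lemma row_neq0 (s t : R) M (n : int) : n != 0 ->
  \prod_(m <- zrange M) (if lpt b m n != 0 then cabs (1 - pt b s t / lpt b m n) else 1) =
  rho M (- rx s t (- n)) (- ry t (- n)) / rho M (- rx 0 0 (- n)) (- ry 0 (- n)).
Proof.
move=> n0; rewrite /rho -prodf_div; apply: eq_bigr => m _.
have l0 : lpt b m n != 0 by rewrite lpt_eq0 // negb_and n0 orbT.
rewrite l0; have -> : 1 - pt b s t / lpt b m n = (lpt b m n - pt b s t) / lpt b m n.
  by rewrite mulrBl mulfV.
have := sub_pt 0 0 m n; rewrite [pt b 0 0](_ : _ = 0) ?subr0; last first.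
  by rewrite /pt !mul0r addr0.
rewrite cabsM cabsV sub_pt => ->; rewrite !cabsM invfM mulrACA mulfV ?mul1r //.
by rewrite cabs_eq0 b1_neq0.
Qed.

Lemma row_eq0 (s t : R) M :
  cabs (pt b s t) * \prod_(m <- zrange M) (if lpt b m 0 != 0 then cabs (1 - pt b s t / lpt b m 0) else 1) =
  cabs b.1 / (2 * pi) * (rho_scale M * rho M (- rx s t 0) (- ry t 0)).
Proof.
rewrite /rho_scale; set P := \prod_(1 <= j < _) _; have c0 : 2 * pi != 0 :> R.
  by rewrite mulf_neq0 // gt_eqF // pi_gt0.
have -> : cabs b.1 / (2 * pi) * (2 * pi / P * rho M (- rx s t 0) (- ry t 0)) =
   ((2 * pi)^-1 * (2 * pi)) * (cabs b.1 * (P^-1 * rho M (- rx s t 0) (- ry t 0))) by ring.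
rewrite mulVf // mul1r.
rewrite /rho !big_zrange /= !addr0.
have -> : lpt b 0 0 = 0 by rewrite /lpt /pt !mul0r addr0.
rewrite eqxx /= mul1r.
have E m : lpt b m 0 = b.1 * (m%:~R)%:C.
  by rewrite /lpt /pt mul0r addr0 mulrC.
have -> : cabs (pt b s t) = cabs b.1 * cabs (- rx s t 0 +i* - ry t 0).
  have := sub_pt s t 0 0; rewrite E mulr0 sub0r => /(congr1 (@cabs R)).
  by rewrite cabsN oppr0 addr0 cabsM => ->.
rewrite [X in _ = _ * X]mulrCA -!mulrA /P; congr (_ * (_ * _)).
rewrite -prodfV -big_split /= !big_nat; apply: eq_bigr => j /andP[j0 _].
have jR : j%:R != 0 :> R by rewrite pnatr_eq0 -lt0n.
have F (m : int) : m != 0 -> cabs (1 - pt b s t / lpt b m 0) =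
    cabs ((- rx s t 0 + m%:~R) +i* - ry t 0) / `|m%:~R|.
  move=> m0; have l0 : lpt b m 0 != 0 by rewrite lpt_eq0 // negb_and m0.
  have -> : 1 - pt b s t / lpt b m 0 = (lpt b m 0 - pt b s t) / lpt b m 0.
    by rewrite mulrBl mulfV.
  rewrite cabsM cabsV sub_pt oppr0 E !cabsM cabs_real invfM mulrACA mulfV ?mul1r //.
  by rewrite cabs_eq0 b1_neq0.
have j0' : j%:Z != 0 by rewrite eqz_nat -lt0n.
rewrite !lpt_eq0 // oppr_eq0 (negbTE j0') /= !F ?oppr_eq0 //.
rewrite mulrNz normrN -pmulrn ger0_norm // mulrACA -invfM mulrC; congr (_^-1 * _).
Qed.

Lemma plain_boxE s t M N : plain_box (pt b s t) M N =
   cabs b.1 / (2 * pi) * (\prod_(n <- zrange N) (rho_scale M * rho M (- rx s t (- n)) (- ry t (- n)))) /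
   \prod_(1 <= j < N.+1) ((rho_scale M * rho M (- rx 0 0 (- j%:Z)) (- ry 0 (- j%:Z))) *
                          (rho_scale M * rho M (- rx 0 0 j%:Z) (- ry 0 j%:Z))).
Proof.
rewrite /plain_box big_mkcond big_box /= big_zrange /= mulrA row_eq0 -[LHS]mulrA -[RHS]mulrA.
rewrite [X in _ = _ * (X / _)]big_zrange /= oppr0 -[X in _ = _ * X]mulrA; congr (_ * (_ * _)).
rewrite -prodfV -big_split /= !big_nat; apply: eq_bigr => j /andP[j0 _].
have j0' : j%:Z != 0 by rewrite eqz_nat -lt0n.
rewrite !row_neq0 ?oppr_eq0 // !opprK; have := rho_scale_gt0 M; move: (rho_scale M) => c c0.
rewrite !invfM; set A := rho _ _ _; set B := rho _ _ _; set C := rho _ _ _; set D := rho _ _ _.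
rewrite (_ : c * A * (c * C) * (c^-1 * B^-1 * (c^-1 * D^-1)) =
   (c * c^-1) * (c * c^-1) * (A / B * (C / D))); last by ring.
by rewrite mulfV ?gt_eqF // !mul1r.
Qed.

Lemma plain_box_cvg s t N : (fun M => plain_box (pt b s t) M N) @ \oo --> plain_rows s t N.
Proof.
under eq_fun do rewrite plain_boxE.
have mc : continuous (fun x : R * R => x.1 * x.2) by move=> x; exact: mul_continuous.
apply: cvgM; last first.
  apply: cvgV.
    rewrite gt_eqF // big_nat; apply: prodr_gt0 => j /andP[j0 _]; rewrite exprn_gt0 // sfac_gt0 //.
    by rewrite /ry add0r mulf_neq0 ?tau_im_neq0 // intr_eq0 -lt0n.
  apply: (cvg_big mc) => j _; rewrite expr2; apply: cvgM.
    rewrite -(_ : sfac (- rx 0 0 (- j%:Z)) (- ry 0 (- j%:Z)) = sfac (rx 0 0 j%:Z) (ry 0 j%:Z)).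
      exact: rho_cvg.
    by rewrite /rx /ry !mulrNz !add0r !mulNr !opprK.
  rewrite -sfacN; exact: rho_cvg.
apply: cvgMr.
rewrite -big_zrangeN; apply: (cvg_big mc) => n _; rewrite -sfacN; exact: rho_cvg.
Qed.

(** The coefficient of z^2 in the exponents collected over a box. *)
Definition box_square (M N : nat) : R[i] := \sum_(w <- box b M N | w != 0) (2 * w ^+ 2)^-1.

(** A box is symmetric about 0. *)
Lemma sum_box_odd z M N : \sum_(w <- box b M N | w != 0) z / w = 0.
Proof.
have E : \sum_(w <- box b M N | w != 0) z / w = - \sum_(w <- box b M N | w != 0) z / w.
  rewrite [LHS]big_mkcond [in RHS]big_mkcond !big_box /= -sumrN -big_zrangeN; apply: eq_bigr => n _.
  rewrite -sumrN -big_zrangeN; apply: eq_bigr => m _.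
  have -> : lpt b (- m) (- n) = - lpt b m n.
    by rewrite /lpt /pt !mulrNz !rmorphN /= !mulNr opprD.
  by rewrite oppr_eq0; case: ifP => _; rewrite ?oppr0 // invrN mulrN.
apply/eqP; move/eqP: E; rewrite -subr_eq0 opprK -mulr2n -mulr_natr mulf_eq0 pnatr_eq0 orbF.
by [].
Qed.

Lemma box_modulus z M N :
  cabs (z * \prod_(w <- box b M N | w != 0) weierstrass_factor z w) =
  plain_box z M N * expR (complex.Re (z ^+ 2 * box_square M N)).
Proof.
rewrite cabsM cabs_prod /plain_box -mulrA; congr (_ * _).
under eq_bigr do rewrite /weierstrass_factor cabsM cabs_cexp.
rewrite big_split /=; congr (_ * _); rewrite -expR_sum; congr expR.
rewrite -(raddf_sum (@complex.Re R)) big_split /= sum_box_odd add0r mulr_sumr.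
by [].
Qed.
End Rows.

(** * Products with geometrically decaying factors *)

Section GeometricProducts.
Variable R : realType.
Lemma cvg_geometric_increments (u : nat -> R) (K q : R) : 0 <= q < 1 ->
  (forall n, `|u n.+1 - u n| <= K * q ^+ n) -> cvgn u.
Proof.
move=> /andP[q0 q1] H.
have qn : `|q| < 1 by rewrite ger0_norm.
have c : cvgn (series (telescope u)).
  have gc : cvgn (series (geometric K q)) := @is_cvg_geometric_series R K q qn.
  have tn n : 0 <= `|telescope u n| by [].
  have Kn n : 0 <= geometric K q n.
    by rewrite /= mulr_ge0 ?exprn_ge0 // (le_trans _ (le_trans (H 0%N) _)) // expr0 mulr1.
  exact: normed_cvg (series_le_cvg tn Kn H gc).
have E : u = (fun n => u 0%N + series (telescope u) n).
  by apply/funext => n; rewrite -eq_sum_telescope.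
by rewrite E; apply: is_cvgD => //; exact: is_cvg_cst.
Qed.
Variables (f : nat -> R) (C q : R).
Hypotheses (C0 : 0 <= C) (q01 : 0 <= q < 1) (fC : forall n, `|f n - 1| <= C * q ^+ n).
Let q0 : 0 <= q. Proof. by case/andP: q01. Qed.
Let q1 : 0 < 1 - q. Proof. by case/andP: q01 => _; rewrite subr_gt0. Qed.
Lemma sum_geometric_le m n : \sum_(m <= j < n) q ^+ j <= (1 - q)^-1.
Proof.
apply: (@le_trans _ _ (\sum_(0 <= j < n) q ^+ j)).
  have [mn|nm] := leqP m n; last first.
    by rewrite (big_geq (ltnW nm)) sumr_ge0 // => i _; exact: exprn_ge0.
  by rewrite [leRHS](@big_cat_nat _ _ _ m) //= lerDr sumr_ge0 // => i _; exact: exprn_ge0.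
rewrite big_mkord.
have -> : \sum_(i < n) q ^+ i = (1 - q ^+ n) / (1 - q).
  apply: (mulIf (lt0r_neq0 q1)); rewrite divfK ?gt_eqF // mulrC -opprB mulNr -subrX1.
  by rewrite opprB.
by rewrite ler_pdivrMr // mulVf ?gt_eqF // gerBl exprn_ge0.
Qed.

Lemma prod_geometric_le n : `|\prod_(0 <= j < n) f j| <= expR (C / (1 - q)).
Proof.
rewrite normr_prod; apply: (@le_trans _ _ (expR (\sum_(0 <= j < n) C * q ^+ j))).
  rewrite expR_sum; apply: ler_prod => j _; rewrite normr_ge0 /=.
  apply: le_trans (expR_ge1Dx _); rewrite -[f j](subrK 1) addrC.
  by apply: le_trans (ler_normD _ _) _; rewrite normr1 lerD2l.
by rewrite ler_expR -mulr_sumr ler_wpM2l // sum_geometric_le.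
Qed.

Lemma prod_geometric_cvg : cvgn (fun n => \prod_(0 <= j < n) f j).
Proof.
apply: (@cvg_geometric_increments _ (expR (C / (1 - q)) * C) _ q01) => n.
rewrite big_nat_recr //= -[X in _ - X]mulr1 -mulrBr normrM -mulrA.
by apply: ler_pM => //; exact: prod_geometric_le.
Qed.
Hypothesis f0 : forall n, 0 < f n.

(** From some rank on the factors are at least 1 - x >= exp(- 2 x) with x <= 1/2
decaying geometrically. *)
Lemma prod_geometric_gt0 : 0 < limn (fun n => \prod_(0 <= j < n) f j).
Proof.
have qn : `|q| < 1 by rewrite ger0_norm //; case/andP: q01.
have [n0 Hn0] : exists n0, forall n, (n0 <= n)%N -> C * q ^+ n <= 1 / 2.
  have := @cvg_geometric R C q qn => /cvgrPdist_le /(_ (1 / 2) _).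
  have h2 : 0 < 1 / 2 :> R by rewrite divr_gt0.
  move=> /(_ h2) [N _ HN]; exists N => n /HN /=; rewrite sub0r normrN ger0_norm //.
  by rewrite mulr_ge0 ?exprn_ge0.
set P := \prod_(0 <= j < n0) f j.
have P0 : 0 < P by apply: prodr_gt0.
apply: (@lt_le_trans _ _ (P * expR (- (2 * (C / (1 - q)))))).
  by rewrite mulr_gt0 // expR_gt0.
apply: limr_ge; first exact: prod_geometric_cvg.
exists n0 => // n /= n0n.
rewrite (@big_cat_nat _ _ _ n0) //= -/P ler_wpM2l ?(ltW P0) //.
apply: (@le_trans _ _ (expR (\sum_(n0 <= j < n) - (2 * (C * q ^+ j))))).
  rewrite ler_expR sumrN lerN2 -mulr_sumr -mulr_sumr.
  by rewrite ler_wpM2l // ler_wpM2l // sum_geometric_le.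
rewrite expR_sum !big_nat; apply: ler_prod => j /andP[jn _]; rewrite expR_ge0 /=.
have := fC j; have := Hn0 j jn; set x := C * q ^+ j => x2 xf.
have x0 : 0 <= x by rewrite mulr_ge0 ?exprn_ge0.
apply: (@le_trans _ _ (1 - x)); last first.
  by move: xf; rewrite ler_norml => /andP[]; lra.
rewrite expRN -[_^-1]mul1r ler_pdivrMr ?expR_gt0 //.
have := expR_ge1Dx (2 * x); move: (expR _) => e He.
have : (1 - x) * (1 + 2 * x) <= (1 - x) * e by rewrite ler_wpM2l //; lra.
by apply: le_trans; nra.
Qed.
End GeometricProducts.

(** * Single row factors and the Bernoulli polynomial *)

Section KernelBounds.
Variable R : realType.
Implicit Types x y : R.
Lemma kfac_dist1 x y : `|kfac x y - 1| <= expR (- (2 * pi * `|y|)).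
Proof.
rewrite /kfac -[X in _ - X](@cabs1 R); apply: le_trans (cabs_dist _ _) _.
by rewrite addrAC subrr sub0r cabsN cabs_nome.
Qed.

Lemma kfac_ge x y : 1 - expR (- (2 * pi * `|y|)) <= kfac x y.
Proof. by have := kfac_dist1 x y; rewrite ler_norml => /andP[]; lra. Qed.

Lemma kfac_ge0 x y : 0 <= kfac x y.
Proof. exact: cabs_ge0. Qed.

Lemma kfac_intz x y (m : int) : kfac (x + m%:~R) y = kfac x y.
Proof.
case: m => n; first by rewrite -pmulrn kfac_int.
by rewrite NegzE mulrNz -pmulrn kfac_intB.
Qed.

Lemma kfac_int0 (m : int) : kfac (m%:~R : R) 0 = 0.
Proof.
rewrite -[m%:~R]add0r kfac_intz /kfac normr0 nome0 subrr cabs0 //.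
Qed.

Definition frac (t : R) : R := t - (Num.floor t)%:~R.
Lemma frac_itv t : 0 <= frac t < 1.
Proof.
by rewrite /frac subr_ge0 floor_le_tmp ltrBlDr addrC; have := lt_succ_floor t; rewrite intrD.
Qed.

Lemma fracE t : t = frac t + (Num.floor t)%:~R.
Proof. by rewrite /frac subrK. Qed.

Lemma frac_int t (m : int) : frac (t + m%:~R) = frac t.
Proof.
rewrite /frac floorDrz ?intr_int // intrKfloor intrD; lra.
Qed.

Lemma frac_id t : 0 <= t < 1 -> frac t = t.
Proof.
by move=> t01; rewrite /frac (floor_def (m := 0)) ?subr0 // add0r.
Qed.

Lemma kfac_real_gt0 x : frac x != 0 -> 0 < kfac x 0.
Proof.
move=> x0; rewrite (fracE x) kfac_intz.
have /andP[f0 f1] := frac_itv x; have {}f0 : 0 < frac x by rewrite lt_def x0.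
have : 0 < sfac (frac x) 0 ^+ 2.
  rewrite sfac_real_sqr mulr_gt0 // exprn_gt0 // sin_gt0_pi //.
  by rewrite mulr_gt0 ?pi_gt0 //= gtr_pMr ?pi_gt0.
rewrite exprn_even_gt0 //= => s0; rewrite lt_def kfac_ge0 andbT.
by apply: contra s0 => /eqP H; rewrite /sfac H mulr0.
Qed.

(** Off the real axis the nome is less than 1 in modulus. *)
Lemma kfac_gt0 x y : y != 0 -> 0 < kfac x y.
Proof.
move=> y0; apply: lt_le_trans (kfac_ge _ _).
by rewrite subr_gt0 expR_lt1 oppr_lt0 !mulr_gt0 ?pi_gt0 // normr_gt0.
Qed.

Definition bern (t : R) : R := frac t ^+ 2 - frac t + 6^-1.
Lemma bern_int t (m : int) : bern (t + m%:~R) = bern t.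
Proof. by rewrite /bern frac_int. Qed.

(** The exponent, in units of pi h, of a product of sines over the rows |n| <= N, normalised by its
value at t = 0. *)
Definition height (t : R) (N : nat) : R :=
  \sum_(n <- zrange N) `|t + n%:~R| - \sum_(1 <= j < N.+1) 2 * j%:R.
Lemma height_succ t N : height (t + 1) N - height t N = `|t + N.+1%:R| - `|t - N%:R|.
Proof.
rewrite /height opprB addrA subrK; elim: N => [|N IH].
  by rewrite /= !big_seq1 !addr0 subr0.
rewrite !big_zrangeS /= !mulrNz -!pmulrn.
have -> : t + 1 - N.+1%:R = t - N%:R by rewrite -natr1; lra.
have -> : t + 1 + N.+1%:R = t + N.+2%:R by rewrite -[N.+2%:R]natr1; lra.
move: IH; lra.
Qed.

(** Moving t by 1 exchanges one row at each end, which changes the sum by 2 t + 1 as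
soon as the end rows lie on either side of t; so it suffices to compute on [0, 1),
where the sum collapses to the term n = 0. *)
Lemma height_eventually t : exists N0 : nat, forall N, (N0 <= N)%N ->
  height t N = t ^+ 2 - bern t + 6^-1.
Proof.
pose H t := exists N0 : nat, forall N, (N0 <= N)%N -> height t N = t ^+ 2 - bern t + 6^-1.
have near t' : exists N0 : nat, forall N, (N0 <= N)%N -> height (t' + 1) N - height t' N = 2 * t' + 1.
  exists (Num.bound `|t'|) => N HN; rewrite height_succ.
  have : `|t'| < N%:R.
    by apply: lt_le_trans (archi_boundP (normr_ge0 _)) _; rewrite ler_nat.
  rewrite ltr_norml => /andP[A B].
  rewrite -natr1 ger0_norm; last by lra.
  by rewrite ltr0_norm; lra.
have step t' : H (t' + 1) <-> H t'.
  have [N1 H1] := near t'; have b1 : bern (t' + 1) = bern t' by exact: (bern_int t' 1).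
  split=> -[N0 H0]; exists (maxn N0 N1) => N; rewrite geq_max => /andP[n0 n1].
    have := H1 N n1; have := H0 N n0; rewrite b1 sqrrD expr1n mulr1; lra.
  have := H1 N n1; have := H0 N n0; rewrite b1 sqrrD expr1n mulr1; lra.
have base t' : 0 <= t' < 1 -> H t'.
  move=> t01; exists 0%N => N _; rewrite /bern frac_id // /height big_zrange /= addr0.
  have -> : \sum_(1 <= j < N.+1) (`|t' + j%:~R| + `|t' + (- j%:Z)%:~R|) = \sum_(1 <= j < N.+1) 2 * j%:R.
    rewrite !big_nat; apply: eq_bigr => j /andP[j0 _]; rewrite mulrNz -!pmulrn.
    have j1 : 1 <= j%:R :> R by rewrite ler1n.
    case/andP: t01 => A B; rewrite ger0_norm; last by lra.
    by rewrite ltr0_norm; lra.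
  by rewrite addrK ger0_norm; [lra|case/andP: t01].
suff : forall m : int, H (frac t + m%:~R) by move=> /(_ (Num.floor t)); rewrite -fracE.
have fr := base _ (frac_itv t).
case=> n; elim: n => [|n IH].
- by rewrite addr0.
- by move/step: IH; rewrite -addrA; congr H; congr (_ + _); rewrite -!pmulrn natr1.
- by apply/step; rewrite NegzE mulrNz -addrA addNr addr0.
- apply/step; move: IH.
  have -> // : frac t + (Negz n.+1)%:~R + 1 = frac t + (Negz n)%:~R.
  by rewrite !NegzE !mulrNz -!pmulrn -[n.+2%:R]natr1; lra.
Qed.
End KernelBounds.

(** * The theta product and its periods *)

Section Theta.
Variables (R : realType) (r h' : R).
Hypothesis h0 : h' != 0.
Definition row_factor (s t : R) (n : int) : R := kfac (s + (t + n%:~R) * r) ((t + n%:~R) * h').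
Definition habs : R := `|h'|.
Definition qabs : R := expR (- (2 * pi * habs)).
Lemma habs_gt0 : 0 < habs.
Proof. by rewrite normr_gt0. Qed.

Lemma pihabs_gt0 : 0 < 2 * pi * habs.
Proof. by rewrite !mulr_gt0 ?pi_gt0 ?habs_gt0. Qed.

Lemma qabs_itv : 0 <= qabs < 1.
Proof. by rewrite expR_ge0 expR_lt1 oppr_lt0 pihabs_gt0. Qed.

Definition row_decay (t : R) (n : int) : R := expR (- (2 * pi * habs * `|t + n%:~R|)).
Lemma row_factor_dist1 s t n : `|row_factor s t n - 1| <= row_decay t n.
Proof.
apply: le_trans (kfac_dist1 _ _) _; rewrite /row_decay normrM /habs.
by rewrite le_eqVlt; apply/orP; left; apply/eqP; congr expR; ring.
Qed.

Lemma row_factor_le s t n : row_factor s t n <= 1 + row_decay t n.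
Proof. by have := row_factor_dist1 s t n; rewrite ler_norml => /andP[_]; lra. Qed.

Lemma row_factor_ge s t n : 1 - row_decay t n <= row_factor s t n.
Proof. by have := row_factor_dist1 s t n; rewrite ler_norml => /andP[]; lra. Qed.

Lemma row_factor_ge0 s t n : 0 <= row_factor s t n.
Proof. exact: kfac_ge0. Qed.

Lemma row_decay_le t n : row_decay t n <= expR (2 * pi * habs * `|t|) * qabs ^+ `|n|.
Proof.
rewrite /row_decay /qabs -expRM_natl -expRD ler_expR.
have -> : 2 * pi * habs * `|t| + `|n|%:R * - (2 * pi * habs) = - (2 * pi * habs * (`|n|%:R - `|t|)) by ring.
rewrite lerN2 ler_wpM2l ?(ltW pihabs_gt0) //.
have -> : `|n|%:R = `|(n%:~R : R)|.
  by rewrite -intr_norm -abszE pmulrn.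
by have := ler_normB (t + n%:~R) t; rewrite addrAC subrr add0r lerBlDr.
Qed.

(** Partial products of theta for the modulus r + i h'. *)
Definition theta_n (s t : R) (N : nat) : R := \prod_(n <- zrange N) row_factor s t n.

(** The factors for n and - n together, so that the symmetric product is an ordinary
product with geometrically small deviations. *)
Definition theta_pair (s t : R) (n : nat) : R :=
  if n is m.+1 then row_factor s t m.+1%:Z * row_factor s t (- m.+1%:Z) else row_factor s t 0.
Lemma theta_nE s t N : theta_n s t N = \prod_(0 <= j < N.+1) theta_pair s t j.
Proof.
rewrite /theta_n; elim: N => [|N IH]; first by rewrite /= big_seq1 big_nat1.
by rewrite big_zrangeS IH [in RHS]big_nat_recr.
Qed.

Definition pair_const (t : R) : R := let D := expR (2 * pi * habs * `|t|) in D * (2 + D).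
Lemma pair_const_ge0 t : 0 <= pair_const t.
Proof. by rewrite mulr_ge0 ?addr_ge0 ?expR_ge0. Qed.

Lemma theta_pair_dist1 s t n : `|theta_pair s t n - 1| <= pair_const t * qabs ^+ n.
Proof.
rewrite /pair_const; set D := expR _.
have D0 : 0 < D by exact: expR_gt0.
have /andP[q0 q1] := qabs_itv.
have qn0 k : 0 <= qabs ^+ k by exact: exprn_ge0.
have qn1 k : qabs ^+ k <= 1 by apply: exprn_ile1 => //; exact: ltW.
case: n => [|n].
  rewrite expr0 mulr1; apply: le_trans (row_factor_dist1 _ _ _) _.
  apply: le_trans (row_decay_le _ _) _; rewrite absz0 expr0 mulr1 -/D.
  by rewrite ler_peMr ?(ltW D0) //; lra.
have H1 := le_trans (row_factor_dist1 s t n.+1%:Z) (row_decay_le t n.+1%:Z).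
have H2 := le_trans (row_factor_dist1 s t (- n.+1%:Z)) (row_decay_le t (- n.+1%:Z)).
rewrite abszN in H2; rewrite !absz_nat -/D in H1 H2.
rewrite /theta_pair; move: (row_factor s t n.+1) (row_factor s t (- n.+1%:Z)) H1 H2 => a c H1 H2.
have -> : a * c - 1 = (a - 1) * (c - 1) + (a - 1) + (c - 1) by ring.
apply: le_trans (ler_normD _ _) _; apply: le_trans (lerD (ler_normD _ _) H2) _.
rewrite normrM.
apply: (@le_trans _ _ (D * qabs ^+ n.+1 * D + D * qabs ^+ n.+1 + D * qabs ^+ n.+1)).
  rewrite lerD2r lerD // ler_pM //; apply: le_trans H2 _.
  by rewrite ler_piMr ?(ltW D0).
by rewrite le_eqVlt; apply/orP; left; apply/eqP; ring.
Qed.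

Definition theta (s t : R) : R := limn (theta_n s t).
Lemma theta_pair_cvg s t (l : R) : (fun n => \prod_(0 <= j < n) theta_pair s t j) @ \oo --> l ->
  theta_n s t @ \oo --> l.
Proof.
rewrite (_ : theta_n s t = (fun N => \prod_(0 <= j < N.+1) theta_pair s t j)).
  by move=> H; have := H; rewrite -(cvg_shiftS (fun n => \prod_(0 <= j < n) theta_pair s t j)).
by apply/funext => N; rewrite theta_nE.
Qed.

Lemma theta_cvg s t : theta_n s t @ \oo --> theta s t.
Proof.
have c := prod_geometric_cvg (pair_const_ge0 t) qabs_itv (theta_pair_dist1 s t).
have /cvg_ex[l /theta_pair_cvg Hl] := c.
by rewrite /theta (cvg_lim _ Hl).
Qed.

Lemma theta_n_ge0 s t N : 0 <= theta_n s t N.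
Proof. by apply: prodr_ge0 => n _; exact: row_factor_ge0. Qed.

Lemma theta_ge0 s t : 0 <= theta s t.
Proof.
apply: limr_ge; first by apply/cvg_ex; exists (theta s t); exact: theta_cvg.
by apply: nearW => N; exact: theta_n_ge0.
Qed.

Lemma theta_le_expR s t C : (forall N, \sum_(n <- zrange N) row_decay t n <= C) -> theta s t <= expR C.
Proof.
move=> H; have c := @theta_cvg s t.
rewrite -(cvg_lim _ c) //; apply: limr_le; first by apply/cvg_ex; eexists; exact: c.
near=> N; apply: (@le_trans _ _ (\prod_(n <- zrange N) expR (row_decay t n))).
  apply: ler_prod => n _; rewrite row_factor_ge0 /=; apply: le_trans (row_factor_le _ _ _) _.
  exact: expR_ge1Dx.
by rewrite -expR_sum ler_expR.
Unshelve. all: by end_near.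
Qed.

Lemma theta_gt0 s t : (frac t != 0) || (frac s != 0) -> 0 < theta s t.
Proof.
move=> st.
have kp n : 0 < row_factor s t n.
  have [tn|tn] := eqVneq (t + n%:~R) 0; last by rewrite kfac_gt0 // mulf_neq0.
  rewrite /row_factor tn !mul0r addr0 kfac_real_gt0 //.
  case/orP: st => //; rewrite (_ : t = 0 + (- n)%:~R).
    by rewrite frac_int frac_id ?eqxx // lexx ltr01.
  by rewrite mulrNz add0r; apply/eqP; rewrite -addr_eq0 tn.
have pp n : 0 < theta_pair s t n by case: n => [|n]; rewrite /= ?mulr_gt0.
have := prod_geometric_gt0 (pair_const_ge0 t) qabs_itv (theta_pair_dist1 s t) pp.
have c := prod_geometric_cvg (pair_const_ge0 t) qabs_itv (theta_pair_dist1 s t).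
have /cvg_ex[l Hl] := c.
by rewrite (cvg_lim _ Hl) // /theta (cvg_lim _ (theta_pair_cvg Hl)).
Qed.

Lemma theta_int0 s t : frac s = 0 -> frac t = 0 -> theta s t = 0.
Proof.
move=> s0 t0.
have E : forall N, (`|Num.floor t| <= N)%N -> theta_n s t N = 0.
  move=> N HN; rewrite /theta_n (big_rem (- Num.floor t)) /=; last by rewrite mem_zrange abszN.
  have tE : t = (Num.floor t)%:~R by rewrite {1}(fracE t) t0 add0r.
  have t00 : t + (- Num.floor t)%:~R = 0 by rewrite mulrNz {1}tE subrr.
  rewrite /row_factor t00 !mul0r addr0 (fracE s) s0 add0r.
  by rewrite kfac_int0 mul0r.
apply: (@cvg_lim R^o) => //.
apply: cvg_near_cst; exists `|Num.floor t|%N => // N /= HN; exact: E.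
Qed.

Lemma theta_periods s t (m : int) : theta (s + m%:~R) t = theta s t.
Proof.
congr (limn _); apply/funext => N; apply: eq_bigr => n _.
by rewrite /row_factor addrAC kfac_intz.
Qed.

(** Translation by 1 shifts the window of rows by one. *)
Lemma theta_n_succ s t N : theta_n s (t + 1) N * row_factor s t (- N%:Z) = theta_n s t N * row_factor s t (N.+1%:Z).
Proof.
have E n : row_factor s (t + 1) n = row_factor s t (n + 1).
  by rewrite /row_factor intrD -[t + 1 + _]addrA [1 + _]addrC.
elim: N => [|N IH]; first by rewrite /theta_n /= !big_seq1 E add0r oppr0 mulrC.
rewrite /theta_n !big_zrangeS -!/(theta_n _ _ _) !E.
have -> : - N.+1%:Z + 1 = - N%:Z by lia.
have -> : N.+1%:Z + 1 = N.+2%:Z by lia.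
move: IH; move: (theta_n _ _ _) (theta_n _ _ _) => A B IH.
rewrite /=; transitivity ((B * row_factor s t (- N%:Z)) * (row_factor s t N.+2%:Z * row_factor s t (- N.+1%:Z))); first ring.
rewrite IH; ring.
Qed.

Lemma row_factor_cvg1 s t (sg : bool) : (fun N : nat => row_factor s t (if sg then - N%:Z else N.+1%:Z)) @ \oo --> (1 : R).
Proof.
have /andP[q0 q1] := qabs_itv.
have g : (fun N : nat => expR (2 * pi * habs * `|t|) * qabs ^+ N) @ \oo --> 0.
  by apply: cvg_geometric; rewrite ger0_norm.
apply/cvgrPdist_le => e e0; move/cvgrPdist_le : g => /(_ e e0) [N0 _ HN].
exists N0 => // N /= N0N; rewrite distrC; apply: le_trans (row_factor_dist1 _ _ _) _.
apply: le_trans (row_decay_le _ _) _; have := HN N N0N; rewrite /= sub0r normrN ger0_norm; last first.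
  by rewrite mulr_ge0 ?expR_ge0 ?exprn_ge0.
apply: le_trans; rewrite ler_wpM2l ?expR_ge0 //.
case: sg; first by rewrite abszN absz_nat.
by rewrite absz_nat exprS ler_piMl ?exprn_ge0 // ltW.
Qed.

Lemma theta_periodt1 s t : theta s (t + 1) = theta s t.
Proof.
have A : (fun N => theta_n s (t + 1) N * row_factor s t (- N%:Z)) @ \oo --> theta s (t + 1) * 1.
  by apply: cvgM; [exact: theta_cvg | exact: (row_factor_cvg1 s t true)].
have B : (fun N => theta_n s (t + 1) N * row_factor s t (- N%:Z)) @ \oo --> theta s t * 1.
  under eq_fun do rewrite theta_n_succ.
  by apply: cvgM; [exact: theta_cvg | exact: (row_factor_cvg1 s t false)].
by have := cvg_unique _ A B; rewrite !mulr1; apply.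
Qed.

Lemma theta_periodt s t (m : int) : theta s (t + m%:~R) = theta s t.
Proof.
case: m => n; elim: n => [|n IH].
- by rewrite addr0.
- have -> : t + n.+1%:~R = t + n%:~R + 1 by rewrite -addrA -!pmulrn natr1.
  by rewrite theta_periodt1.
- by rewrite -[in LHS]theta_periodt1 NegzE mulrNz subrK.
- rewrite -[RHS]IH -[LHS]theta_periodt1; congr (theta _ _).
  by rewrite !NegzE !mulrNz -!pmulrn -[n.+2%:R]natr1; lra.
Qed.

(** The Bernoulli factor accounts for the exponentials by which [kfac] and [sfac]
differ in the rows. It has the periods of theta, and the mean of its logarithm is
zero. *)
Definition psi (s t : R) : R := expR (- (pi * habs * bern t)) * theta s t.
Lemma psi_ge0 s t : 0 <= psi s t.
Proof. by rewrite mulr_ge0 ?expR_ge0 ?theta_ge0. Qed.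

Lemma psi_period s t (m n : int) : psi (s + m%:~R) (t + n%:~R) = psi s t.
Proof. by rewrite /psi theta_periods theta_periodt bern_int. Qed.

Lemma psi_gt0 s t : (frac t != 0) || (frac s != 0) -> 0 < psi s t.
Proof. by move=> st; rewrite mulr_gt0 ?expR_gt0 ?theta_gt0. Qed.

Lemma psi_int0 s t : frac s = 0 -> frac t = 0 -> psi s t = 0.
Proof. by move=> s0 t0; rewrite /psi theta_int0 // mulr0. Qed.

Definition nome_pair (n : nat) : R := if n is m.+1 then row_factor 0 0 m.+1%:Z ^+ 2 else 1.
Definition nome_n (N : nat) : R := \prod_(1 <= j < N.+1) row_factor 0 0 j%:Z ^+ 2.
Lemma nome_nE N : nome_n N = \prod_(0 <= j < N.+1) nome_pair j.
Proof.
rewrite /nome_n [RHS]big_ltn // mul1r !big_nat; apply: eq_bigr => j /andP[j0 _].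
by case: j j0.
Qed.

Lemma nome_pair_dist1 n : `|nome_pair n - 1| <= pair_const 0 * qabs ^+ n.
Proof.
case: n => [|n]; first by rewrite subrr normr0 mulr_ge0 ?pair_const_ge0.
have := theta_pair_dist1 0 0 n.+1; rewrite /theta_pair.
have -> // : row_factor 0 0 (- n.+1%:Z) = row_factor 0 0 n.+1%:Z.
by rewrite /row_factor mulrNz !add0r !mulNr kfacN.
Qed.

(** The product of |1 - q^n|^2 over n >= 1, with q = e(r + i |h'|). *)
Definition nome_lim : R := limn nome_n.
Lemma nome_cvg : nome_n @ \oo --> nome_lim /\ 0 < nome_lim.
Proof.
have pp n : 0 < nome_pair n.
  case: n => [|n] //=; rewrite exprn_gt0 // kfac_gt0 // add0r mulf_neq0 //.
  by rewrite intr_eq0.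
have c := prod_geometric_cvg (pair_const_ge0 0) qabs_itv nome_pair_dist1.
have := prod_geometric_gt0 (pair_const_ge0 0) qabs_itv nome_pair_dist1 pp.
have /cvg_ex[l Hl] := c.
rewrite (cvg_lim _ Hl) // => l0.
have H : nome_n @ \oo --> l.
  rewrite (_ : nome_n = (fun N => \prod_(0 <= j < N.+1) nome_pair j)).
    by have := Hl; rewrite -(cvg_shiftS (fun n => \prod_(0 <= j < n) nome_pair j)).
  by apply/funext => N; rewrite nome_nE.
by rewrite /nome_lim (cvg_lim _ H).
Qed.
End Theta.

(** * The modulus of sigma in terms of theta *)

Section SigmaFormula.
Variables (R : realType) (L : set R[i]) (b : R[i] * R[i]).
Hypothesis Lb : lattice_basis L b.
Let indep := Lb.1.
Let r := tau_re b.
Let h' := tau_im b.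
Let h0 : h' != 0. Proof. exact: tau_im_neq0 indep. Qed.
Let h := habs h'.
Lemma prod_sfac_zrange s t N :
  \prod_(n <- zrange N) sfac (rx b s t n) (ry b t n) =
  expR (pi * h * \sum_(n <- zrange N) `|t + n%:~R|) * theta_n r h' s t N.
Proof.
rewrite big_split /= mulr_sumr expR_sum; congr (_ * _); apply: eq_bigr => n _.
by rewrite /ry normrM /h /habs; congr expR; rewrite /h'; ring.
Qed.

Lemma plain_rowsE s t N : plain_rows b s t N =
  cabs b.1 / (2 * pi) * expR (pi * h * height t N) * theta_n r h' s t N / nome_n r h' N.
Proof.
rewrite /plain_rows prod_sfac_zrange /height.
have -> : \prod_(1 <= j < N.+1) sfac (rx b 0 0 j%:Z) (ry b 0 j%:Z) ^+ 2 =
  expR (pi * h * (\sum_(1 <= j < N.+1) 2 * j%:R)) * nome_n r h' N.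
  rewrite mulr_sumr expR_sum -big_split /= !big_nat; apply: eq_bigr => j /andP[j0 _].
  rewrite /sfac exprMn -expRM_natl; congr (expR _ * _).
  by rewrite /ry add0r normrM -pmulrn ger0_norm // /h /habs /h'; ring.
set c := cabs b.1 / _; rewrite [pi * h * (_ - _)]mulrBr expRB invfM.
by set A := expR _; set B := (expR _)^-1; move: (theta_n _ _ _ _ _) (nome_n _ _ _)^-1 => T G; ring.
Qed.

(** The modulus of the derivative of sigma at 0 is 1; this constant normalises psi
accordingly. *)
Definition scale_const : R := cabs b.1 / (2 * pi) * expR (pi * h / 6) / nome_lim r h'.
Lemma scale_const_gt0 : 0 < scale_const.
Proof.
have [_ n0] := nome_cvg r h0.
rewrite divr_gt0 // mulr_gt0 ?expR_gt0 // divr_gt0 ?mulr_gt0 ?pi_gt0 //.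
by rewrite lt_def cabs_ge0 cabs_eq0 (b1_neq0 indep).
Qed.

(** The value of the conditionally convergent product of z (1 - z / w) over rows, in
modulus. *)
Definition plain_lim (s t : R) : R := scale_const * expR (pi * h * t ^+ 2) * psi r h' s t.
Lemma plain_rows_cvg s t : plain_rows b s t @ \oo --> plain_lim s t.
Proof.
have [nc n0] := nome_cvg r h0.
have -> : plain_lim s t = cabs b.1 / (2 * pi) * expR (pi * h * (t ^+ 2 - bern t + 6^-1)) *
    theta r h' s t / nome_lim r h'.
  rewrite /plain_lim /scale_const /psi -/h.
  have -> : pi * h * (t ^+ 2 - bern t + 6^-1) = pi * h / 6 + (pi * h * t ^+ 2 + - (pi * h * bern t)) by ring.
  rewrite !expRD; set A := expR _; set B := expR (_ * _ ^+ 2); set D := expR (- _); ring.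
have -> : plain_rows b s t = (fun N => cabs b.1 / (2 * pi) * expR (pi * h * height t N) * theta_n r h' s t N / nome_n r h' N).
  by apply/funext => N; exact: plain_rowsE.
apply: cvgM; last by apply: cvgV => //; rewrite gt_eqF.
apply: cvgM; last exact: theta_cvg.
apply: cvgMr; apply: cvg_near_cst.
have [N0 HN] := height_eventually t.
by exists N0 => // N /= HN'; rewrite HN.
Qed.

Lemma plain_lim_gt0 s t : ~ L (pt b s t) -> 0 < plain_lim s t.
Proof.
move=> zL; rewrite mulr_gt0 //; first by rewrite mulr_gt0 ?scale_const_gt0 ?expR_gt0.
apply: psi_gt0 => //; apply: contrapT => /negP; rewrite negb_or !negbK => /andP[/eqP t0 /eqP s0].
apply: zL; apply/(lattice_mem Lb); exists (Num.floor s), (Num.floor t).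
by rewrite /lpt {1}(fracE s) {1}(fracE t) s0 t0 !add0r.
Qed.

(** The modulus of the Weierstrass product over a box is that of the plain product
times exp(Re(z^2 u)), where u depends on the box only. The finite list of points
shares one sequence of boxes, hence one sequence u. *)
Lemma sigma_common_exponent (ps : seq (R * R)) :
  (forall p, p \in ps -> ~ L (pt b p.1 p.2)) ->
  exists u : nat -> R[i], forall p, p \in ps ->
    (fun N => expR (complex.Re (pt b p.1 p.2 ^+ 2 * u N))) @ \oo -->
      cabs (sigma L (pt b p.1 p.2)) / plain_lim p.1 p.2.
Proof.
move=> Hps.
(* points with vanishing row product are skipped: near the limit there are none *)
have sel N : exists M : nat, (N <= M)%N /\ forall p, p \in ps -> 0 < plain_rows b p.1 p.2 N ->
   `|plain_box b (pt b p.1 p.2) M N - plain_rows b p.1 p.2 N| <= plain_rows b p.1 p.2 N / N.+1%:R.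
  elim: ps {Hps} => [|p ps [M [NM HM]]]; first by exists N.
  suff : \forall M' \near \oo, (N <= M')%N /\ forall p', p' \in (p :: ps) -> 0 < plain_rows b p'.1 p'.2 N ->
   `|plain_box b (pt b p'.1 p'.2) M' N - plain_rows b p'.1 p'.2 N| <= plain_rows b p'.1 p'.2 N / N.+1%:R.
    by move=> [M0 _ HM0]; exists M0; apply: HM0 => /=.
  elim: (p :: ps) => [|p' ps' IH]; first by exists N => // M' /= ->.
  have c : (fun M => plain_box b (pt b p'.1 p'.2) M N) @ \oo --> plain_rows b p'.1 p'.2 N.
    exact: plain_box_cvg.
  have [pp|pp] := ltP 0 (plain_rows b p'.1 p'.2 N); last first.
    apply: filterS IH => M' [NM' H]; split => // p''.
    by rewrite inE => /orP[/eqP ->|]; [rewrite ltNge pp | exact: H].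
  have e0 : 0 < plain_rows b p'.1 p'.2 N / N.+1%:R by rewrite divr_gt0.
  move/cvgrPdist_le : c => /(_ _ e0) c.
  apply: filterS2 IH c => M' [NM' H] c; split => // p''.
  by rewrite inE => /orP[/eqP -> _|]; [rewrite distrC | exact: H].
(* the rows of length phi N are complete up to a relative error 1/(N + 1) *)
have [phi Hphi] := choice sel.
exists (fun N => box_square b (phi N) N) => p pps.
have pL := Hps p pps; have P0 := plain_lim_gt0 pL.
set z := pt b p.1 p.2.
pose X := fun N => plain_box b z (phi N) N * expR (complex.Re (z ^+ 2 * box_square b (phi N) N)).
pose Y := fun N => plain_box b z (phi N) N.
have Xc : X @ \oo --> cabs (sigma L z).
  apply/cvgrPdist_le => e e0; have [K HK] := sigma_box Lb z e0.
  exists K => // N /= KN; rewrite distrC /X -box_modulus.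
  apply: le_trans (cabs_dist _ _) _; apply: HK => //.
  by apply: leq_trans KN _; case: (Hphi N).
have Yc : Y @ \oo --> plain_lim p.1 p.2.
  have rc : plain_rows b p.1 p.2 @ \oo --> plain_lim p.1 p.2 by exact: plain_rows_cvg.
  have -> : Y = (fun N => plain_rows b p.1 p.2 N + (Y N - plain_rows b p.1 p.2 N)).
    by apply/funext => N; rewrite addrC subrK.
  rewrite -[X in _ --> X]addr0; apply: cvgD => //.
  apply: (@cvg_le_harmonic _ _ _ (plain_lim p.1 p.2 + 1)).
  have Pl : plain_lim p.1 p.2 < plain_lim p.1 p.2 + 1 by rewrite ltrDl.
  have H1 : \forall N \near \oo, plain_rows b p.1 p.2 N <= plain_lim p.1 p.2 + 1.
    by move/cvgr_le : rc; apply.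
  have H2 : \forall N \near \oo, 0 < plain_rows b p.1 p.2 N by move/cvgr_gt : rc; apply.
  apply: filterS2 H1 H2 => N H1 H2; rewrite subr0.
  have [_ H] := Hphi N; apply: le_trans (H p pps H2) _.
  by rewrite ler_wpM2r ?invr_ge0.
have XY : \forall N \near \oo, X N / Y N = expR (complex.Re (z ^+ 2 * box_square b (phi N) N)).
  have : \forall N \near \oo, 0 < Y N by move/cvgr_gt : Yc; apply.
  apply: filterS => N YN; rewrite /X -/(Y N) mulrAC mulfV ?mul1r //.
  by rewrite gt_eqF.
have : (fun N => X N / Y N) @ \oo --> cabs (sigma L z) / plain_lim p.1 p.2.
  by apply: cvgM => //; apply: cvgV => //; rewrite gt_eqF.
by apply: cvg_trans; apply: near_eq_cvg; apply: filterS XY.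
Qed.

(** Supplies points where sigma does not vanish. *)
Lemma small_not_lattice (z : R[i]) : z != 0 -> cabs z < basis_gap b -> ~ L z.
Proof. by move=> z0 zb zL; have := lattice_norm_ge Lb zL z0; rewrite leNgt zb. Qed.

(** Each large box contains the factor that vanishes at the point. *)
Lemma sigma_zero s t : L (pt b s t) -> cabs (sigma L (pt b s t)) = 0 /\ psi r h' s t = 0.
Proof.
move=> /(lattice_mem Lb)[m [n E]]; have [-> ->] := pt_inj indep E; split; last first.
  by apply: psi_int0; rewrite -[X in frac X]add0r frac_int frac_id // lexx ltr01.
rewrite -/(lpt b m n).
have [z0|z0] := eqVneq (lpt b m n) 0.
  by rewrite z0 /sigma mul0r cabs0.
apply/eqP; rewrite eq_le cabs_ge0 andbT; apply/ler_addgt0Pl => e e0; rewrite addr0.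
have [K HK] := sigma_box Lb (lpt b m n) e0.
pose M := maxn K (maxn `|m| `|n|).
have := HK M M (leq_maxl _ _) (leq_maxl _ _).
rewrite (big_rem (lpt b m n)) /=; last by rewrite mem_box // !leq_max !leqnn !orbT.
by rewrite z0 /weierstrass_factor mulfV // subrr !mul0r mulr0 sub0r cabsN.
Qed.

(** At four points of the small circles, namely e, i e, (1 + i) e and its product
with i, the limits of exp(Re(z^2 u_N)) occur in pairs with opposite exponents, so
they are positive and Re u_N and Im u_N converge. The limit of u_N is the same
for every further point. *)
Lemma sigma_formula : exists al : R[i], forall s t : R,
  cabs (sigma L (pt b s t)) =
  expR (complex.Re (pt b s t ^+ 2 * al)) * plain_lim s t.
Proof.
have g0 := basis_gap_gt0 indep.
pose e : R := basis_gap b / 3.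
have e0 : 0 < e by rewrite divr_gt0.
have [a1 [c1 E1]] := pt_surj indep (e%:C).
have [a2 [c2 E2]] := pt_surj indep (e%:C * 'i).
have [a3 [c3 E3]] := pt_surj indep (e%:C * (1 + 'i)).
have [a4 [c4 E4]] := pt_surj indep (e%:C * (1 + 'i) * 'i).
have ci : cabs ('i : R[i]) = 1 by rewrite /cabs normc_def /= expr0n expr1n add0r sqrtr1.
have c1i : cabs (1 + 'i : R[i]) <= 2.
  by apply: le_trans (cabsD _ _) _; rewrite cabs1 ci.
have i0 : 'i != 0 :> R[i] by rewrite -cabs_eq0 ci oner_eq0.
have ii0 : 1 + 'i != 0 :> R[i] by rewrite eq_complex /= negb_and !addr0 oner_eq0.
have eC0 : e%:C != 0 :> R[i] by rewrite -cabs_eq0 cabs_real normr_eq0 gt_eqF.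
have ce : cabs (e%:C : R[i]) = e by rewrite cabs_real ger0_norm // ltW.
have e3 : e < basis_gap b by rewrite /e ltr_pdivrMr // ltr_pMr // ltr1n.
have e32 : e * cabs (1 + 'i : R[i]) < basis_gap b.
  apply: (@le_lt_trans _ _ (e * 2)); first by rewrite ler_wpM2l // ltW.
  by rewrite /e; lra.
have N1 : ~ L (pt b a1 c1) by rewrite -E1; apply: small_not_lattice; rewrite ?ce.
have N2 : ~ L (pt b a2 c2).
  by rewrite -E2; apply: small_not_lattice; rewrite ?mulf_neq0 // cabsM ce ci mulr1.
have N3 : ~ L (pt b a3 c3).
  by rewrite -E3; apply: small_not_lattice; rewrite ?mulf_neq0 // cabsM ce.
have N4 : ~ L (pt b a4 c4).
  by rewrite -E4; apply: small_not_lattice; rewrite ?mulf_neq0 // !cabsM ci mulr1 ce.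
pose ratio (p : R * R) := cabs (sigma L (pt b p.1 p.2)) / plain_lim p.1 p.2.
(* read off from Re(e^2 u) = e^2 Re u and Re(((1 + i) e)^2 u) = - 2 e^2 Im u *)
pose al : R[i] := (ln (ratio (a1, c1)) / e ^+ 2) +i* (- (ln (ratio (a3, c3)) / (2 * e ^+ 2))).
exists al => s t.
have [zL|zL] := pselect (L (pt b s t)).
  by have [-> p0] := sigma_zero zL; rewrite /plain_lim p0 !mulr0.
pose ps := [:: (s, t); (a1, c1); (a2, c2); (a3, c3); (a4, c4)].
have [p|u Hu] := @sigma_common_exponent ps.
  by rewrite !inE => /orP[/eqP ->|/orP[/eqP ->|/orP[/eqP ->|/orP[/eqP ->|/eqP ->]]]].
have U0 := Hu (s, t) (mem_head _ _).
have m1 : (a1, c1) \in ps by rewrite !inE eqxx ?orbT.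
have U1 := Hu _ m1; rewrite -/(ratio (a1, c1)) /= -E1 in U1.
have m2 : (a2, c2) \in ps by rewrite !inE eqxx ?orbT.
have U2 := Hu _ m2; rewrite -/(ratio (a2, c2)) /= -E2 in U2.
have m3 : (a3, c3) \in ps by rewrite !inE eqxx ?orbT.
have U3 := Hu _ m3; rewrite -/(ratio (a3, c3)) /= -E3 in U3.
have m4 : (a4, c4) \in ps by rewrite !inE eqxx ?orbT.
have U4 := Hu _ m4; rewrite -/(ratio (a4, c4)) /= -E4 in U4.
rewrite /= in U0.
have rg0 p : ~ L (pt b p.1 p.2) -> 0 <= ratio p.
  by move=> pL; rewrite divr_ge0 ?cabs_ge0 // ltW // plain_lim_gt0.
(* the two sequences have product 1, so neither limit is zero *)
have pos (z w : R[i]) (p q : R * R) : z ^+ 2 = - w ^+ 2 -> ~ L (pt b p.1 p.2) ->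
   (fun N => expR (complex.Re (z ^+ 2 * u N))) @ \oo --> ratio p ->
   (fun N => expR (complex.Re (w ^+ 2 * u N))) @ \oo --> ratio q -> 0 < ratio p.
  move=> zw pL A B; rewrite lt_def rg0 // andbT; apply/eqP => p0.
  have AB : (fun N => expR (complex.Re (z ^+ 2 * u N)) * expR (complex.Re (w ^+ 2 * u N))) @ \oo --> (0 : R).
    by rewrite -(mul0r (ratio q)) -p0; apply: cvgM.
  have E : (fun N => expR (complex.Re (z ^+ 2 * u N)) * expR (complex.Re (w ^+ 2 * u N))) = (fun=> 1).
    by apply/funext => N; rewrite -expRD zw mulNr (raddfN (@complex.Re R)) /= addNr expR0.
  rewrite E in AB; have c1' : (fun=> 1 : R) @ \oo --> (1 : R) by exact: cvg_cst.
  have : 1 = 0 :> R by apply: (cvg_unique _ c1' AB).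
  by move/eqP; rewrite oner_eq0.
have i2 : ('i : R[i]) ^+ 2 = -1 := sqr_i R.
have P1 : 0 < ratio (a1, c1) by apply: pos U1 U2 => //; rewrite exprMn i2 mulrN1 opprK.
have P3 : 0 < ratio (a3, c3) by apply: pos U3 U4 => //; rewrite [in RHS]exprMn i2 mulrN1 opprK.
have ln_cvg (f : nat -> R) (l : R) : 0 < l -> (fun N => expR (f N)) @ \oo --> l -> f @ \oo --> ln l.
  move=> l0 H; rewrite (_ : f = @ln R \o (fun N => expR (f N))); last by apply/funext => N /=; rewrite expRK.
  by apply: continuous_cvg => //; exact: continuous_ln.
have V1 := ln_cvg _ _ P1 U1; have V3 := ln_cvg _ _ P3 U3.
have W1 : (fun N => complex.Re (u N)) @ \oo --> complex.Re al.
  rewrite (_ : (fun N => complex.Re (u N)) = (fun N => complex.Re (e%:C ^+ 2 * u N) / e ^+ 2)).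
    by exact: (cvgM V1 (cvg_cst _)).
  apply/funext => N; rewrite -rmorphXn /=; case: (u N) => x y /=.
  by rewrite mul0r subr0 mulrAC mulfV ?mul1r // expf_neq0 // gt_eqF.
have W3 : (fun N => complex.Im (u N)) @ \oo --> complex.Im al.
  rewrite (_ : (fun N => complex.Im (u N)) = (fun N => - (complex.Re ((e%:C * (1 + 'i)) ^+ 2 * u N) / (2 * e ^+ 2)))).
    by apply: cvgN; exact: (cvgM V3 (cvg_cst _)).
  apply/funext => N.
  have -> : (e%:C * (1 + 'i)) ^+ 2 = (2 * e ^+ 2)%:C * 'i :> R[i].
    by apply/eqP; rewrite eq_complex /=; apply/andP; split; apply/eqP; ring.
  case: (u N) => x y.
  have -> : complex.Re ((2 * e ^+ 2)%:C * 'i * (x +i* y)) = - (2 * e ^+ 2 * y) by rewrite /=; ring.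
  by rewrite mulNr opprK mulrAC mulfV ?mul1r // mulf_neq0 // expf_neq0 // gt_eqF.
have V0 : (fun N => expR (complex.Re (pt b s t ^+ 2 * u N))) @ \oo --> expR (complex.Re (pt b s t ^+ 2 * al)).
  apply: continuous_cvg; first exact: continuous_expR.
  have ReM (z w : R[i]) : complex.Re (z * w) =
     complex.Re z * complex.Re w - complex.Im z * complex.Im w by case: z w => [? ?] [? ?].
  rewrite ReM; under eq_fun do rewrite ReM.
  by apply: cvgB; apply: cvgMr.
have := cvg_unique _ U0 V0; move=> /(_ _) <- //.
by rewrite divfK // gt_eqF // plain_lim_gt0.
Qed.
End SigmaFormula.

(** * The modified sigma function *)

Section SigmaStar.
Variables (R : realType) (L : set R[i]).
Let b := basis_of_lattice L.
Hypothesis isL : is_lattice L.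
Lemma basis_of_latticeP : lattice_basis L b.
Proof. by have [b0 Hb0] := isL; exact: (xgetPex (0, 0) (ex_intro _ b0 Hb0)). Qed.
Let Lb := basis_of_latticeP.
Let indep := Lb.1.
Let r := tau_re b.
Let h' := tau_im b.
Let h := habs h'.
Let h0 : h' != 0. Proof. exact: tau_im_neq0 indep. Qed.
Lemma basis_detE : `|basis_det b| = h * cabs b.1 ^+ 2.
Proof.
have E : b.2 = b.1 * (tau_re b +i* tau_im b).
  by rewrite /tau_re /tau_im mulrC; case E : (b.2 / b.1) => [x y] /=; rewrite -E divfK // (b1_neq0 indep).
rewrite /basis_det E cabs_sqr /h /habs /h'.
have p : 0 <= complex.Re b.1 ^+ 2 + complex.Im b.1 ^+ 2 by rewrite addr_ge0 // sqr_ge0.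
by rewrite -(ger0_norm p) -normrM; congr `|_|; case: (b.1) => x y /=; ring.
Qed.
Hypothesis covol : `|basis_det b| = pi / 2.

(** This is where the covolume pi/2 enters: the growth of psi in the direction of t
differs from |z|^2 by a real part of a multiple of z^2. *)
Lemma height_square (s t : R) :
  pi * h * t ^+ 2 = cabs (pt b s t) ^+ 2 - complex.Re (pt b s t ^+ 2 * ((cabs b.1 ^+ 2)%:C / b.1 ^+ 2)).
Proof.
have hp : 0 < h by exact: habs_gt0.
rewrite (tau_pt indep); set w := (_ +i* _).
have b10 := b1_neq0 indep.
have -> : (b.1 * w) ^+ 2 * ((cabs b.1 ^+ 2)%:C / b.1 ^+ 2) = (cabs b.1 ^+ 2)%:C * w ^+ 2.
  by field; rewrite b10.
have -> : complex.Re ((cabs b.1 ^+ 2)%:C * w ^+ 2) = cabs b.1 ^+ 2 * complex.Re (w ^+ 2).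
  by case: (w ^+ 2) => x y /=; ring.
rewrite cabsM exprMn -mulrBr [cabs w ^+ 2]cabs_sqr.
have -> : complex.Re w ^+ 2 + complex.Im w ^+ 2 - complex.Re (w ^+ 2) = 2 * (t * h') ^+ 2.
  by rewrite /w /= /h'; ring.
have -> : (t * h') ^+ 2 = t ^+ 2 * (h * h).
  by rewrite exprMn -(real_normK (num_real h')) -expr2.
have := covol; rewrite basis_detE => E.
have -> : cabs b.1 ^+ 2 * (2 * (t ^+ 2 * (h * h))) = 2 * (h * cabs b.1 ^+ 2) * h * t ^+ 2 by ring.
by rewrite E [2 * (pi / 2)]mulrC divfK.
Qed.

(** The function whose periodicity defines the constant of the modified sigma
function. *)
Definition star_gauge (c : R[i]) (z : R[i]) : R :=
  expR (- cabs z ^+ 2) * cabs (sigma_star_with L c z).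
Lemma star_gauge_formula : exists c0 : R[i], forall (c : R[i]) (s t : R),
  star_gauge c (pt b s t) =
  expR (complex.Re (pt b s t ^+ 2 * (c - c0))) * (scale_const b * psi r h' s t).
Proof.
have [al Hal] := sigma_formula Lb.
exists (((cabs b.1 ^+ 2)%:C / b.1 ^+ 2) - al) => c s t.
rewrite /star_gauge /sigma_star_with cabsM cabs_cexp Hal /plain_lim -/h (height_square s t).
set z := pt b s t; set g := (cabs b.1 ^+ 2)%:C / b.1 ^+ 2.
have -> : z ^+ 2 * (c - (g - al)) = c * z ^+ 2 + z ^+ 2 * al - z ^+ 2 * g by ring.
rewrite raddfB raddfD /= !expRD !expRN -/r -/h'.
set A := expR _; set B := expR _; set D := expR _; set E := expR _.
have A0 : A != 0 by rewrite gt_eqF // expR_gt0.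
have E0 : E != 0 by rewrite gt_eqF // expR_gt0.
by rewrite /=; field; rewrite A0 E0.
Qed.

(** Existence of the constant is the periodicity of psi. For uniqueness, if
exp(Re(k z^2)) is invariant under z -> z + b1 for z near 0, then
Re(2 k b1 z + k b1^2) vanishes for all such z; comparing z with - z, and taking
z in two directions, gives k b1 = 0. *)
Lemma sigma_star_formula (s t : R) :
  expR (- cabs (pt b s t) ^+ 2) * cabs (sigma_star L (pt b s t)) = scale_const b * psi r h' s t.
Proof.
have [c0 Hc0] := star_gauge_formula.
have per c : c = c0 -> lattice_periodic L (star_gauge c).
  move=> -> z om /(lattice_mem Lb)[m [n ->]].
  have [s' [t' ->]] := pt_surj indep z.
  have -> : pt b s' t' + lpt b m n = pt b (s' + m%:~R) (t' + n%:~R).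
    by rewrite /lpt /pt !rmorphD /=; ring.
  by rewrite !Hc0 subrr !mulr0 /= psi_period.
have Pc : lattice_periodic L (star_gauge (sigma_star_const L)).
  pose P := [set c | lattice_periodic L (star_gauge c)].
  exact: (@xgetPex _ 0 P (ex_intro _ c0 (per c0 erefl))).
suff E : sigma_star_const L = c0.
  have := Hc0 (sigma_star_const L) s t; rewrite /star_gauge -/(sigma_star L _) => ->.
  by rewrite E subrr mulr0 /= expR0 mul1r.
set c := sigma_star_const L in Pc *.
apply/eqP; rewrite -subr_eq0; set k := c - c0.
have g0 := basis_gap_gt0 indep.
have C0 := scale_const_gt0 Lb.
have Lb1 : L b.1.
  by apply/(lattice_mem Lb); exists 1, 0; rewrite /lpt /pt mul0r addr0 mul1r.
(* for z off the lattice the exponent is invariant under translation by b.1 *)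
have inv z : ~ L z -> complex.Re (2 * (z * b.1 * k) + b.1 ^+ 2 * k) = 0.
  move=> zL; have [s' [t' zE]] := pt_surj indep z.
  have := Pc z _ Lb1; have -> : z + b.1 = pt b (s' + 1%:~R) (t' + 0%:~R).
    by rewrite zE /pt addr0 rmorphD /=; ring.
  rewrite zE !Hc0 (psi_period r h0) -/k => /mulIf H.
  have nz : scale_const b * psi r h' s' t' != 0.
    rewrite gt_eqF // mulr_gt0 //.
    have := zL; rewrite zE => /(plain_lim_gt0 Lb).
    by rewrite /plain_lim pmulr_rgt0 // mulr_gt0 // expR_gt0.
  have /expR_inj {}H := H nz.
  have -> : 2 * (pt b s' t' * b.1 * k) + b.1 ^+ 2 * k =
     pt b (s' + 1%:~R) (t' + 0%:~R) ^+ 2 * k - pt b s' t' ^+ 2 * k.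
    have -> : pt b (s' + 1%:~R) (t' + 0%:~R) = pt b s' t' + b.1.
      by rewrite /pt addr0 rmorphD /=; ring.
    by ring.
  by rewrite raddfB /= H subrr.
pose e : R := basis_gap b / 2.
have e0 : 0 < e by rewrite divr_gt0.
have lin (w : R[i]) : w != 0 -> cabs w <= 1 -> complex.Re (w * (b.1 * k)) = 0.
  move=> w0 w1.
  have ew (sg : R[i]) : cabs sg = 1 -> ~ L (sg * (e%:C * w)).
    move=> sg1; apply: (small_not_lattice Lb).
      rewrite -cabs_eq0 !cabsM sg1 mul1r cabs_real ger0_norm ?(ltW e0) //.
      by rewrite mulf_neq0 ?cabs_eq0 // gt_eqF.
    rewrite !cabsM sg1 mul1r cabs_real ger0_norm ?(ltW e0) //.
    apply: (@le_lt_trans _ _ e); first by rewrite ler_piMr // ltW.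
    by rewrite /e ltr_pdivrMr // ltr_pMr // ltr1n.
  have := inv _ (ew 1 (@cabs1 R)); have := inv _ (ew (-1) _).
  rewrite cabsN cabs1 => /(_ erefl); rewrite !raddfD /= => A B.
  have : complex.Re (2 * (1 * (e%:C * w) * b.1 * k)) - complex.Re (2 * (-1 * (e%:C * w) * b.1 * k)) = 0.
    by move: A B; lra.
  rewrite -raddfB /=.
  have -> : 2 * (1 * (e%:C * w) * b.1 * k) - 2 * (-1 * (e%:C * w) * b.1 * k) = (4 * e)%:C * (w * (b.1 * k)).
    by rewrite realCM (rmorph_nat (real_complex R)); ring.
  have -> (x : R) (v : R[i]) : complex.Re (x%:C * v) = x * complex.Re v by case: v => ? ? /=; ring.
  have e4 : 4 * e != 0 by rewrite mulf_neq0 // gt_eqF.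
  by move/eqP; rewrite mulf_eq0 (negbTE e4) /= => /eqP.
have ci : cabs ('i : R[i]) = 1 by rewrite /cabs normc_def /= expr0n expr1n add0r sqrtr1.
have A := lin 1 (oner_neq0 _); rewrite cabs1 mul1r in A; have {}A := A (lexx _).
have i0 : 'i != 0 :> R[i] by rewrite -cabs_eq0 ci oner_eq0.
have B := lin 'i i0; rewrite ci in B; have {}B := B (lexx _).
have : b.1 * k == 0.
  move: A B; case: (b.1 * k) => x y /= xx; rewrite xx => yy.
  by rewrite eq_complex /= eqxx /=; apply/eqP; lra.
by rewrite mulf_eq0 (negbTE (b1_neq0 indep)).
Qed.
Local Open Scope ereal_scope.
Lemma log_sigma_star_formula (s t : R) :
  log_sigma_star L (pt b s t) = lne (scale_const b * psi r h' s t)%:E.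
Proof.
rewrite /log_sigma_star -sigma_star_formula; set x := cabs (pt b s t); set y := cabs (sigma_star L _).
have := cabs_ge0 (sigma_star L (pt b s t)); rewrite -/y le_eqVlt => /orP[/eqP <-|y0].
  by rewrite mulr0 !le0_lneNy //= ?addNye.
by rewrite !lne_EFin ?mulr_gt0 ?expR_gt0 // lnM ?posrE ?expR_gt0 // expRK EFinD addeC EFinN.
Qed.
End SigmaStar.

(** * Linear changes of variable in the plane *)

Section LinearChange.
Variable R : realType.
Notation mu := (@lebesgue_measure R).
Notation GR := (measurableTypeR R).
Local Open Scope ereal_scope.
Definition aff (a c : R) (x : GR) : GR := (a * x + c)%R.
Lemma measurable_aff a c : measurable_fun [set: GR] (aff a c).
Proof.
have : measurable_fun [set: GR] (fun x : R => a * x + c)%R.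
  apply: measurable_funD => //; exact: mulrl_measurable.
by [].
Qed.

(** By uniqueness of Lebesgue measure it suffices to compare intervals. *)
Lemma lebesgue_measure_aff (a c : R) (A : set GR) : a != 0%R -> measurable A ->
  mu A = `|a|%:E * pushforward mu (aff a c) A.
Proof.
move=> a0 mA.
pose nu0 : {measure set GR -> \bar R} := mscale (NngNum (normr_ge0 a)) (pushforward mu (aff a c)).
pose nu := nu0 (measurable_aff a c).
have := @lebesgue_measure_unique R nu.
move=> /(_ _ A mA) -> //= _ [[u v]] _ <-.
rewrite /nu /nu0 /mscale /= /pushforward /=.
have [a_gt0|a_lt0] := ltP 0%R a.
  have -> : aff a c @^-1` `]u, v]%classic = `]((u - c) / a)%R, ((v - c) / a)%R]%classic.
    apply/seteqP; split => x; rewrite /= !in_itv /= /aff ltr_pdivrMr // ler_pdivlMr // [(x * a)%R]mulrC.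
      by move=> /andP[A1 A2]; apply/andP; split; lra.
    by move=> /andP[A1 A2]; apply/andP; split; lra.
  rewrite !lebesgue_measure_itv /= !lte_fin ltr_pM2r ?invr_gt0 // ltrD2r.
  case: ifP => _; last by rewrite mule0.
  rewrite -EFinB -EFinM gtr0_norm //; congr (_%:E).
  by field.
have {}a_lt0 : (a < 0)%R by rewrite lt_neqAle a0.
have -> : aff a c @^-1` `]u, v]%classic = `[((v - c) / a)%R, ((u - c) / a)%R[%classic.
  apply/seteqP; split => x; rewrite /= !in_itv /= /aff ltr_ndivlMr // ler_ndivrMr // [(x * a)%R]mulrC.
    by move=> /andP[A1 A2]; apply/andP; split; lra.
  by move=> /andP[A1 A2]; apply/andP; split; lra.
rewrite !lebesgue_measure_itv /= !lte_fin ltr_nM2r ?invr_lt0 // ltrD2r.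
case: ifP => _; last by rewrite mule0.
rewrite -EFinB -EFinM ltr0_norm //; congr (_%:E).
by field.
Qed.

Lemma integral_aff (a c : R) (f : GR -> \bar R) : a != 0%R ->
  measurable_fun setT f -> (forall x, 0 <= f x) ->
  `|a|%:E * \int[mu]_x f (aff a c x) = \int[mu]_x f x.
Proof.
move=> a0 mf f0.
pose nu0 : {measure set GR -> \bar R} := mscale (NngNum (normr_ge0 a)) (pushforward mu (aff a c)).
pose nu := nu0 (measurable_aff a c).
have -> : \int[mu]_x f x = \int[nu]_x f x.
  by apply: eq_measure_integral => A mA _ /=; rewrite /nu /nu0 /mscale /= (lebesgue_measure_aff c a0 mA).
rewrite /nu /nu0 ge0_integral_mscale //=; congr (_ * _).
rewrite ge0_integral_pushforward //.
exact: measurable_aff.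
Qed.

Definition lin2 (a1 c1 a2 c2 : R) (q : GR * GR) : GR * GR :=
  (q.1 * a1 + q.2 * a2, q.1 * c1 + q.2 * c2)%R.
Lemma measurable_lincomb (a c : R) : measurable_fun [set: GR * GR] (fun q : GR * GR => (q.1 * a + q.2 * c)%R : GR).
Proof.
have : measurable_fun [set: GR * GR] (fun q : GR * GR => (q.1 * a + q.2 * c)%R : R).
  by apply: measurable_funD; apply: measurable_funM.
by [].
Qed.

Lemma measurable_lin2 a1 c1 a2 c2 : measurable_fun setT (lin2 a1 c1 a2 c2).
Proof. by apply: measurable_fun_pair; exact: measurable_lincomb. Qed.

(** Integrate in one variable at a time; a shear preserves the inner integrals.
When c2 = 0 the other variable is eliminated first. *)
Lemma integral_lin2 (a1 c1 a2 c2 : R) (f : GR * GR -> \bar R) :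
  (a1 * c2 - c1 * a2 != 0)%R -> measurable_fun setT f -> (forall p, 0 <= f p) ->
  \int[area R]_p f p = `|a1 * c2 - c1 * a2|%:E * \int[area R]_q f (lin2 a1 c1 a2 c2 q).
Proof.
move=> D0 mf f0.
have mg : measurable_fun setT (f \o lin2 a1 c1 a2 c2).
  by apply: measurableT_comp => //; exact: measurable_lin2.
rewrite /area (fubini_tonelli2 f) // (fubini_tonelli1 (f \o lin2 a1 c1 a2 c2)) //=.
have mF : measurable_fun setT (fun s : GR => \int[mu]_t f ((s * a1 + t * a2)%R, (s * c1 + t * c2)%R)).
  exact: (@measurable_fun_fubini_tonelli_F _ _ GR GR R mu (f \o lin2 a1 c1 a2 c2) mg (fun q => f0 _)).
rewrite /fubini_F /fubini_G /lin2 /=.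
have [c20|c20] := eqVneq c2 0%R.
  have a2c1 : (a2 != 0)%R /\ (c1 != 0)%R.
    by move: D0; rewrite c20 mulr0 sub0r oppr_eq0 mulf_eq0 negb_or => /andP[-> ->].
  case: a2c1 => a20 c10.
  have -> : `|a1 * c2 - c1 * a2|%R = (`|c1| * `|a2|)%R by rewrite c20 mulr0 sub0r normrN normrM.
  rewrite EFinM -muleA.
  pose G := fun y : GR => \int[mu]_x f (x, y).
  have mG : measurable_fun setT G by exact: (@measurable_fun_fubini_tonelli_G _ _ GR GR R mu f mf f0).
  have G0 y : 0 <= G y by apply: integral_ge0.
  rewrite -(integral_aff 0 c10 mG G0); congr (_ * _).
  rewrite -ge0_integralZl //; last by move=> s _; apply: integral_ge0.
  apply: eq_integral => s _; rewrite /G.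
  have mh : measurable_fun setT (fun x : GR => f (x, aff c1 0 s)).
    by apply: measurableT_comp => //; exact: pair2_measurable.
  rewrite -(integral_aff (s * a1) a20 mh) //; congr (_ * _); apply: eq_integral => t _.
  by congr (f (_, _)); rewrite /aff ?c20 ?mulr0 ?addr0; ring.
set D := (a1 * c2 - c1 * a2)%R in D0 *.
have E : `|D|%R = (`|D / c2| * `|c2|)%R by rewrite -normrM divfK.
rewrite E EFinM -muleA.
pose H := fun q : GR * GR => f ((q.1 * (D / c2) + q.2 * (a2 / c2))%R, q.2).
have mH : measurable_fun setT H.
  apply: (measurableT_comp mf); apply: measurable_fun_pair; first exact: measurable_lincomb.
  exact: measurable_snd.
have H0 q : 0 <= H q by exact: f0.
have -> : `|c2|%:E * \int[mu]_s \int[mu]_t f ((s * a1 + t * a2)%R, (s * c1 + t * c2)%R) =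
   \int[mu]_s \int[mu]_y H (s, y).
  rewrite -ge0_integralZl //; last by move=> s _; apply: integral_ge0.
  apply: eq_integral => s _.
  have mh : measurable_fun setT (fun y : GR => H (s, y)).
    by apply: measurableT_comp => //; exact: pair1_measurable.
  rewrite -(integral_aff (s * c1) c20 mh) //; congr (_ * _); apply: eq_integral => t _.
  rewrite /H /aff /=; congr (f (_, _)); last by ring.
  by rewrite /D; field.
rewrite (fubini_tonelli H) // -ge0_integralZl //; last 2 first.
- exact: (@measurable_fun_fubini_tonelli_G _ _ GR GR R mu H mH H0).
- by move=> s _; apply: integral_ge0.
apply: eq_integral => y _.
have mh : measurable_fun setT (fun x : GR => f (x, y)).
  by apply: measurableT_comp => //; exact: pair2_measurable.
have Dc0 : (D / c2 != 0)%R by rewrite mulf_neq0 // invr_eq0.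
rewrite -(integral_aff (y * (a2 / c2)) Dc0 mh) //; congr (_ * _); apply: eq_integral => s _.
by rewrite /H /aff /=; congr (f (_, _)); ring.
Qed.
End LinearChange.

(** * Means of doubly periodic functions *)

Section PeriodicIntegral.
Variable R : realType.
Notation mu := (@lebesgue_measure R).
Notation GR := (measurableTypeR R).
Local Open Scope ereal_scope.
Definition unit_itv : set GR := [set` `[0%R : R, 1%R[].
Notation U := unit_itv.
Lemma unit_itvE (x : R) : U x = (0 <= x < 1)%R :> Prop.
Proof. by rewrite /unit_itv /= in_itv. Qed.

Lemma measurable_unit_itv : measurable U.
Proof. exact: measurable_itv. Qed.

Lemma integral_translate (D : set GR) (a : R) (f : GR -> \bar R) : measurable D ->
  measurable_fun setT f -> (forall x, 0 <= f x) ->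
  \int[mu]_(x in D) f x = \int[mu]_(x in [set x : GR | D (x + a)%R]) f (x + a)%R.
Proof.
move=> mD mf f0; rewrite integral_mkcond [RHS]integral_mkcond.
rewrite -(@integral_aff R 1 a (f \_ D)) ?oner_neq0 //; last 2 first.
- by apply/(measurable_restrictT _ mD)/measurable_funTS.
- by move=> x; rewrite patchE; case: ifP.
rewrite normr1 mul1e; apply: eq_integral => x _.
rewrite !patchE /aff mul1r.
have -> : (x \in [set x : GR | D (x + a)%R]) = ((x + a)%R \in D) by apply/idP/idP; rewrite !inE.
by [].
Qed.

Lemma periodic_int (f : GR -> \bar R) (m : int) x : (forall x, f (x + 1)%R = f x) -> f (x + m%:~R)%R = f x.
Proof.
move=> P; have Pn n y : f (y + n%:R)%R = f y.
  elim: n y => [|n IH] y; first by rewrite addr0.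
  by rewrite -natr1 addrA P IH.
case: m => n; first by rewrite -pmulrn Pn.
by rewrite NegzE mulrNz -pmulrn -(Pn n.+1 (x - _)%R) subrK.
Qed.

(** The shift may be taken in [0, 1); the part of the translated interval that
leaves [0, 1) returns by periodicity. *)
Lemma integral_period_shift (f : GR -> \bar R) (a : R) :
  measurable_fun setT f -> (forall x, 0 <= f x) -> (forall x, f (x + 1)%R = f x) ->
  \int[mu]_(x in U) f (x + a)%R = \int[mu]_(x in U) f x.
Proof.
move=> mf f0 P.
have -> : \int[mu]_(x in U) f (x + a)%R = \int[mu]_(x in U) f (x + frac a)%R.
  apply: eq_integral => x _.
  by rewrite [in LHS](fracE a) addrA periodic_int.
have := frac_itv a; move: (frac a) => c /andP[c0 c1].
have sp (u v w : R) : (u <= v)%R -> (v <= w)%R ->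
   \int[mu]_(x in `[u, w[) f x = \int[mu]_(x in `[u, v[) f x + \int[mu]_(x in `[v, w[) f x.
  move=> uv vw; rewrite -ge0_integral_setU //.
  - congr (integral _ _ _); apply/seteqP; split => x /=; rewrite !in_itv /=.
      move=> /andP[A B]; case: (ltP x v) => C; [left|right]; apply/andP; split => //.
    move=> [|] /andP[A B]; apply/andP; split => //; first exact: lt_le_trans B vw.
    exact: le_trans uv A.
  - exact: measurable_funTS.
  - apply/disj_setPS => x [] /=; rewrite !in_itv /= => /andP[_ A] /andP[B _].
    by move: (le_lt_trans B A); rewrite ltxx.
have -> : \int[mu]_(x in U) f (x + c)%R = \int[mu]_(x in `[c, (c + 1)%R[) f x.
  rewrite (@integral_translate `[c, (c + 1)%R[ c) //; congr (integral _ _ _).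
  rewrite /unit_itv.
  apply/seteqP; split => x /=; rewrite !in_itv /= => /andP[A B]; apply/andP; split; lra.
rewrite (sp c 1%R (c + 1)%R (ltW c1)); last by rewrite lerDr.
rewrite /unit_itv (sp 0%R c 1%R c0 (ltW c1)) addeC; congr (_ + _).
rewrite (@integral_translate `[1%R, (c + 1)%R[ 1) //.
rewrite (eq_integral f); last by move=> x _; rewrite P.
congr (integral _ _ _).
apply/seteqP; split => x /=; rewrite !in_itv /= => /andP[A B]; apply/andP; split; lra.
Qed.

Lemma lebesgue_unit_itv : mu U = 1.
Proof. by rewrite lebesgue_measure_itv /= lte_fin ltr01 oppr0 adde0. Qed.

Definition unit_sq : set (GR * GR) := U `*` U.
Lemma measurable_unit_sq : measurable unit_sq.
Proof. by apply: measurableX; exact: measurable_unit_itv. Qed.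

(** Written as an iterated integral because the argument works row by row; [meanE]
is Tonelli's theorem. *)
Definition mean (G : R -> R -> \bar R) : \bar R := \int[mu]_(t in U) \int[mu]_(s in U) G s t.
Definition measurable2 (G : R -> R -> \bar R) :=
  measurable_fun [set: GR * GR] (fun q : GR * GR => G q.1 q.2).
Lemma measurable2_row G t : measurable2 G -> measurable_fun [set: GR] (fun s : GR => G s t).
Proof.
move=> mG; rewrite (_ : (fun s : GR => G s t) = (fun q : GR * GR => G q.1 q.2) \o (fun s : GR => (s, t))) //.
by apply: (measurableT_comp mG); exact: pair2_measurable.
Qed.

(** The inner integral of Tonelli's theorem, for the function cut off outside the
strip 0 <= s < 1. *)
Lemma measurable2_rows G : measurable2 G -> (forall s t, 0 <= G s t) ->
  measurable_fun [set: GR] (fun t : GR => \int[mu]_(s in U) G s t).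
Proof.
move=> mG G0.
pose H : GR * GR -> \bar R := (fun q => G q.1 q.2) \_ (U `*` setT).
have mUT : measurable (U `*` [set: GR]).
  by apply: measurableX => //; exact: measurable_unit_itv.
have mH : measurable_fun setT H.
  by apply/(measurable_restrictT _ mUT)/measurable_funTS.
have H0 q : 0 <= H q by rewrite /H patchE; case: ifP.
have := (@measurable_fun_fubini_tonelli_G _ _ GR GR R mu H mH H0).
apply: eq_measurable_fun => t _; rewrite /fubini_G [RHS]integral_mkcond; apply: eq_integral => s _.
rewrite /H !patchE.
have -> : ((s, t) \in U `*` [set: GR]) = (s \in U) by apply/idP/idP; rewrite !inE //= => -[].
by [].
Qed.

Lemma meanE G : measurable2 G -> (forall s t, 0 <= G s t) ->
  \int[area R]_(q in unit_sq) G q.1 q.2 = mean G.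
Proof.
move=> mG G0; rewrite integral_mkcond.
have mH : measurable_fun setT ((fun q : GR * GR => G q.1 q.2) \_ unit_sq).
  by apply/(measurable_restrictT _ measurable_unit_sq)/measurable_funTS.
rewrite /area fubini_tonelli2 //; last by move=> q; rewrite patchE; case: ifP.
rewrite /mean [RHS]integral_mkcond; apply: eq_integral => t _.
rewrite /fubini_G patchE; case: ifPn => tU.
  rewrite [RHS]integral_mkcond; apply: eq_integral => s _; rewrite !patchE.
  have -> : ((s, t) \in unit_sq) = (s \in U); last by [].
  by apply/idP/idP; rewrite !inE; [case|split => //; move: tU; rewrite inE].
rewrite integral0_eq // => s _; rewrite patchE.
have -> : ((s, t) \in unit_sq) = false; last by [].
by apply/negP; rewrite inE => -[_ /= tt]; move/negP: tU; apply; rewrite inE.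
Qed.

Lemma mean_cst (r : R) : mean (fun _ _ => r%:E) = r%:E.
Proof.
rewrite /mean.
have E : \int[mu]_(s in U) r%:E = r%:E.
  have := @integral_cst _ _ _ mu U measurable_unit_itv r%:E => /= ->.
  by rewrite [X in _ * X]lebesgue_unit_itv mule1.
by rewrite (eq_integral (fun=> r%:E)) // => t _.
Qed.

Lemma meanD F G : measurable2 F -> (forall s t, 0 <= F s t) -> measurable2 G ->
  (forall s t, 0 <= G s t) -> mean (fun s t => F s t + G s t) = mean F + mean G.
Proof.
move=> mF F0 mG G0; rewrite /mean -ge0_integralD //.
- apply: eq_integral => t _; rewrite ge0_integralD //.
  + exact: measurable_unit_itv.
  + by apply: measurable_funTS; apply: measurable2_row.
  + by apply: measurable_funTS; apply: measurable2_row.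
- exact: measurable_unit_itv.
- by move=> t _; apply: integral_ge0.
- by apply: measurable_funTS; apply: measurable2_rows.
- by move=> t _; apply: integral_ge0.
- by apply: measurable_funTS; apply: measurable2_rows.
Qed.

Lemma meanZ (c : R) F : (0 <= c)%R -> measurable2 F -> (forall s t, 0 <= F s t) ->
  mean (fun s t => c%:E * F s t) = c%:E * mean F.
Proof.
move=> c0 mF F0; rewrite /mean -ge0_integralZl //.
- apply: eq_integral => t _; rewrite ge0_integralZl //.
  + exact: measurable_unit_itv.
  + by apply: measurable_funTS; apply: measurable2_row.
- exact: measurable_unit_itv.
- by apply: measurable_funTS; apply: measurable2_rows.
- by move=> t _; apply: integral_ge0.
Qed.

Lemma mean_le F G : measurable2 F -> measurable2 G -> (forall s t, 0 <= F s t) ->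
  (forall s t, F s t <= G s t) -> mean F <= mean G.
Proof.
move=> mF mG F0 FG; rewrite /mean.
have G0 s t : 0 <= G s t by exact: le_trans (F0 _ _) (FG _ _).
apply: ge0_le_integral => //.
- exact: measurable_unit_itv.
- by move=> t _; apply: integral_ge0.
- by apply: measurable_funTS; apply: measurable2_rows.
- by apply: measurable_funTS; apply: measurable2_rows.
- move=> t _; apply: ge0_le_integral => //.
  + exact: measurable_unit_itv.
  + by apply: measurable_funTS; apply: measurable2_row.
  + by apply: measurable_funTS; apply: measurable2_row.
Qed.

Lemma mean_shift G (a c : R) : measurable2 G -> (forall s t, 0 <= G s t) ->
  (forall s t, G (s + 1)%R t = G s t) -> (forall s t, G s (t + 1)%R = G s t) ->
  mean (fun s t => G (s + a) (t + c))%R = mean G.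
Proof.
move=> mG G0 P1 P2; rewrite /mean.
rewrite -(@integral_period_shift (fun t : GR => \int[mu]_(s in U) G s t) c).
- apply: eq_integral => t _.
  rewrite (@integral_period_shift (fun s : GR => G s (t + c)%R) a) //.
  exact: measurable2_row.
- exact: measurable2_rows.
- by move=> t; apply: integral_ge0.
- by move=> t; apply: eq_integral => s _; rewrite P2.
Qed.
End PeriodicIntegral.

(** * Integration over the fundamental parallelogram *)

Section TorusIntegral.
Variables (R : realType) (L : set R[i]).
Notation GR := (measurableTypeR R).
Let b := basis_of_lattice L.
Hypothesis isL : is_lattice L.
Let indep := (basis_of_latticeP isL).1.
Let D := basis_det b.
Local Open Scope ereal_scope.
Definition from_coord : GR * GR -> GR * GR :=
  lin2 (complex.Re b.1) (complex.Im b.1) (complex.Re b.2) (complex.Im b.2).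
Definition to_coord : GR * GR -> GR * GR :=
  lin2 (complex.Im b.2 / D)%R (- complex.Im b.1 / D)%R (- complex.Re b.2 / D)%R (complex.Re b.1 / D)%R.
Lemma pair_from_coord q : complex_of_pair (from_coord q) = pt b q.1 q.2.
Proof. by rewrite ptE. Qed.

Lemma from_coordK : cancel from_coord to_coord.
Proof.
have D0 := basis_det_neq0 indep.
move=> [s t]; rewrite /to_coord /from_coord /lin2 /=; congr (_, _); rewrite -/D in D0 *;
  move: D0; rewrite /D /basis_det => D0; by field.
Qed.

Lemma to_coordK : cancel to_coord from_coord.
Proof.
have D0 := basis_det_neq0 indep.
move=> [s t]; rewrite /to_coord /from_coord /lin2 /=; congr (_, _); rewrite -/D in D0 *;
  move: D0; rewrite /D /basis_det => D0; by field.
Qed.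

Lemma parallelogramE : fundamental_parallelogram L = to_coord @^-1` (@unit_sq R).
Proof.
apply/seteqP; split => p.
  move=> [s [t [s01 t01 E]]]; have -> : p = from_coord (s, t).
    have := pair_from_coord (s, t); rewrite /= /pt -/b -E.
    by case: p {E} => x y; case: (from_coord (s, t)) => u v /= [-> ->].
  by rewrite /= from_coordK; split; rewrite unit_itvE.
rewrite /= => -[]; rewrite !unit_itvE => s01 t01.
exists (to_coord p).1, (to_coord p).2; split => //.
by rewrite -[in LHS](to_coordK p) pair_from_coord.
Qed.

Lemma measurable_parallelogram : measurable (fundamental_parallelogram L : set (GR * GR)).
Proof.
rewrite parallelogramE -[X in measurable X]setTI; apply: measurable_lin2 => //.
exact: measurable_unit_sq.
Qed.
Variables (f : R[i] -> \bar R) (G : R -> R -> \bar R).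
Hypothesis fG : forall s t, f (pt b s t) = G s t.
Hypothesis mG : measurable2 G.
Lemma measurable_torus_fun : measurable_fun [set: GR * GR] (fun p : GR * GR => f (complex_of_pair p)).
Proof.
rewrite (_ : (fun p : GR * GR => _) = (fun q : GR * GR => G q.1 q.2) \o to_coord).
  by apply: (measurableT_comp mG); exact: measurable_lin2.
by apply/funext => p; rewrite -[in LHS](to_coordK p) pair_from_coord fG.
Qed.

(** The basis maps the unit square onto the fundamental parallelogram and scales
areas by the determinant. *)
Lemma torus_integralE : (forall s t, 0 <= G s t) -> torus_integral L f = `|D|%:E * mean G.
Proof.
move=> G0; rewrite /torus_integral integral_mkcond -meanE //.
rewrite (@integral_lin2 R (complex.Re b.1) (complex.Im b.1) (complex.Re b.2) (complex.Im b.2)).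
- congr (_ * _); rewrite [RHS]integral_mkcond; apply: eq_integral => q _; rewrite !patchE.
  rewrite -/from_coord parallelogramE.
  have -> : (from_coord q \in to_coord @^-1` (@unit_sq R)) = (q \in @unit_sq R).
    by apply/idP/idP; rewrite !inE /= from_coordK.
  by rewrite pair_from_coord fG.
- exact: (basis_det_neq0 indep).
- apply/(measurable_restrictT _ measurable_parallelogram)/measurable_funTS.
  exact: measurable_torus_fun.
- move=> p; rewrite patchE; case: ifP => // _.
  by rewrite -[p]to_coordK pair_from_coord fG.
Qed.
End TorusIntegral.

Section Covolume.
Variables (R : realType) (L : set R[i]).
Hypothesis isL : is_lattice L.
Local Open Scope ereal_scope.
Lemma covolumeE : covolume L = `|basis_det (basis_of_lattice L)|%:E.
Proof.
have -> : covolume L = torus_integral L (fun=> 1).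
  rewrite /torus_integral integral_cst ?mul1e //; exact: measurable_parallelogram.
rewrite (@torus_integralE _ _ isL _ (fun _ _ => 1)) //; last exact: measurable_cst.
by rewrite mean_cst mule1.
Qed.
End Covolume.

(** * Measurability of theta *)

Section MeasurableTheta.
Variables (R : realType) (r h' : R).
Hypothesis h0 : h' != 0.
Notation GR := (measurableTypeR R).
Notation h := (habs h').
Lemma kfacE (x y : R) : kfac x y =
  Num.sqrt (1 - 2 * expR (- (2 * pi * `|y|)) * cos (2 * pi * x) + expR (- (2 * pi * `|y|)) ^+ 2).
Proof. by rewrite -cabs_1Bcexp_sqr sqrtr_sqr ger0_norm // cabs_ge0. Qed.

Lemma measurable_cos : measurable_fun [set: R] (@cos R).
Proof. by apply: continuous_measurable_fun; exact: continuous_cos. Qed.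

Lemma measurable_sqrt : measurable_fun [set: R] (@Num.sqrt R).
Proof. by apply: continuous_measurable_fun; exact: sqrt_continuous. Qed.

Lemma measurable_kfac d (T : measurableType d) (u v : T -> R) :
  measurable_fun setT u -> measurable_fun setT v -> measurable_fun setT (fun q => kfac (u q) (v q)).
Proof.
move=> mu mv.
rewrite (_ : (fun q => _) = (fun q => Num.sqrt (1 - 2 * expR (- (2 * pi * `|v q|)) * cos (2 * pi * u q) + expR (- (2 * pi * `|v q|)) ^+ 2))).
  have me : measurable_fun setT (fun q => expR (- (2 * pi * `|v q|))).
    apply: (measurableT_comp (@measurable_expR R)).
    apply: (measurableT_comp (@oppr_measurable R setT)).
    apply: measurable_funM => //; exact: measurableT_comp.
  apply: (measurableT_comp measurable_sqrt); apply: measurable_funD; last exact: measurable_funX.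
  apply: measurable_funB => //; apply: measurable_funM.
    exact: measurable_funM.
  apply: (measurableT_comp measurable_cos); exact: measurable_funM.
by apply/funext => q; rewrite kfacE.
Qed.

Lemma measurable_row_factor n : measurable_fun [set: GR * GR] (fun q : GR * GR => row_factor r h' q.1 q.2 n).
Proof.
have m2 : measurable_fun [set: GR * GR] (fun q : GR * GR => (q.2 + n%:~R)%R : R).
  by apply: measurable_funD.
apply: measurable_kfac.
  apply: measurable_funD => //; exact: measurable_funM.
exact: measurable_funM.
Qed.

Lemma measurable_theta : measurable_fun [set: GR * GR] (fun q : GR * GR => theta r h' q.1 q.2).
Proof.
apply: (@measurable_fun_cvg _ _ _ _ (fun N q => theta_n r h' q.1 q.2 N)).
  by move=> N; apply: measurable_prod => n _; exact: measurable_row_factor.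
by move=> q _; exact: theta_cvg.
Qed.

(** A limit of continuous functions, by [height_eventually]. *)
Lemma measurable_bern : measurable_fun [set: GR] (fun t : GR => bern (t : R)).
Proof.
apply: (@measurable_fun_cvg _ _ _ _ (fun N t => (t : R) ^+ 2 + 6^-1 - height (t : R) N)).
  move=> N; apply: measurable_funB.
    apply: measurable_funD => //; exact: measurable_funX.
  apply: measurable_funB => //; apply: measurable_sum => n.
  apply: measurableT_comp => //; exact: measurable_funD.
move=> t _; have [N0 H] := height_eventually (t : R).
apply: cvg_near_cst; exists N0 => // N /= /H ->; lra.
Qed.

Lemma measurable_psi : measurable_fun [set: GR * GR] (fun q : GR * GR => psi r h' q.1 q.2).
Proof.
apply: measurable_funM; last exact: measurable_theta.
apply: (measurableT_comp (@measurable_expR R)).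
apply: (measurableT_comp (@oppr_measurable R setT)).
apply: measurable_funM => //.
apply: (measurableT_comp measurable_bern); exact: measurable_snd.
Qed.
End MeasurableTheta.

(** * Bounds and multiplication formula for theta *)

Section ThetaBounds.
Variables (R : realType) (r h' : R).
Hypothesis h0 : h' != 0.
Definition decay_bound (t : R) : R := expR (2 * pi * habs h' * `|t|) * (2 / (1 - qabs h')).
Lemma one_Bqabs_gt0 : 0 < 1 - qabs h'.
Proof. by have /andP[_] := qabs_itv h0; rewrite subr_gt0. Qed.

Lemma decay_bound_ge0 t : 0 <= decay_bound t.
Proof. by rewrite mulr_ge0 ?expR_ge0 // divr_ge0 // ltW // one_Bqabs_gt0. Qed.

Lemma sum_row_decay_le t N : \sum_(n <- zrange N) row_decay h' t n <= decay_bound t.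
Proof.
apply: (@le_trans _ _ (\sum_(n <- zrange N) expR (2 * pi * habs h' * `|t|) * qabs h' ^+ `|n|)).
  by apply: ler_sum => n _; exact: row_decay_le.
rewrite -mulr_sumr ler_wpM2l ?expR_ge0 // big_zrange /= expr0.
have -> : \sum_(1 <= j < N.+1) (qabs h' ^+ `|j%:Z| + qabs h' ^+ `|- j%:Z|) = 2 * \sum_(1 <= j < N.+1) qabs h' ^+ j.
  by rewrite mulr_sumr; apply: eq_bigr => j _; rewrite abszN; ring.
have := sum_geometric_le (qabs_itv h0) 0 N.+1; rewrite big_ltn // expr0.
have : 1 <= (1 - qabs h')^-1.
  rewrite invf_ge1 ?one_Bqabs_gt0 //; have /andP[] := qabs_itv h0; lra.
lra.
Qed.

Definition theta_bound : R := decay_bound 1.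
Lemma theta_le s t : theta r h' s t <= expR theta_bound.
Proof.
rewrite (fracE t) theta_periodt //; apply: theta_le_expR => // N.
apply: le_trans (sum_row_decay_le _ _) _.
rewrite /theta_bound /decay_bound ler_wpM2r ?divr_ge0 ?(ltW one_Bqabs_gt0) // ler_expR ler_wpM2l ?(ltW (pihabs_gt0 h0)) //.
by have /andP[A B] := frac_itv t; rewrite ger0_norm // normr1 ltW.
Qed.

(** For 0 < t < 1 no row passes through the point, so each factor is at least 1 - x
with x bounded away from 1. The bound is the same for all moduli of larger height. *)
Lemma theta_ge_expR (a h2 s t : R) : h2 != 0 -> habs h' <= habs h2 -> 0 < t < 1 ->
  expR (- (decay_bound t / (1 - expR (- (2 * pi * habs h' * Num.min t (1 - t)))))) <= theta a h2 s t.
Proof.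
move=> h20 hle /andP[t0 t1]; set d := Num.min t (1 - t); set x0 := expR (- (_ * d)).
have d0 : 0 < d by rewrite /d lt_min t0 subr_gt0.
have x01 : 0 < 1 - x0.
  by rewrite subr_gt0 expR_lt1 oppr_lt0; apply: mulr_gt0 => //; exact: pihabs_gt0.
have kd n : row_decay h' t n <= x0.
  rewrite ler_expR lerN2 ler_wpM2l ?(ltW (pihabs_gt0 h0)) //.
  case: n => n.
    have n0 : 0 <= n%:R :> R by [].
    by rewrite -pmulrn (ger0_norm (addr_ge0 (ltW t0) n0)) ge_min lerDl n0.
  rewrite NegzE mulrNz -pmulrn ler0_norm; last first.
    have : 1 <= n.+1%:R :> R by rewrite ler1n.
    lra.
  have : 1 <= n.+1%:R :> R by rewrite ler1n.
  by rewrite ge_min => ?; apply/orP; right; lra.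
have c := @theta_cvg R a _ h20 s t.
rewrite -(cvg_lim _ c) //; apply: limr_ge; first by apply/cvg_ex; eexists; exact: c.
near=> N; apply: (@le_trans _ _ (\prod_(n <- zrange N) expR (- (row_decay h' t n / (1 - x0))))).
  rewrite -expR_sum ler_expR sumrN lerN2 -mulr_suml.
  by rewrite ler_wpM2r ?invr_ge0 ?(ltW x01) // sum_row_decay_le.
apply: ler_prod => n _; rewrite expR_ge0 /=; apply: le_trans (row_factor_ge _ _ _ _ _).
have kk : row_decay h2 t n <= row_decay h' t n.
  by rewrite ler_expR lerN2 ler_wpM2r // ler_wpM2l // mulr_ge0 // pi_ge0.
apply: (@le_trans _ _ (1 - row_decay h' t n)); last by rewrite lerD2l lerN2.
have := kd n; have := expR_ge0 (- (2 * pi * habs h' * `|t + n%:~R|)); rewrite -/(row_decay h' t n).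
move: (row_decay h' t n) => x xg xl.
rewrite expRN invf_ple ?posrE ?expR_gt0 //; last by lra.
apply: le_trans (expR_ge1Dx _).
apply: (@le_trans _ _ (1 + x / (1 - x))).
  by rewrite le_eqVlt; apply/orP; left; apply/eqP; field; lra.
rewrite lerD2l ler_wpM2l // lef_pV2 ?posrE //; lra.
Unshelve. all: by end_near.
Qed.

(** The distribution relation in each row. *)
Lemma prod_theta n s t : (0 < n)%N ->
  \prod_(0 <= j < n) theta r h' (s + j%:R / n%:R) t = theta (n%:R * r) (n%:R * h') (n%:R * s) t.
Proof.
move=> n0.
have nh0 : n%:R * h' != 0 by rewrite mulf_neq0 // pnatr_eq0 -lt0n.
apply: (cvg_unique _ (_ : (fun N => \prod_(0 <= j < n) theta_n r h' (s + j%:R / n%:R) t N) @ \oo --> _) _) => //.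
  have mc : continuous (fun x : R * R => x.1 * x.2) by move=> x; exact: mul_continuous.
  by apply: (cvg_big mc) => j _; exact: theta_cvg.
have -> : (fun N => \prod_(0 <= j < n) theta_n r h' (s + j%:R / n%:R) t N) = theta_n (n%:R * r) (n%:R * h') (n%:R * s) t.
  apply/funext => N; rewrite /theta_n exchange_big /=; apply: eq_bigr => m _.
  rewrite /row_factor (_ : n%:R * s + (t + m%:~R) * (n%:R * r) = n%:R * (s + (t + m%:~R) * r)); last by ring.
  rewrite (_ : (t + m%:~R) * (n%:R * h') = n%:R * ((t + m%:~R) * h')); last by ring.
  by rewrite -prod_kfac //; apply: eq_bigr => j _; rewrite addrAC.
exact: theta_cvg.
Qed.

(** Rows of n tau are further apart than those of tau, so all bounds improve. *)
Lemma ln_theta_multiple (t : R) : 0 < t < 1 -> exists C, 0 <= C /\ forall n s, (0 < n)%N ->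
  `|ln (theta (n%:R * r) (n%:R * h') (n%:R * s) t)| <= C.
Proof.
move=> t01; set C1 := decay_bound t / (1 - expR (- (2 * pi * habs h' * Num.min t (1 - t)))).
exists (Num.max C1 (decay_bound t)); split; first by rewrite le_max decay_bound_ge0 orbT.
move=> n s n0.
have nh0 : n%:R * h' != 0 by rewrite mulf_neq0 // pnatr_eq0 -lt0n.
have hle : habs h' <= habs (n%:R * h').
  by rewrite /habs normrM ler_peMl // ger0_norm // ler1n.
have L := theta_ge_expR (n%:R * r) (n%:R * s) nh0 hle t01.
have T0 : 0 < theta (n%:R * r) (n%:R * h') (n%:R * s) t by apply: lt_le_trans L; exact: expR_gt0.
have Up : theta (n%:R * r) (n%:R * h') (n%:R * s) t <= expR (decay_bound t).
  apply: theta_le_expR => // M; apply: le_trans (sum_row_decay_le t M); apply: ler_sum => m _.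
  by rewrite ler_expR lerN2 ler_wpM2r // ler_wpM2l // mulr_ge0 // pi_ge0.
rewrite ler_norml; apply/andP; split.
  rewrite lerNl; apply: (@le_trans _ _ C1); last by rewrite le_max lexx.
  by rewrite lerNl -ler_expR lnK ?posrE.
apply: (@le_trans _ _ (decay_bound t)); last by rewrite le_max lexx orbT.
by rewrite -ler_expR lnK ?posrE.
Qed.
End ThetaBounds.

(** * The mean of log theta *)

Section ThetaMean.
Variables (R : realType) (r h' : R).
Hypothesis h0 : h' != 0.
Notation mu := (@lebesgue_measure R).
Notation GR := (measurableTypeR R).
Notation U := (@unit_itv R).
Notation B := (theta_bound h').
Lemma ln_prod (I : eqType) (s : seq I) (F : I -> R) : (forall i, i \in s -> 0 < F i) ->
  ln (\prod_(i <- s) F i) = \sum_(i <- s) ln (F i).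
Proof.
elim: s => [|i s IH] F0; first by rewrite !big_nil ln1.
have F0' j : j \in s -> 0 < F j by move=> js; apply: F0; rewrite inE js orbT.
rewrite !big_cons lnM ?IH // posrE; first by apply: F0; rewrite mem_head.
by rewrite big_seq; apply: prodr_gt0.
Qed.
Local Open Scope ereal_scope.
Lemma integral_unit_cst (c : R) : \int[mu]_(s in U) c%:E = c%:E.
Proof.
have := @integral_cst _ _ _ mu U (@measurable_unit_itv R) c%:E => /= ->.
by rewrite [X in _ * X]lebesgue_unit_itv mule1.
Qed.

Lemma measurable_lne d (T : measurableType d) (u : T -> R) :
  measurable_fun setT u -> measurable_fun setT (fun q => lne (u q)%:E).
Proof.
move=> mu; apply: measurable_fun_ifT.
- exact: measurable_fun_ler.
- exact: measurable_cst.
- apply/measurable_EFinP; exact: (measurableT_comp (@measurable_ln R)).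
Qed.

(** Working with the nonnegative deficit of log theta below its upper bound avoids
integrals of signed extended reals with value -oo. *)
Definition theta_gap (s t : R) : \bar R := B%:E - lne (theta r h' s t)%:E.
Lemma measurable_theta_gap : measurable2 theta_gap.
Proof.
apply: emeasurable_funB; first exact: measurable_cst.
by apply: measurable_lne; exact: measurable_theta.
Qed.

Lemma theta_gap_ge0 s t : 0 <= theta_gap s t.
Proof.
rewrite /theta_gap; have := theta_ge0 r h0 s t; rewrite le_eqVlt => /orP[/eqP <-|T0].
  by rewrite le0_lneNy // leey.
rewrite lne_EFin // -EFinB lee_fin subr_ge0 -ler_expR lnK ?posrE //; exact: theta_le.
Qed.

Lemma theta_row_gt0 s t : (0 < t < 1)%R -> (0 < theta r h' s t)%R.
Proof.
move=> /andP[A A']; apply: theta_gt0 => //.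
by rewrite frac_id ?(ltW A) ?A' // (gt_eqF A).
Qed.

Lemma theta_gapE s t : (0 < t < 1)%R -> theta_gap s t = (B - ln (theta r h' s t))%:E.
Proof. by move=> t01; rewrite /theta_gap lne_EFin // theta_row_gt0. Qed.

(** The mean of log theta over a row is zero. By translation invariance n times
that mean is the mean of log theta for n tau, which is bounded in n. *)
Lemma theta_gap_row t : (0 < t < 1)%R -> \int[mu]_(s in U) theta_gap s t = B%:E.
Proof.
move=> t01; have [C [C0 HC]] := ln_theta_multiple r h0 t01.
have mW : measurable_fun [set: GR] (fun s : GR => theta_gap s t).
  exact: (measurable2_row t measurable_theta_gap).
have W0 s := theta_gap_ge0 s t.
set J := integral _ _ _.
have J0 : 0 <= J by apply: integral_ge0.
pose A n s : R := (n%:R * B - ln (theta (n%:R * r) (n%:R * h') (n%:R * s) t))%R.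
have sumE n s : (0 < n)%N -> \sum_(0 <= j < n) theta_gap (s + j%:R / n%:R)%R t = (A n s)%:E.
  move=> n0; rewrite /A -(prod_theta r h0) // ln_prod; last by move=> j _; exact: theta_row_gt0.
  under eq_bigr do rewrite theta_gapE //.
  rewrite sumEFin; congr (_%:E).
  by rewrite sumrB sumr_const_nat subn0 mulr_natl.
(* translation invariance turns n times the mean deficit into the mean of a sum *)
have avg n : (0 < n)%N -> \sum_(0 <= j < n) J = \int[mu]_(s in U) (A n s)%:E.
  move=> n0.
  have -> : \int[mu]_(s in U) (A n s)%:E =
     \int[mu]_(s in U) \sum_(0 <= j < n) theta_gap (s + j%:R / n%:R)%R t.
    by apply: eq_integral => s _; rewrite sumE.
  pose f (j : nat) (s : GR) := theta_gap (s + j%:R / n%:R)%R t.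
  have mf j : measurable_fun U (f j).
    by apply: measurable_funTS; apply: (measurableT_comp mW); exact: measurable_funD.
  have f0 j s : U s -> 0 <= f j s by move=> _; exact: W0.
  have := @ge0_integral_sum _ GR R mu U (@measurable_unit_itv R) nat f mf f0 (index_iota 0 n).
  move=> ->; apply: eq_bigr => j _.
  rewrite /f (@integral_period_shift _ (fun s : GR => theta_gap s t)) //.
  by move=> s; rewrite /theta_gap -[1%R]/(1%:~R) theta_periods.
have mA n : (0 < n)%N -> measurable_fun [set: GR] (fun s : GR => (A n s)%:E).
  move=> n0; apply: (eq_measurable_fun (fun s : GR => \sum_(0 <= j < n) theta_gap (s + j%:R / n%:R)%R t)).
    by move=> s _; rewrite sumE.
  apply: emeasurable_sum => j; apply: (measurableT_comp mW).
  exact: measurable_funD.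
have A0 n s : (0 < n)%N -> 0 <= (A n s)%:E.
  by move=> n0; rewrite -sumE // sume_ge0.
have up n : (0 < n)%N -> \int[mu]_(s in U) (A n s)%:E <= (n%:R * B + C)%:E.
  move=> n0; rewrite -[leRHS]integral_unit_cst; apply: ge0_le_integral => //.
  - exact: measurable_unit_itv.
  - by move=> s _; exact: A0.
  - by apply: measurable_funTS; exact: mA.
  - move=> s _; rewrite lee_fin lerD2l; have := HC n s n0; rewrite ler_norml => /andP[]; lra.
have lo n : (0 < n)%N -> (n%:R * B)%:E <= \int[mu]_(s in U) (A n s)%:E + C%:E.
  move=> n0; rewrite -[leLHS]integral_unit_cst -[X in _ + X]integral_unit_cst -ge0_integralD //.
  - apply: ge0_le_integral => //.
    + exact: measurable_unit_itv.
    + by move=> s _; rewrite lee_fin mulr_ge0 // decay_bound_ge0.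
    + apply: measurable_funTS; apply: emeasurable_funD => //; exact: mA.
    + by move=> s _; rewrite -EFinD lee_fin; have := HC n s n0; rewrite ler_norml /A => /andP[]; lra.
  - exact: measurable_unit_itv.
  - by move=> s _; exact: A0.
  - by apply: measurable_funTS; exact: mA.
(* the case n = 1 of the upper bound *)
have Jfin : J \is a fin_num.
  rewrite ge0_fin_numE //; have := up 1%N isT; rewrite -avg // big_nat1 => /le_lt_trans; apply.
  exact: ltry.
rewrite -(fineK Jfin); congr (_%:E); set j := fine J.
have jn n : (0 < n)%N -> (n%:R * `|j - B| <= C)%R.
  move=> n0; have := lo n n0; have := up n n0; rewrite -avg // -(fineK Jfin) -/j sumEFin.
  rewrite sumr_const_nat subn0 -[(j *+ n)%R]mulr_natl -EFinD !lee_fin => H1 H2.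
  have -> : (n%:R * `|j - B| = `|n%:R * (j - B)|)%R by rewrite normrM (ger0_norm (ler0n R n)).
  rewrite ler_norml mulrBr; apply/andP; split; lra.
apply/eqP; rewrite -subr_eq0 -normr_le0 leNgt; apply/negP => d0.
have := jn (Num.bound (C / `|j - B|)%R).+1 isT.
have := archi_boundP (divr_ge0 C0 (ltW d0)).
rewrite ltr_pdivrMr // -natr1 => H1 H2; move: d0 H1 H2; lra.
Qed.

Lemma mean_theta_gap : mean theta_gap = B%:E.
Proof.
rewrite /mean.
have mF : measurable_fun [set: GR] (fun t : GR => \int[mu]_(s in U) theta_gap s t).
  exact: (measurable2_rows measurable_theta_gap theta_gap_ge0).
rewrite -[RHS]integral_unit_cst /unit_itv.
rewrite (@integral_itv_bndoo R 0%R 1%R (fun t : GR => \int[mu]_(s in U) theta_gap s t) true true); last exact: measurable_funTS.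
rewrite (@integral_itv_bndoo R 0%R 1%R (fun t : GR => B%:E) true true); last exact: measurable_cst.
apply: eq_integral => t; rewrite inE /= in_itv /= => t01.
exact: theta_gap_row.
Qed.
End ThetaMean.

(** * The mean of log psi and the lower bound *)

Section PsiMean.
Variables (R : realType) (r h' : R).
Hypothesis h0 : h' != 0.
Notation mu := (@lebesgue_measure R).
Notation GR := (measurableTypeR R).
Notation U := (@unit_itv R).
Notation psi := (psi r h').
Definition psi_top : R := theta_bound h' + pi * habs h' / 12.
Lemma psi_top_ge0 : 0 <= psi_top.
Proof. by rewrite addr_ge0 ?decay_bound_ge0 // divr_ge0 // mulr_ge0 ?pi_ge0 // normr_ge0. Qed.
Local Open Scope ereal_scope.
Definition parabola (t : R) : R := (pi * habs h' * (frac t - 2^-1) ^+ 2)%R.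
Lemma parabola_ge0 t : (0 <= parabola t)%R.
Proof. by rewrite mulr_ge0 ?sqr_ge0 // mulr_ge0 ?pi_ge0 // normr_ge0. Qed.

Lemma parabolaE t : parabola t = (pi * habs h' * (bern t + 12^-1))%R.
Proof. by rewrite /parabola /bern; congr (_ * _)%R; field. Qed.

Lemma measurable_parabola : measurable_fun [set: GR] (fun t : GR => parabola t).
Proof.
apply: (eq_measurable_fun (fun t : GR => pi * habs h' * (bern (t : R) + 12^-1))%R).
  by move=> t _; rewrite parabolaE.
apply: measurable_funM => //; apply: measurable_funD => //; exact: measurable_bern.
Qed.

Lemma integral_parabola : \int[mu]_(t in U) (parabola t)%:E = (pi * habs h' / 12)%:E.
Proof.
pose f (t : R) : R := (pi * habs h' * (t - 2^-1) ^+ 2)%R.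
pose F (t : R) : R := (pi * habs h' / 3 * (t - 2^-1) ^+ 3)%R.
have dF (t : R) : is_derive t (1%R : R) F (f t).
  rewrite /F; apply: is_derive_eq.
  by rewrite /f /GRing.scale /=; field.
have cf : continuous f.
  move=> t; apply: differentiable_continuous; apply/derivable1_diffP.
  by apply: ex_derive.
have -> : (pi * habs h' / 12)%:E = (F 1%R)%:E - (F 0%R)%:E.
  by rewrite -EFinB /F; congr (_%:E); field.
rewrite -(@continuous_FTC2 R f F 0%R 1%R) //; last 3 first.
- exact: continuous_subspaceT.
- split.
  + by move=> t _; apply: ex_derive.
  + apply: cvg_at_right_filter; apply: differentiable_continuous; apply/derivable1_diffP; exact: ex_derive.
  + apply: cvg_at_left_filter; apply: differentiable_continuous; apply/derivable1_diffP; exact: ex_derive.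
- by move=> t _; rewrite derive1E; apply: derive_val.
have mf : measurable_fun setT (fun t : GR => (f t)%:E).
  by apply/measurable_EFinP; exact: continuous_measurable_fun.
have mp : measurable_fun setT (fun t : GR => (parabola t)%:E).
  by apply/measurable_EFinP; exact: measurable_parabola.
rewrite /unit_itv (@integral_itv_bndoo R 0%R 1%R _ true false); last exact: measurable_funTS.
rewrite (@integral_itv_bndoo R 0%R 1%R _ true true); last exact: measurable_funTS.
apply: eq_integral => t; rewrite inE /= in_itv /= => /andP[t0 t1].
by rewrite /parabola frac_id ?(ltW t0) ?t1.
Qed.

(** The deficit of log psi below its upper bound; its mean equals the bound exactly
when log psi has mean zero. *)
Definition psi_gap (s t : R) : \bar R := psi_top%:E - lne (psi s t)%:E.

(** B(t) + 1/12 = (t - 1/2)^2 on [0, 1). *)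
Lemma psi_gapE s t : psi_gap s t = theta_gap r h' s t + (parabola t)%:E.
Proof.
rewrite /psi_gap /theta_gap; have := theta_ge0 r h0 s t; rewrite le_eqVlt => /orP[/eqP E|T0].
  by rewrite /psi -E mulr0 !le0_lneNy.
rewrite !lne_EFin ?mulr_gt0 ?expR_gt0 // lnM ?posrE ?expR_gt0 // expRK -!EFinB -EFinD.
by rewrite parabolaE /psi_top; congr (_%:E); field.
Qed.

Lemma measurable_psi_gap : measurable2 psi_gap.
Proof.
apply: emeasurable_funB; first exact: measurable_cst.
by apply: measurable_lne; exact: measurable_psi.
Qed.

Lemma psi_gap_ge0 s t : 0 <= psi_gap s t.
Proof. by rewrite psi_gapE adde_ge0 ?theta_gap_ge0 // lee_fin parabola_ge0. Qed.

Lemma mean_psi_gap : mean psi_gap = psi_top%:E.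
Proof.
have mp : measurable2 (fun s t => (parabola t)%:E).
  by apply/measurable_EFinP; apply: (measurableT_comp measurable_parabola); exact: measurable_snd.
have p0 (s t : R) : 0 <= (parabola t)%:E by rewrite lee_fin parabola_ge0.
have -> : mean psi_gap = mean (fun s t => theta_gap r h' s t + (parabola t)%:E).
  by apply: eq_integral => t _; apply: eq_integral => s _; rewrite psi_gapE.
rewrite (meanD (measurable_theta_gap r h0) (theta_gap_ge0 r h0) mp p0) mean_theta_gap // [RHS]EFinD.
congr (_ + _); rewrite /mean -integral_parabola.
by apply: eq_integral => t _; rewrite integral_unit_cst.
Qed.

Lemma mean_psi_gap_shift a c : mean (fun s t => psi_gap (s + a) (t + c))%R = psi_top%:E.
Proof.
have pp s t (m n : int) : psi_gap (s + m%:~R)%R (t + n%:~R)%R = psi_gap s t.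
  by rewrite /psi_gap psi_period.
have P1 s t : psi_gap (s + 1)%R t = psi_gap s t by have := pp s t 1%Z 0%Z; rewrite addr0.
have P2 s t : psi_gap s (t + 1)%R = psi_gap s t by have := pp s t 0%Z 1%Z; rewrite addr0.
by rewrite (mean_shift a c measurable_psi_gap psi_gap_ge0 P1 P2); exact: mean_psi_gap.
Qed.

Lemma measurable2_shift (G : R -> R -> \bar R) a c : measurable2 G -> measurable2 (fun s t => G (s + a) (t + c))%R.
Proof.
move=> mG; rewrite /measurable2.
rewrite (_ : (fun q : GR * GR => _) = (fun q : GR * GR => G q.1 q.2) \o (fun q : GR * GR => ((q.1 + a)%R, (q.2 + c)%R) : GR * GR)) //.
apply: (measurableT_comp mG); apply: measurable_fun_pair.
  have : measurable_fun [set: GR * GR] (fun q : GR * GR => (q.1 + a)%R : R) by apply: measurable_funD.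
  by [].
have : measurable_fun [set: GR * GR] (fun q : GR * GR => (q.2 + c)%R : R) by apply: measurable_funD.
by [].
Qed.

Lemma mean_sum (I : Type) (l : seq I) (F : I -> R -> R -> \bar R) :
  (forall i, measurable2 (F i)) -> (forall i s t, 0 <= F i s t) ->
  mean (fun s t => \sum_(i <- l) F i s t) = \sum_(i <- l) mean (F i).
Proof.
move=> mF F0; elim: l => [|i l IH].
  rewrite big_nil -[RHS]mean_cst; apply: eq_integral => t _; apply: eq_integral => s _.
  by rewrite big_nil.
have mS : measurable2 (fun s t => \sum_(i <- l) F i s t).
  by apply: emeasurable_sum => j; exact: mF.
have S0 s t : 0 <= \sum_(i <- l) F i s t by apply: sume_ge0.
rewrite big_cons -IH -(meanD (mF i) (F0 i) mS S0).
by apply: eq_integral => t _; apply: eq_integral => s _; rewrite big_cons.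
Qed.

Lemma measurable_psi_power (I : eqType) (l : seq I) (a c : I -> R) (beta : R) :
  measurable2 (fun s t => ((\prod_(i <- l) psi (s + a i) (t + c i)) `^ beta)%:E)%R.
Proof.
apply/measurable_EFinP; apply: (measurableT_comp (@measurable_powR R beta)).
apply: measurable_prod => i _.
have := @measurable2_shift (fun s t => (psi s t)%:E) (a i) (c i).
rewrite /measurable2 => H; apply/measurable_EFinP; apply: H.
by apply/measurable_EFinP; exact: measurable_psi.
Qed.

(** Pointwise e^x >= 1 + x for x the logarithm of the integrand. To integrate with
nonnegative functions only, both sides are augmented by the deficits of the
logarithms, whose mean is known. *)
Lemma mean_psi_power_ge1 (I : eqType) (l : seq I) (a c : I -> R) (beta : R) : (0 < beta)%R ->
  1 <= mean (fun s t => ((\prod_(i <- l) psi (s + a i) (t + c i)) `^ beta)%:E)%R.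
Proof.
move=> b0; set P := (fun s t => _).
pose V i s t := psi_gap (s + a i)%R (t + c i)%R.
have mV i : measurable2 (V i) by apply: measurable2_shift; exact: measurable_psi_gap.
have V0 i s t : 0 <= V i s t by exact: psi_gap_ge0.
pose bV i s t := beta%:E * V i s t.
have mbV i : measurable2 (bV i) by apply: measurable_funeM; exact: mV.
have bV0 i s t : 0 <= bV i s t by rewrite mule_ge0 // lee_fin ltW.
pose S := (\sum_(i <- l) beta * psi_top)%R.
have S0 : (0 <= S)%R by apply: sumr_ge0 => i _; rewrite mulr_ge0 ?psi_top_ge0 // ltW.
have P0 s t : 0 <= P s t by rewrite lee_fin powR_ge0.
have mP : measurable2 P by exact: measurable_psi_power.
have key s t : (1 + S)%:E <= P s t + \sum_(i <- l) bV i s t.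
  have [/allP A|/allPn[i il Pi]] := boolP (all (fun i => 0 < psi (s + a i) (t + c i))%R l).
    have E i : i \in l -> bV i s t = (beta * psi_top - beta * ln (psi (s + a i) (t + c i)))%:E.
      by move=> il; rewrite /bV /V /psi_gap lne_EFin ?A // -EFinB -EFinM mulrBr.
    rewrite [X in _ + X](eq_big_seq _ E) sumEFin -EFinD lee_fin sumrB -/S -mulr_sumr -ln_prod //.
    rewrite /powR gt_eqF; last by rewrite big_seq prodr_gt0.
    set x := ln _; have := expR_ge1Dx (beta * x); lra.
  (* a vanishing factor has infinite deficit *)
  have V1 : bV i s t = +oo.
    rewrite /bV /V /psi_gap le0_lneNy; last by rewrite lee_fin leNgt.
    by rewrite /= gt0_muley // lte_fin.
  rewrite (big_rem i) //= V1 addye; first by rewrite addey // leey.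
  by rewrite gt_eqF // (lt_le_trans ltNy0) // sume_ge0.
have mS : measurable2 (fun s t => \sum_(i <- l) bV i s t) by apply: emeasurable_sum.
have S0' s t : 0 <= \sum_(i <- l) bV i s t by apply: sume_ge0.
have mPS : measurable2 (fun s t => P s t + \sum_(i <- l) bV i s t) by apply: emeasurable_funD.
have S1 : (0 <= 1 + S)%R by rewrite addr_ge0.
have := @mean_le _ (fun _ _ => (1 + S)%:E) _ (measurable_cst _) mPS (fun _ _ => S1) key.
rewrite mean_cst (meanD mP P0 mS S0') mean_sum //.
have -> : \sum_(i <- l) mean (bV i) = S%:E.
  rewrite -sumEFin; apply: eq_bigr => i _.
  by rewrite (meanZ (ltW b0) (mV i) (V0 i)) mean_psi_gap_shift.
by rewrite EFinD leeD2rE.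
Qed.
End PsiMean.

(** * Primitives of the Bernoulli polynomial and of exponential decay *)

Section Primitives.
Variable R : realType.

(** The third Bernoulli polynomial divided by 3, extended periodically. *)
Definition bern_prim (x : R) : R := let f := frac x in f ^+ 3 / 3 - f ^+ 2 / 2 + f / 6.
Lemma bern_prim_int x (m : int) : bern_prim (x + m%:~R) = bern_prim x.
Proof. by rewrite /bern_prim frac_int. Qed.

(** For t^2 - t + 1/6 the mean over a cell is the value at the midpoint plus w^2 / 3.
Where the
cell crosses an integer, the periodic function B lies below the polynomial that
continues it from the centre, as the signs of the two squares show. *)
Lemma bern_prim_cell (x w : R) : 0 <= w <= 2^-1 ->
  bern_prim (x + w) - bern_prim (x - w) <= 2 * w * (bern x + w ^+ 2 / 3).
Proof.
move=> /andP[w0 w1]; rewrite (fracE x) bern_int.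
have -> (m : int) : frac x + m%:~R + w = frac x + w + m%:~R by ring.
have -> (m : int) : frac x + m%:~R - w = frac x - w + m%:~R by ring.
rewrite !bern_prim_int; have := frac_itv x; move: (frac x) => f f01.
rewrite /bern (frac_id f01); case/andP: f01 => f0 f1.
pose p (y : R) := y ^+ 3 / 3 - y ^+ 2 / 2 + y / 6.
have up : bern_prim (f + w) <= p (f + w).
  have [z1|z1] := ltP (f + w) 1; first by rewrite /bern_prim frac_id ?z1 ?andbT ?addr_ge0.
  have -> : bern_prim (f + w) = p (f + w - 1).
    rewrite -[f + w in LHS](subrK 1) -[X in _ + X]/(1%:~R) bern_prim_int /bern_prim frac_id //.
    by apply/andP; split; lra.
  have -> : p (f + w) = p (f + w - 1) + (f + w - 1) ^+ 2 by rewrite /p; field.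
  by rewrite lerDl sqr_ge0.
have lo : p (f - w) <= bern_prim (f - w).
  have [z1|z1] := leP 0 (f - w).
    by rewrite /bern_prim frac_id // z1 /=; lra.
  have -> : bern_prim (f - w) = p (f - w + 1).
    rewrite -[f - w in LHS](addrK 1) -[X in _ - X]/(1%:~R) -mulrNz bern_prim_int /bern_prim frac_id //.
    by apply/andP; split; lra.
  have -> : p (f - w + 1) = p (f - w) + (f - w) ^+ 2 by rewrite /p; field.
  by rewrite lerDl sqr_ge0.
have -> : 2 * w * (f ^+ 2 - f + 6^-1 + w ^+ 2 / 3) = p (f + w) - p (f - w) by rewrite /p; field.
by rewrite lerB.
Qed.

(** The primitive of exp(- |x|) that vanishes at 0. *)
Definition decay_prim (x : R) : R := if 0 <= x then 1 - expR (- x) else expR x - 1.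
Lemma decay_prim_le1 x : `|decay_prim x| <= 1.
Proof.
rewrite /decay_prim ler_norml; case: (leP 0 x) => x0; apply/andP; split.
- have : expR (- x) <= 1 by rewrite expR_le1 oppr_le0.
  lra.
- have := expR_ge0 (- x); lra.
- have := expR_ge0 x; lra.
- have : expR x <= 1 by rewrite expR_le1 ltW.
  lra.
Qed.

(** The integral over [p, q] is at least the length times exp(- M), a lower bound
of the integrand. *)
Lemma decay_prim_cell (p q M : R) : p <= q -> `|p| <= M -> `|q| <= M ->
  (q - p) * expR (- M) <= decay_prim q - decay_prim p.
Proof.
move=> pq pM qM.
have inc (u v : R) : u <= v -> - M <= u -> (v - u) * expR (- M) <= expR v - expR u.
  move=> uv Mu; have -> : expR v - expR u = expR u * (expR (v - u) - 1).
    by rewrite mulrBr mulr1 -expRD [u + _]addrC subrK.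
  rewrite mulrC; apply: ler_pM; rewrite ?expR_ge0 ?subr_ge0 ?ler_expR //.
  have := expR_ge1Dx (v - u); lra.
move: pM qM; rewrite !ler_norml => /andP[p1 p2] /andP[q1 q2].
rewrite /decay_prim; case: (leP 0 q) => q0; case: (leP 0 p) => p0.
- have := inc (- q) (- p); rewrite lerN2 => /(_ pq); lra.
- have := inc (- q) 0; rewrite expR0 => /(_ ltac:(lra) ltac:(lra)).
  have := inc p 0; rewrite expR0 => /(_ ltac:(lra) ltac:(lra)).
  by rewrite !sub0r opprK mulrBl mulNr; lra.
- lra.
- have := inc p q pq p1; lra.
Qed.
End Primitives.

(** * Points arranged in equally spaced rows *)

Section RowPoints.
Variables (R : realType) (r h' : R).
Hypothesis h0 : h' != 0.
Notation h := (habs h').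
Variables (N k : nat).
Hypotheses (k0 : (0 < k)%N) (kN : (k * k <= N)%N) (Nk : (N <= 4 * (k * k))%N) (Nk3 : (N < k * (k + 3))%N).

(** Rounding i N / k down gives rows of almost equal sizes with sum exactly N. *)
Definition cut (i : nat) : nat := (i * N) %/ k.
Definition row_size (i : nat) : nat := cut i.+1 - cut i.
Lemma cut_le i : (cut i <= cut i.+1)%N.
Proof. by apply: leq_div2r; rewrite leq_mul2r leqnSn orbT. Qed.

Lemma row_size_ge i : (k <= row_size i)%N.
Proof.
rewrite /row_size leq_subRL ?cut_le // /cut mulSn leq_divRL // mulnDl addnC.
by apply: leq_add; [|exact: leq_trunc_div].
Qed.

Lemma row_size_le i : (row_size i <= 4 * k)%N.
Proof.
rewrite /row_size leq_subLR /cut -ltnS ltn_divLR // mulSn.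
have : (i * N < (i * N %/ k).+1 * k)%N by rewrite -ltn_divLR.
move: (i * N)%N (i * N %/ k)%N Nk3 k0 => a c; clear; nia.
Qed.

Lemma cut0 : cut 0 = 0%N. Proof. by rewrite /cut mul0n div0n. Qed.

Lemma cutk : cut k = N. Proof. by rewrite /cut mulKn. Qed.

Lemma sum_row_size : (\sum_(0 <= i < k) row_size i = N)%N.
Proof.
rewrite /row_size; have -> : N = (cut k - cut 0)%N by rewrite cut0 cutk subn0.
by rewrite telescope_sumn_in // => i _; exact: cut_le.
Qed.

Definition edge (i : nat) : R := (cut i)%:R / N%:R.

(** The midpoint of the cell, for the second-order accuracy of the midpoint rule. *)
Definition row_height (i : nat) : R := (edge i + edge i.+1) / 2.
Definition half_width (i : nat) : R := (row_size i)%:R / (2 * N%:R).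
Lemma N_gt0 : 0 < N%:R :> R.
Proof. by rewrite ltr0n (leq_trans _ kN) // muln_gt0 k0. Qed.

Lemma edgeE i : edge i = row_height i - half_width i.
Proof.
rewrite /row_height /half_width /edge /row_size natrB ?cut_le //; field.
by rewrite gt_eqF // N_gt0.
Qed.

Lemma edgeSE i : edge i.+1 = row_height i + half_width i.
Proof.
rewrite /row_height /half_width /edge /row_size natrB ?cut_le //; field.
by rewrite gt_eqF // N_gt0.
Qed.

Lemma half_width_itv i : (i < k)%N -> 0 <= half_width i <= 2^-1.
Proof.
move=> ik; have N0 := N_gt0; have N20 : 0 < 2 * N%:R :> R by rewrite mulr_gt0.
rewrite /half_width divr_ge0 ?(ltW N20) //= ler_pdivrMr // mulrA mulVf ?pnatr_eq0 // mul1r ler_nat.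
have := sum_row_size; rewrite (bigD1_seq i) ?mem_index_iota ?iota_uniq //=.
by move=> <-; rewrite leq_addr.
Qed.

Lemma row_sizeE i : (row_size i)%:R = 2 * N%:R * half_width i.
Proof. by rewrite /half_width; field; rewrite gt_eqF // N_gt0. Qed.

(** Each term is bounded by N times the increment of a primitive over the cell of
the row; the increments telescope over a period to 0. The midpoint errors sum to
a constant since the cells have length of order N^(-1/2). *)
Lemma sum_bern t : - (\sum_(0 <= i < k) (row_size i)%:R * bern (t - row_height i)) <= 4 / 3.
Proof.
have N0 := N_gt0.
have cell i : (0 <= i < k)%N -> - ((row_size i)%:R * bern (t - row_height i)) <=
   N%:R * (bern_prim (t - edge i.+1) - bern_prim (t - edge i)) + (row_size i)%:R * (4 * k%:R ^+ 2 / (3 * N%:R ^+ 2)).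
  move=> /andP[_ ik].
  have w01 := half_width_itv ik.
  have := bern_prim_cell (t - row_height i) w01.
  have -> : t - row_height i + half_width i = t - edge i by rewrite edgeE; ring.
  have -> : t - row_height i - half_width i = t - edge i.+1 by rewrite edgeSE; ring.
  set A := bern_prim _; set B := bern_prim _; set b := bern _; set w := half_width i => H.
  (* the cell has length 2 w = n_i / N with n_i <= 4 k *)
  have nw : (row_size i)%:R = 2 * N%:R * w by exact: row_sizeE.
  have n4 : (row_size i)%:R <= 4 * k%:R :> R by rewrite -[4]/(4%:R) -natrM ler_nat row_size_le.
  have w2 : w ^+ 2 / 3 <= 4 * k%:R ^+ 2 / (3 * N%:R ^+ 2).
    have -> : w ^+ 2 / 3 = ((row_size i)%:R / 2) ^+ 2 / (3 * N%:R ^+ 2).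
      by rewrite nw; field; rewrite gt_eqF.
    rewrite ler_wpM2r ?invr_ge0 ?mulr_ge0 ?sqr_ge0 //.
    have -> : 4 * k%:R ^+ 2 = (2 * k%:R) ^+ 2 :> R by ring.
    rewrite ler_sqr ?nnegrE ?mulr_ge0 ?invr_ge0 //; lra.
  have : N%:R * (A - B) <= (row_size i)%:R * (b + w ^+ 2 / 3).
    have -> : (row_size i)%:R * (b + w ^+ 2 / 3) = N%:R * (2 * w * (b + w ^+ 2 / 3)) by rewrite nw; ring.
    by rewrite ler_pM2l.
  have : (row_size i)%:R * (w ^+ 2 / 3) <= (row_size i)%:R * (4 * k%:R ^+ 2 / (3 * N%:R ^+ 2)) by rewrite ler_wpM2l.
  rewrite mulrDr; lra.
rewrite -sumrN big_nat; apply: le_trans (ler_sum _ cell) _.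
rewrite -big_nat big_split /= -mulr_sumr telescope_sumr //.
have -> : bern_prim (t - edge k) - bern_prim (t - edge 0) = 0.
  rewrite /edge cut0 cutk divff ?gt_eqF // mul0r subr0.
  by have := bern_prim_int t (-1); rewrite mulrNz => ->; rewrite subrr.
rewrite mulr0 add0r -mulr_suml -natr_sum sum_row_size.
have -> : N%:R * (4 * k%:R ^+ 2 / (3 * N%:R ^+ 2)) = 4 / 3 * (k%:R ^+ 2 / N%:R) :> R by field; rewrite gt_eqF.
rewrite ler_piMr // ler_pdivrMr // mul1r -natrX ler_nat.
by rewrite expnS expn1.
Qed.

(** Each term is bounded by a constant times the increment of a primitive over the
cell of the row translated by m, because the cells have length at least of order
1/k and the exponential varies by a bounded factor on each. The translated cells
tile the line, and the primitive is bounded by 1. *)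
Lemma sum_decay t M : \sum_(0 <= i < k) \sum_(m <- zrange M) row_decay ((row_size i)%:R * h') (t - row_height i) m
  <= 4 / (pi * h) * expR (4 * pi * h).
Proof.
have N0 := N_gt0; have hp : 0 < h by exact: habs_gt0.
have pi0 := pi_gt0 R.
have K0 : 0 < k%:R :> R by rewrite ltr0n.
(* every row has at least k points, so its exponentials decay at rate a or faster *)
pose a : R := 2 * pi * h * k%:R.
have a0 : 0 < a by rewrite !mulr_gt0.
have kk : k%:R ^+ 2 <= N%:R :> R by rewrite -natrX ler_nat expnS expn1.
have k4 : N%:R <= 4 * k%:R ^+ 2 :> R by rewrite -natrX -[4]/(4%:R) -natrM ler_nat expnS expn1.
pose g i (m : int) := decay_prim (a * (t - edge i + m%:~R)).
have cell i (m : int) : row_decay ((row_size i)%:R * h') (t - row_height i) m <=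
   2 / (pi * h) * expR (4 * pi * h) * (g i m - g i.+1 m).
  set x := t - row_height i + m%:~R; set w := half_width i.
  have gk : k%:R <= (row_size i)%:R :> R by rewrite ler_nat row_size_ge.
  have n4 : (row_size i)%:R <= 4 * k%:R :> R by rewrite -[4]/(4%:R) -natrM ler_nat row_size_le.
  have nw : (row_size i)%:R = 2 * N%:R * w by exact: row_sizeE.
  have w0 : 0 <= w by rewrite /w /half_width divr_ge0.
  have -> : g i m = decay_prim (a * (x + w)) by rewrite /g edgeE; congr decay_prim; rewrite /x /w; ring.
  have -> : g i.+1 m = decay_prim (a * (x - w)) by rewrite /g edgeSE; congr decay_prim; rewrite /x /w; ring.
  have aw : a * w <= 4 * pi * h.
    have -> : a * w = pi * h * (k%:R * (row_size i)%:R / N%:R).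
      by rewrite nw /a; field; rewrite gt_eqF.
    have -> : 4 * pi * h = pi * h * 4 by move: (pi : R) => P; ring.
    rewrite ler_pM2l ?mulr_gt0 // ler_pdivrMr //.
    apply: (@le_trans _ _ (k%:R * (4 * k%:R))); first by rewrite ler_pM2l.
    by move: kk; rewrite expr2; lra.
  have aw2 : pi * h / 2 <= 2 * (a * w).
    have -> : 2 * (a * w) = 2 * (pi * h) * (k%:R * (row_size i)%:R / N%:R).
      by rewrite nw /a; field; rewrite gt_eqF.
    have -> : pi * h / 2 = 2 * (pi * h) * 4^-1 by field.
    rewrite ler_pM2l ?mulr_gt0 // ler_pdivlMr //.
    apply: (@le_trans _ _ (k%:R * k%:R)); last by rewrite ler_pM2l.
    by move: k4; rewrite expr2; lra.
  have bd (e : R) : `|e| <= w -> `|a * (x + e)| <= a * `|x| + 4 * pi * h.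
    move=> ew; rewrite normrM (gtr0_norm a0).
    apply: (@le_trans _ _ (a * (`|x| + w))); last by rewrite mulrDr lerD2l.
    by rewrite ler_pM2l //; apply: le_trans (ler_normD _ _) _; rewrite lerD2l.
  have := @decay_prim_cell R (a * (x - w)) (a * (x + w)) (a * `|x| + 4 * pi * h).
  move=> /(_ _ _ _) H; have {H} := H _ (bd (- w) _) (bd w _).
  rewrite normrN (ger0_norm w0) lexx ler_pM2l // => /(_ ltac:(lra) isT isT).
  set D := decay_prim _ - decay_prim _ => H.
  have kd : row_decay ((row_size i)%:R * h') (t - row_height i) m <= expR (- (a * `|x|)).
    rewrite ler_expR lerN2 -/x ler_wpM2r // /a /habs normrM (ger0_norm (ler0n _ _)).
    rewrite -/(habs h') [(row_size i)%:R * _]mulrC mulrA ler_pM2l //.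
    by rewrite !mulr_gt0.
  apply: le_trans kd _.
  have -> : expR (- (a * `|x|)) = 2 / (pi * h) * expR (4 * pi * h) * (pi * h / 2 * expR (- (a * `|x| + 4 * pi * h))).
    rewrite opprD expRD [expR (- (4 * pi * h))]expRN.
    move: (expR_gt0 (4 * pi * h)); move: (expR (4 * pi * h)) (expR (- (a * _))) => E F E0.
    move: pi0; move: (pi : R) => P P0.
    by field; rewrite (gt_eqF E0) (gt_eqF P0) (gt_eqF hp).
  rewrite ler_wpM2l ?mulr_ge0 ?expR_ge0 ?invr_ge0 ?mulr_ge0 ?(ltW pi0) ?(ltW hp) //.
  apply: le_trans H; rewrite ler_wpM2r ?expR_ge0 //.
  have -> : a * (x + w) - a * (x - w) = 2 * (a * w) by ring.
  by [].
apply: (@le_trans _ _ (\sum_(0 <= i < k) \sum_(m <- zrange M) (2 / (pi * h) * expR (4 * pi * h) * (g i m - g i.+1 m)))).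
  by apply: ler_sum => i _; apply: ler_sum => m _.
rewrite exchange_big /=.
have row m : \sum_(0 <= i < k) 2 / (pi * h) * expR (4 * pi * h) * (g i m - g i.+1 m) =
   2 / (pi * h) * expR (4 * pi * h) * (decay_prim (a * (t + m%:~R)) - decay_prim (a * (t - 1 + m%:~R))).
  rewrite -mulr_sumr; congr (_ * _).
  have -> : \sum_(0 <= i < k) (g i m - g i.+1 m) = - \sum_(0 <= i < k) (g i.+1 m - g i m).
    by rewrite -sumrN; apply: eq_bigr => i _; rewrite opprB.
  by rewrite telescope_sumr // opprB /g /edge cut0 cutk divff ?gt_eqF // mul0r subr0.
under eq_bigr do rewrite row.
rewrite -mulr_sumr.
have -> : \sum_(m <- zrange M) (decay_prim (a * (t + m%:~R)) - decay_prim (a * (t - 1 + m%:~R))) =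
   decay_prim (a * (t + M%:R)) - decay_prim (a * (t - 1 - M%:R)).
  elim: M => [|M' IH]; first by rewrite /= big_seq1 !addr0 subr0.
  rewrite big_zrangeS /= IH !mulrNz -!pmulrn.
  have -> : t - 1 + M'.+1%:R = t + M'%:R by rewrite -natr1; ring.
  have -> : t - M'.+1%:R = t - 1 - M'%:R by rewrite -natr1; ring.
  by ring.
have -> : 4 / (pi * h) * expR (4 * pi * h) = 2 / (pi * h) * expR (4 * pi * h) * 2 by ring.
rewrite ler_wpM2l ?mulr_ge0 ?expR_ge0 ?invr_ge0 ?mulr_ge0 ?(ltW pi0) ?(ltW hp) //.
have := decay_prim_le1 (a * (t + M%:R)); have := decay_prim_le1 (a * (t - 1 - M%:R)).
by rewrite !ler_norml => /andP[A1 A2] /andP[B1 B2]; lra.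
Qed.

Definition row_bound : R := pi * h * (4 / 3) + 4 / (pi * h) * expR (4 * pi * h).
Lemma row_bound_gt0 : 0 < row_bound.
Proof.
have hp : 0 < h by exact: habs_gt0.
by rewrite addr_gt0 // !mulr_gt0 ?invr_gt0 ?mulr_gt0 ?expR_gt0 ?pi_gt0.
Qed.

(** A row of n points is, by the multiplication formula, one theta product for
n tau, with factors at most 1 + x <= exp(x). *)
Lemma prod_psi_rows s t :
  \prod_(0 <= i < k) \prod_(0 <= j < row_size i) psi r h' (s + j%:R / (row_size i)%:R) (t - row_height i)
  <= expR row_bound.
Proof.
have n0 i : (0 < row_size i)%N by exact: leq_trans k0 (row_size_ge i).
have nh0 i : (row_size i)%:R * h' != 0 by rewrite mulf_neq0 // pnatr_eq0 -lt0n.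
pose T i := theta ((row_size i)%:R * r) ((row_size i)%:R * h') ((row_size i)%:R * s) (t - row_height i).
have rowE i : \prod_(0 <= j < row_size i) psi r h' (s + j%:R / (row_size i)%:R) (t - row_height i) =
   expR (- (pi * h * ((row_size i)%:R * bern (t - row_height i)))) * T i.
  rewrite big_split /= prod_theta //; congr (_ * _).
  by rewrite prodr_const_nat subn0 -expRM_natl; congr expR; ring.
under eq_bigr do rewrite rowE.
rewrite big_split /= -expR_sum sumrN -mulr_sumr expRD; apply: ler_pM.
- exact: expR_ge0.
- by apply: prodr_ge0 => i _; exact: theta_ge0.
- rewrite ler_expR -mulrN ler_wpM2l ?mulr_ge0 ?pi_ge0 ?normr_ge0 //; exact: sum_bern.
have mc : continuous (fun x : R * R => x.1 * x.2) by move=> x; exact: mul_continuous.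
have c : (fun M => \prod_(0 <= i < k) theta_n ((row_size i)%:R * r) ((row_size i)%:R * h') ((row_size i)%:R * s) (t - row_height i) M)
    @ \oo --> \prod_(0 <= i < k) T i.
  by apply: (cvg_big mc) => i _; exact: theta_cvg.
rewrite -(cvg_lim _ c) //; apply: limr_le; first by apply/cvg_ex; eexists; exact: c.
near=> M; apply: le_trans (_ : expR (\sum_(0 <= i < k) \sum_(m <- zrange M) row_decay ((row_size i)%:R * h') (t - row_height i) m) <= _).
  rewrite expR_sum; apply: ler_prod => i _; rewrite theta_n_ge0 /= expR_sum.
  apply: ler_prod => m _; rewrite row_factor_ge0 /=; apply: le_trans (row_factor_le _ _ _ _ _) _.
  exact: expR_ge1Dx.
rewrite ler_expR; exact: sum_decay.
Unshelve. all: by end_near.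
Qed.

(** The entries are the translations to be applied to psi, which are the opposites
of the positions of the points. *)
Definition row_points : seq (R * R) :=
  flatten [seq [seq (j%:R / (row_size i)%:R, - row_height i) | j <- index_iota 0 (row_size i)] | i <- index_iota 0 k].
Lemma size_row_points : size row_points = N.
Proof.
rewrite size_flatten sumnE /shape -map_comp big_map -[RHS]sum_row_size.
by apply: eq_bigr => i _ /=; rewrite size_map size_iota subn0.
Qed.

Lemma prod_row_points s t : \prod_(p <- row_points) psi r h' (s + p.1) (t + p.2) <= expR row_bound.
Proof.
rewrite big_flatten big_map; apply: le_trans (prod_psi_rows s t).
by under eq_bigr do rewrite big_map.
Qed.
End RowPoints.

Section GoodConfiguration.
Variables (R : realType) (r h' : R).
Hypothesis h0 : h' != 0.

(** k is the integer part of the square root. *)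
Lemma square_root_bounds N : (0 < N)%N -> exists k : nat,
  [/\ (0 < k)%N, (k * k <= N)%N, (N <= 4 * (k * k))%N & (N < k * (k + 3))%N].
Proof.
move=> N0; have [|k kN kmax] := @ex_maxnP (fun k => k * k <= N)%N N (ex_intro _ 1%N N0).
  move=> k; case: k => // k; nia.
have k0 : (0 < k)%N by exact: kmax.
have : (N < k.+1 * k.+1)%N by rewrite ltnNge; apply/negP => /kmax; rewrite ltnn.
exists k; split => //; nia.
Qed.

Lemma good_configuration N : (0 < N)%N -> exists p : 'I_N -> R * R, forall s t,
  \prod_(i < N) psi r h' (s + (p i).1) (t + (p i).2) <= expR (row_bound h').
Proof.
move=> N0; have [k [k0 kN Nk Nk3]] := square_root_bounds N0.
exists (fun i => nth (0, 0) (row_points R N k) i) => s t.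
apply: le_trans (prod_row_points r h0 k0 kN Nk Nk3 s t).
by rewrite (big_nth (0, 0)) (size_row_points R N k0) big_mkord.
Qed.
End GoodConfiguration.

(** * The Green function and the packing number *)

Section Green.
Variables (R : realType) (L : set R[i]).
Notation GR := (measurableTypeR R).
Let b := basis_of_lattice L.
Hypothesis isL : is_lattice L.
Hypothesis covol : `|basis_det b| = pi / 2.
Let r := tau_re b.
Let h' := tau_im b.
Let indep := (basis_of_latticeP isL).1.
Let h0 : h' != 0. Proof. exact: tau_im_neq0 indep. Qed.
Let C0 := scale_const b.
Let C0_gt0 : 0 < C0. Proof. exact: (scale_const_gt0 (basis_of_latticeP isL)). Qed.
Local Open Scope ereal_scope.
Lemma lne_scale (x : R) : (0 <= x)%R -> lne (C0 * x)%:E = (ln C0)%:E + lne x%:E.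
Proof.
rewrite le_eqVlt => /orP[/eqP <-|x0]; first by rewrite mulr0 !le0_lneNy // addeNy.
rewrite (lne_EFin x0) (lne_EFin (mulr_gt0 C0_gt0 x0)) lnM ?posrE // EFinD.
Qed.

Lemma normalize_torus : (2 / pi)%R%:E * `|basis_det b|%:E = 1.
Proof.
rewrite covol -EFinM; congr (_%:E); move: (pi : R) (pi_gt0 R) => P P0.
by field; rewrite gt_eqF.
Qed.

(** The logarithm of psi has mean zero, so the mean of log(C0 psi) is log C0. *)
Lemma green_constE : green_const L = (ln C0)%:E.
Proof.
pose c := (ln C0 + psi_top h')%R.
pose V z := c%:E - log_sigma_star L z.
have VE s t : V (pt b s t) = psi_gap r h' s t.
  rewrite /V /psi_gap log_sigma_star_formula // lne_scale; last exact: psi_ge0.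
  rewrite /c [in LHS]EFinD; case: (lne _) => [x| |] //=.
  by rewrite -!EFinD; congr (_%:E); ring.
have mF := measurable_parallelogram isL.
have tV : torus_integral L V = `|basis_det b|%:E * (psi_top h')%:E.
  rewrite (torus_integralE isL VE) ?mean_psi_gap //.
  - exact: measurable_psi_gap.
  - exact: psi_gap_ge0.
have mV : measurable_fun [set: GR * GR] (fun p : GR * GR => V (complex_of_pair p)).
  exact: (measurable_torus_fun isL VE (measurable_psi_gap r h0)).
have iV : (area R).-integrable (fundamental_parallelogram L) (fun p => V (complex_of_pair p)).
  apply/integrableP; split; first exact: measurable_funTS.
  have E : \int[area R]_(p in fundamental_parallelogram L) `|V (complex_of_pair p)| = torus_integral L V.
    apply: eq_integral => p _; rewrite gee0_abs //.
    by have [s [t ->]] := pt_surj indep (complex_of_pair p); rewrite VE psi_gap_ge0.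
  by rewrite E tV -EFinM ltry.
have aF : area R (fundamental_parallelogram L) = `|basis_det b|%:E by exact: covolumeE.
have int_cst (x : R) : \int[area R]_(p in fundamental_parallelogram L) x%:E = x%:E * `|basis_det b|%:E.
  have := @integral_cst _ _ _ (area R) _ mF x%:E => /= ->.
  by rewrite -aF.
have ic : (area R).-integrable (fundamental_parallelogram L) (fun p => c%:E).
  apply/integrableP; split; first exact: measurable_cst.
  by rewrite (int_cst `|c|%R) -EFinM ltry.
have E : torus_integral L (log_sigma_star L) = c%:E * `|basis_det b|%:E - torus_integral L V.
  rewrite -int_cst /torus_integral -integralB //.
  apply: eq_integral => p _ /=; rewrite /V.
  by case: (log_sigma_star L _) => [x| |] //=; rewrite -!EFinB; congr (_%:E); ring.
rewrite /green_const E tV -!EFinM.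
rewrite covol; congr (_%:E).
rewrite /c; move: (pi : R) (pi_gt0 R) => P P0.
by field; rewrite gt_eqF.
Qed.

(** The additive constant A_Lambda removes the scale constant. *)
Lemma greenE (s t u v : R) : green L (pt b s t) (pt b u v) = lne (psi r h' (s - u) (t - v))%:E.
Proof.
rewrite /green green_constE; have -> : (pt b s t - pt b u v = pt b (s - u) (t - v))%R.
  by rewrite /pt !rmorphB /=; ring.
rewrite log_sigma_star_formula // lne_scale; last exact: psi_ge0.
by case: (lne _) => [x| |] //=; rewrite -!EFinD; congr (_%:E); ring.
Qed.

(** Where a factor vanishes both sides are zero, since the sum has a term -oo and
no term +oo. *)
Lemma expeR_green (N : nat) (beta s t : R) (u v : 'I_N -> R) : (0 < beta)%R ->
  expeR (\sum_(i < N) beta%:E * green L (pt b s t) (pt b (u i) (v i))) =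
  ((\prod_(i < N) psi r h' (s - u i) (t - v i)) `^ beta)%R%:E.
Proof.
move=> b0; under eq_bigr do rewrite greenE.
have [/forallP A|] := boolP [forall i, (0 < psi r h' (s - u i) (t - v i))%R].
  under eq_bigr do rewrite lne_EFin // -EFinM.
  rewrite sumEFin /= -mulr_sumr -ln_prod // /powR gt_eqF //.
  by apply: prodr_gt0.
rewrite negb_forall => /existsP[i Pi].
have P0 : psi r h' (s - u i) (t - v i) = 0%R.
  by apply/eqP; rewrite eq_le psi_ge0 // andbT leNgt.
have -> : (\prod_(j < N) psi r h' (s - u j) (t - v j) = 0)%R by rewrite (bigD1 i) //= P0 mul0r.
by rewrite powR0 ?gt_eqF // (bigD1 i) // P0 le0_lneNy // gt0_muleNy ?lte_fin //.
Qed.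

Lemma packing_term (N : nat) (beta : R) (u v : 'I_N -> R) : (0 < beta)%R ->
  (2 / pi)%R%:E * torus_integral L (fun z => expeR (\sum_(i < N) beta%:E * green L z (pt b (u i) (v i)))) =
  mean (fun s t => ((\prod_(i < N) psi r h' (s - u i) (t - v i)) `^ beta)%R%:E).
Proof.
move=> b0; rewrite (torus_integralE isL (G := fun s t => ((\prod_(i < N) psi r h' (s - u i) (t - v i)) `^ beta)%R%:E)).
- by rewrite muleA normalize_torus mul1e.
- by move=> s t; rewrite -expeR_green.
- exact: (measurable_psi_power r h0 (index_enum 'I_N) (fun i => - u i)%R (fun i => - v i)%R beta).
- by move=> s t; rewrite lee_fin powR_ge0.
Qed.

Lemma packing_ge1 (N : nat) (beta : R) : (0 < beta)%R -> 1 <= packing_number L N beta.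
Proof.
move=> b0; apply/ereal_infP => _ [w _ <-].
have /choice[u Hu] : forall i, exists q : R * R, w i = pt b q.1 q.2.
  by move=> i; have [s [t E]] := pt_surj indep (w i); exists (s, t).
have -> : w = (fun i => pt b (u i).1 (u i).2) by apply/funext.
rewrite (packing_term (fun i => (u i).1) (fun i => (u i).2) b0).
exact: (mean_psi_power_ge1 r h0 (index_enum 'I_N) (fun i => - (u i).1)%R (fun i => - (u i).2)%R b0).
Qed.

Lemma packing_le (N : nat) (beta : R) : (0 < N)%N -> (0 < beta)%R ->
  packing_number L N beta <= (powR (expR (row_bound h')) beta)%:E.
Proof.
move=> N0 b0; have [p Hp] := good_configuration r h0 N0.
have := packing_term (fun i => - (p i).1)%R (fun i => - (p i).2)%R b0.
set G := (X in mean X) => E.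
apply: (@le_trans _ _ (mean G)).
  by apply: ereal_inf_lbound; exists (fun i => pt b (- (p i).1)%R (- (p i).2)%R).
rewrite -[leRHS]mean_cst; apply: mean_le.
- exact: (measurable_psi_power r h0 (index_enum 'I_N) (fun i => - - (p i).1)%R (fun i => - - (p i).2)%R beta).
- exact: measurable_cst.
- by move=> s t; rewrite lee_fin powR_ge0.
- move=> s t; rewrite lee_fin ge0_ler_powR ?nnegrE ?(ltW b0) ?expR_ge0 //.
    by apply: prodr_ge0 => i _; exact: psi_ge0.
  by under eq_bigr do rewrite !opprK.
Qed.
End Green.

Theorem theorem2p3p1 :
  forall (R : realType) (L : set (complex R)),
    is_lattice L ->
    covolume L = (pi / 2)%R%:E ->
    exists K : R, (1 < K)%R /\
      forall (N : nat) (beta : R), (1 <= N)%N -> (0 < beta)%R ->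
        (1 <= packing_number L N beta)%E /\
        (packing_number L N beta <= (powR K beta)%:E)%E.
Proof.
move=> R L isL; rewrite covolumeE // => -[covol].
exists (expR (row_bound (tau_im (basis_of_lattice L)))); split.
  rewrite expR_gt1; apply: row_bound_gt0.
  exact: tau_im_neq0 (basis_of_latticeP isL).1.
move=> N beta N1 b0; split; first exact: packing_ge1.
exact: packing_le.
Qed.
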